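(* Let $r,s\ge2$ and let $F:U\to\mathbb P^{r',s',t'}$ be a local sign-preserving map, where $U\subset\mathbb P^{r,s,t}$ is a connected open set containing a null point. If $r=r'$ or $s=s'$, then $F$ is quasi-standard (standard when $t'=0$).
   Context: Let $r,s,t\ge 0$ be integers with $n=r+s+t>0$. $\mathbb C^{r,s,t}$ denotes $\mathbb C^n$ equipped with the (possibly degenerate, indefinite) Hermitian form $\langle z,w\rangle_{r,s,t}=\sum_{j=1}^{r}z_j\bar w_j-\sum_{j=r+1}^{r+s}z_j\bar w_j$, and $\mathbb P^{r,s,t}$ is its projectivization. A point $[z]$ is positive, negative or null according as $\langle z,z\rangle_{r,s,t}>0$, $<0$ or $=0$. A complex linear subspace $H$ (or $\mathbb PH$) is a null space if the form vanishes identically on $H$. A holomorphic map $F:U\to\mathbb P^{r',s',t'}$ on a connected open set $U$ containing a null point is sign-preserving if it maps positive points to positive points and negative points to negative points. $F$ is linear if it extends to a rational map induced by a linear map $\mathbb C^{r+s+t}\to\mathbb C^{r'+s'+t'}$; standard if it is induced by a linear isometry $\mathbb C^{r,s,t}\to\mathbb C^{r',s',t'}$ (a linear map $L$ with $\langle Lu,Lv\rangle_{r',s',t'}=\langle u,v\rangle_{r,s,t}$); null if $F(U)$ is contained in a null space. $F$ is quasi-standard if either $F$ is standard, or there is a decomposition $\mathbb C^{r',s',t'}=A\oplus B$ into nonzero subspaces with $\langle a,b\rangle_{r',s',t'}=0$ for all $a\in A,b\in B$ such that $\pi_A\circ F$ is standard and $\pi_B\circ F$ is null, where $\pi_A:\mathbb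 P^{r',s',t'}\dashrightarrow\mathbb PA$, $\pi_B:\mathbb P^{r',s',t'}\dashrightarrow\mathbb PB$ are induced by the linear projections, and $\mathbb PA,\mathbb PB$ carry the restricted forms. *)

(* Defs.v *)
(* Complex numbers: C := R[i]^o for an arbitrary R : realType (real_closed's
   complex numbers; the ^o copy carries MathComp-Analysis's normed/topological
   structure, so 'rV[C]_n is a normedModType over C with the standard topology). *)
From mathcomp Require Import all_boot all_order all_algebra.
From mathcomp Require Import all_classical all_reals all_analysis.
From mathcomp.real_closed Require Import complex.
Import GRing.Theory Num.Theory numFieldNormedType.Exports numFieldTopology.Exports.

Set Implicit Arguments.
Unset Strict Implicit.
Unset Printing Implicit Defensive.

Local Open Scope ring_scope.
Local Open Scope classical_set_scope.

(* C^n as row vectors *)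
Notation Cvec R n := 'rV[(R[i])^o]_n.

(* sign of the j-th coordinate in C^{r,s,t} *)
Definition hsign (R : realType) (r s j : nat) : (R[i])^o :=
  if (j < r)%N then 1 else if (j < r + s)%N then -1 else 0.

(* <z,w>_{r,s,t} = sum_{j<r} z_j conj(w_j) - sum_{r<=j<r+s} z_j conj(w_j) *)
Definition herm (R : realType) (r s t : nat) (z w : Cvec R (r + s + t)) : (R[i])^o :=
  \sum_(j < r + s + t) hsign R r s j * (z 0 j * (w 0 j)^*).

(* u and v represent the same projective point (up to a nonzero scalar) *)
Definition proj_eq (R : realType) (n : nat) (u v : Cvec R n) : Prop :=
  exists c : (R[i])^o, c != 0 /\ u = c *: v.

(* An open subset of P^{n-1} is represented by its cone in C^n \ {0}. *)
Definition is_cone (R : realType) (n : nat) (U : set (Cvec R n)) : Prop :=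
  (forall z, U z -> z != 0) /\
  (forall z (c : (R[i])^o), U z -> c != 0 -> U (c *: z)).

(* F : 'rV_n -> 'rV_n' gives, for every z in the cone U, a nonzero
   representative F z of the image point, compatibly with scaling, i.e. a map
   P(U) -> P^{n'-1}. *)
Definition is_proj_map (R : realType) (n n' : nat) (U : set (Cvec R n))
    (F : Cvec R n -> Cvec R n') : Prop :=
  (forall z, U z -> F z != 0) /\
  (forall z (c : (R[i])^o), U z -> c != 0 -> proj_eq (F (c *: z)) (F z)).

(* Holomorphy of a map into projective space: locally it admits a
   holomorphic (complex-differentiable) nonvanishing lift. *)
Definition proj_holomorphic (R : realType) (n n' : nat) (U : set (Cvec R n))
    (F : Cvec R n -> Cvec R n') : Prop :=
  forall z0, U z0 ->
    exists (V : set (Cvec R n)) (f : Cvec R n -> Cvec R n'),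
      [/\ open V, V z0, V `<=` U &
          forall z, V z -> [/\ differentiable f z, f z != 0 & proj_eq (F z) (f z)]].

(* sign-preserving: positive points to positive, negative to negative *)
Definition sign_preserving (R : realType) (r s t r' s' t' : nat)
    (U : set (Cvec R (r + s + t))) (F : Cvec R (r + s + t) -> Cvec R (r' + s' + t')) : Prop :=
  forall z, U z ->
    (0 < herm z z -> 0 < herm (F z) (F z)) /\
    (herm z z < 0 -> herm (F z) (F z) < 0).

(* linear isometry C^{r,s,t} -> C^{r',s',t'} (as a matrix acting on rows) *)
Definition lin_isometry (R : realType) (r s t r' s' t' : nat)
    (L : 'M[(R[i])^o]_(r + s + t, r' + s' + t')) : Prop :=
  forall u v : Cvec R (r + s + t), herm (u *m L) (v *m L) = herm u v.

(* F is standard: it agrees with the (rational) map [z] |-> [z L] induced by a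
   linear isometry L, wherever the latter is defined. *)
Definition standard (R : realType) (r s t r' s' t' : nat)
    (U : set (Cvec R (r + s + t))) (F : Cvec R (r + s + t) -> Cvec R (r' + s' + t')) : Prop :=
  exists L : 'M[(R[i])^o]_(r + s + t, r' + s' + t'),
    lin_isometry L /\
    forall z, U z -> z *m L != 0 -> proj_eq (F z) (z *m L).

(* quasi-standard: standard, or an orthogonal decomposition C^{r',s',t'} = A (+) B
   into nonzero subspaces (row spaces of square matrices A, B) such that
   pi_A o F is standard (induced by a linear isometry into A with the restricted
   form) and pi_B o F is null (image in a null subspace N of B). *)
Definition quasi_standard (R : realType) (r s t r' s' t' : nat)
    (U : set (Cvec R (r + s + t))) (F : Cvec R (r + s + t) -> Cvec R (r' + s' + t')) : Prop :=
  standard U F \/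
  exists A B : 'M[(R[i])^o]_(r' + s' + t'),
    [/\ [/\ mxdirect (A + B), (A + B == 1%:M)%MS, A != 0 & B != 0],
        (forall a b : Cvec R (r' + s' + t'),
            (a <= A)%MS -> (b <= B)%MS -> herm a b = 0),
        (exists L : 'M[(R[i])^o]_(r + s + t, r' + s' + t'),
            [/\ (L <= A)%MS, lin_isometry L &
                forall z, U z -> F z *m proj_mx A B != 0 -> z *m L != 0 ->
                  proj_eq (F z *m proj_mx A B) (z *m L)])
      & (exists N : 'M[(R[i])^o]_(r' + s' + t'),
            [/\ (N <= B)%MS,
                (forall u v : Cvec R (r' + s' + t'),
                    (u <= N)%MS -> (v <= N)%MS -> herm u v = 0) &
                forall z, U z -> (F z *m proj_mx B A <= N)%MS])].

(* Main.v *)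
Require Import Defs.
From mathcomp Require Import all_boot all_order all_algebra.
From mathcomp Require Import all_classical all_reals all_analysis.
From mathcomp.real_closed Require Import complex.
From mathcomp Require Import ring lra.
Import Order.TTheory GRing.Theory Num.Theory numFieldNormedType.Exports numFieldTopology.Exports.
Set Implicit Arguments.
Unset Strict Implicit.
Unset Printing Implicit Defensive.
Local Open Scope ring_scope.
Local Open Scope classical_set_scope.

(* Near a null point take a holomorphic lift f of F and drop its radical
   coordinates. Polarizing along holomorphic curves of null vectors, f preserves
   orthogonality. When r = r', choose r - 2 orthogonal positive vectors
   orthogonal to a null line: their images leave only a plane for the image of
   that line, so f maps null lines into lines. A function holomorphic along
   complex lines that vanishes wherever an indefinite real function vanishes is
   zero; hence f also maps degenerate lines, and then all lines through a fixed
   positive point z, into lines. Thus f(x) is a combination of f(z) and T0 x,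
   where T0 is the differential at z projected orthogonally to f(z).
   Orthogonality makes T0 conformal on the complement of z and determines the
   ratio of the two coefficients, so f is parallel to a linear similarity L; the
   identity theorem and connectedness extend this from a small ball to U.
   The case s = s' follows by changing the sign of both forms. The identity
   theorem rests on the maximum principle, and the latter on Goursat's bisection
   argument applied in polar coordinates. *)

(** Holomorphy means complex differentiability at each point, with no continuity of the derivative,
    so the identity theorem has to be reached without power series; the maximum principle therefore
    tolerates finitely many points of mere continuity. Linear dependence of images is expressed by
    minors: they are holomorphic in the points, so a relation that geometry gives only on a real
    hypersurface spreads by the identity theorem. The differential is taken at a positive z, not at
    the null point, because f(z) is then not null and the target splits orthogonally along it,
    whatever its index and radical. The equality r = r' enters through a count: r - 2 positive
    images and three points of a null line are r + 1 vectors against r' positive coordinates.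
    Orthogonality determines the coefficients in f(x) only up to phases at a single point; comparing
    them at pairs of orthogonal points fixes the phase. The form does not see the radical
    coordinates of F, which is where the null summand comes from. *)

(* [case/(_ _)/Wrap] turns the first premise of the top assumption into a goal
   without destructing its conclusion. *)
Variant wrapped (P : Prop) : Prop := Wrap of P.

(** * Goursat's theorem for real 1-forms *)

Lemma ltr_divn (R : realFieldType) (a : R) (m : nat) : 0 < a -> (1 < m)%N -> (a / m%:R < a) = true.
Proof. by move=> a0 m1; rewrite ltr_pdivrMr ?ltr0n 1?ltnW // ltr_pMr // ltr1n. Qed.

Section RealGoursat.
Variable R : realType.
Implicit Types (phi psi : R -> R) (a b c d x y : R).

(** An integral is the increment of a two-sided primitive: additivity is then algebra and estimates
    follow from the mean value theorem. Measure theory enters only through the existence of a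
    primitive. *)
Definition is_int phi a b (I : R) := exists Phi : R -> R,
  (forall x, a <= x <= b -> is_derive x 1 Phi (phi x)) /\ I = Phi b - Phi a.

Lemma exists_primitive phi (K : R) : 0 < K -> continuous phi ->
  exists Phi : R -> R, forall x, - K < x < K -> is_derive x 1 Phi (phi x).
Proof.
move=> K0 cphi.
have key (F : R -> R) (x l : R) : derivable F x 1 /\ F^`() x = l -> is_derive x 1 F l.
  by move=> [h1 h2]; apply: DeriveDef => //; rewrite -derive1E.
exists (fun x => \int[lebesgue_measure]_(t in [set` Interval (BLeft (- K)) (BRight x)]) phi t)%R.
move=> x /andP[x1 x2]; apply: key.
apply: (@continuous_FTC1 R phi (BLeft (- K)) x K x2).
- apply: continuous_compact_integrable; first exact: segment_compact.
  by apply: continuous_subspaceT.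
- by [].
- exact: cphi.
Qed.

Lemma is_int_exists phi a b : a <= b ->
  (forall x, a <= x <= b -> {for x, continuous phi}) -> exists I, is_int phi a b I.
Proof.
move=> ab hc.
(* Clamping to [a, b] gives a function continuous on the whole line, whose primitive is
   differentiable from both sides even at a and b. *)
pose cl : R -> R := cst a \max (id \min cst b).
have clab x : a <= cl x <= b.
  by rewrite /cl /= le_max lexx /= ge_max ab ge_min lexx orbT.
have cid x : a <= x <= b -> cl x = x.
  by move=> /andP[ax xb]; rewrite /cl /= (min_idPl xb) (max_idPr ax).
have ccl : continuous cl.
  move=> x; apply: continuous_max; first exact: cst_continuous.
  by apply: continuous_min; [exact: cvg_id|exact: cst_continuous].
have cphi : continuous (phi \o cl).
  move=> x; apply: continuous_comp; first exact: ccl.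
  exact: hc.
have [|Phi hPhi] := @exists_primitive _ (`|a| + `|b| + 1) _ cphi.
  by rewrite ltr_pwDr // addr_ge0.
exists (Phi b - Phi a), Phi; split=> // x xab.
have := hPhi x; rewrite /= cid //; apply.
case/andP: xab => ax xb.
have := ler_norm b; have := ler_norm (- a).
rewrite normrN => h2 h3.
have h4 := normr_ge0 a; have h5 := normr_ge0 b.
by apply/andP; split; lra.
Qed.

Lemma is_int_near phi psi a b (I J e : R) : a <= b ->
  is_int phi a b I -> is_int psi a b J ->
  (forall x, a <= x <= b -> `|phi x - psi x| <= e) -> `|I - J| <= e * (b - a).
Proof.
move=> ab'; have [ab| |<-] := ltgtP a b; last 2 first.
- by rewrite ltNge ab'.
- by move=> [F [_ ->]] [G [_ ->]] _; rewrite !subrr normr0 mulr0.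
move=> [F [hF ->]] [G [hG ->]] he.
have hd x : a <= x <= b -> is_derive x 1 (F - G) (phi x - psi x).
  by move=> xab; apply: is_deriveB; [exact: hF|exact: hG].
have [||z zab hz] := @MVT R (F - G) (fun x => phi x - psi x) a b ab.
- by move=> x; rewrite in_itv /= => /andP[/ltW h1 /ltW h2]; apply: hd; rewrite h1.
- apply: derivable_within_continuous => x; rewrite in_itv /= => xab.
  by have [] := hd x xab.
have -> : F b - F a - (G b - G a) = (F - G) b - (F - G) a.
  by rewrite !fctE; ring.
rewrite hz normrM (@ger0_norm _ (b - a)) ?subr_ge0//.
apply: ler_wpM2r; first by rewrite subr_ge0 ltW.
apply: he; move: zab; rewrite in_itv /= => /andP[/ltW -> /ltW ->] //.
Qed.

Lemma is_int_unique phi a b (I J : R) : a <= b ->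
  is_int phi a b I -> is_int phi a b J -> I = J.
Proof.
move=> ab hI hJ; apply/eqP; rewrite -subr_eq0 -normr_le0.
have := @is_int_near phi phi a b I J 0 ab hI hJ; rewrite mul0r; apply.
by move=> x _; rewrite subrr normr0.
Qed.

Lemma is_int_cat phi a b c (I J : R) : a <= b -> b <= c ->
  is_int phi a c I -> is_int phi a b J -> is_int phi b c (I - J).
Proof.
move=> ab bc [F [hF ->]] hJ; exists F; split.
  by move=> x /andP[h1 h2]; apply: hF; rewrite h2 (le_trans ab h1).
have -> : J = F b - F a; last by ring.
apply: (@is_int_unique phi a b) => //; exists F; split=> // x /andP[h1 h2].
by apply: hF; rewrite h1 (le_trans h2 bc).
Qed.

Lemma is_int_affine (al be x0 : R) a b :
  is_int (fun x => al + be * (x - x0)) a b (al * (b - a) + be * ((b - x0) ^+ 2 - (a - x0) ^+ 2) / 2).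
Proof.
exists (fun x => al * x + be / 2 * (x - x0) ^+ 2); split; last by field.
move=> x _; apply: is_derive_eq.
by rewrite /GRing.scale /=; field.
Qed.

Definition intg phi a b : R := xget 0 [set I | is_int phi a b I].

Lemma intgP phi a b : (exists I, is_int phi a b I) -> is_int phi a b (intg phi a b).
Proof. by move=> h; rewrite /intg; case: xgetP => //= /(_ _ _) hn; case: h => I /hn. Qed.

Lemma intgE phi a b I : a <= b -> is_int phi a b I -> intg phi a b = I.
Proof. by move=> ab hI; apply: (@is_int_unique phi a b) => //; apply: intgP; exists I. Qed.

Definition diff2 (P : R -> R -> R) x y (A B : R) := forall e : R, 0 < e ->
  exists2 dl : R, 0 < dl & forall h k, `|h| < dl -> `|k| < dl ->
    `|P (x + h) (y + k) - P x y - A * h - B * k| <= e * (`|h| + `|k|).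

Lemma diff2_continuousl P x y A B : diff2 P x y A B -> {for x, continuous (P^~ y)}.
Proof.
move=> hd; apply/cvgrPdist_le => /= e e0.
have [dl dl0 h] := hd 1 ltr01.
have A1 : 0 < 1 + `|A| by rewrite ltr_pwDl.
near=> z.
have hz1 : `|z - x| < dl by rewrite distrC; near: z; exact: cvgr_dist_lt.
have hz2 : `|z - x| <= e / (1 + `|A|).
  by rewrite distrC; near: z; apply: cvgr_dist_le => //; rewrite divr_gt0.
have := h (z - x) 0 hz1; rewrite normr0 => /(_ dl0).
rewrite subrKC addr0 mulr0 subr0 addr0 mul1r => h2.
rewrite distrC.
have -> : P z y - P x y = (P z y - P x y - A * (z - x)) + A * (z - x) by rewrite subrK.
apply: le_trans (ler_normD _ _) _; rewrite normrM.
apply: le_trans (lerD h2 (lexx _)) _.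
by rewrite -[X in X + _]mul1r -mulrDl mulrC -ler_pdivlMr.
Unshelve. all: by end_near. Qed.

Lemma diff2_swap P x y A B : diff2 P x y A B -> diff2 (fun u v => P v u) y x B A.
Proof.
move=> hd e e0; have [dl dl0 h] := hd e e0; exists dl => // k' h' hk hh.
by have := h h' k' hh hk; rewrite (addrC `|h'|) -!addrA (addrC (- (A * h'))).
Qed.

Lemma diff2_continuousr P x y A B : diff2 P x y A B -> {for y, continuous (P x)}.
Proof. by move=> /diff2_swap /diff2_continuousl. Qed.

Lemma dist_le_length (X u x x' : R) : X <= x <= X + u -> X <= x' <= X + u -> `|x' - x| <= u.
Proof. by move=> /andP[? ?] /andP[? ?]; rewrite ler_norml; apply/andP; split; lra. Qed.

(* Goursat's bisection argument for the form P dx + Q dy, which is closed at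
   every point but need not have continuous derivatives. *)
Section Rectangle.
Variables (P Q : R -> R -> R) (a0 b0 c0 d0 : R).
Hypotheses (ab0 : a0 <= b0) (cd0 : c0 <= d0).
Hypothesis closedPQ : forall x y, a0 <= x <= b0 -> c0 <= y <= d0 ->
  exists A B D, diff2 P x y A B /\ diff2 Q x y B D.

Let circ a b c d := intg (P^~ c) a b + intg (Q b) c d - intg (P^~ d) a b - intg (Q a) c d.

Let inP a b y : a0 <= a -> a <= b -> b <= b0 -> c0 <= y <= d0 ->
  is_int (P^~ y) a b (intg (P^~ y) a b).
Proof.
move=> h1 h2 h3 hy; apply: intgP; apply: is_int_exists => // x /andP[x1 x2].
have [|A [B [D [+ _]]]] := @closedPQ x y _ hy; last exact: diff2_continuousl.
by rewrite (le_trans h1) // (le_trans x2).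
Qed.

Let inQ c d x : c0 <= c -> c <= d -> d <= d0 -> a0 <= x <= b0 ->
  is_int (Q x) c d (intg (Q x) c d).
Proof.
move=> h1 h2 h3 hx; apply: intgP; apply: is_int_exists => // y /andP[y1 y2].
have [|A [B [D [_]]]] := @closedPQ x y hx; last exact: diff2_continuousr.
by rewrite (le_trans h1) // (le_trans y2).
Qed.

Let catP a m b y : a0 <= a -> a <= m -> m <= b -> b <= b0 -> c0 <= y <= d0 ->
  intg (P^~ y) a b = intg (P^~ y) a m + intg (P^~ y) m b.
Proof.
move=> h1 h2 h3 h4 hy.
have ib := @inP a b y h1 (le_trans h2 h3) h4 hy.
have im := @inP a m y h1 h2 (le_trans h3 h4) hy.
by rewrite (intgE h3 (is_int_cat h2 h3 ib im)); ring.
Qed.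

Let catQ c m d x : c0 <= c -> c <= m -> m <= d -> d <= d0 -> a0 <= x <= b0 ->
  intg (Q x) c d = intg (Q x) c m + intg (Q x) m d.
Proof.
move=> h1 h2 h3 h4 hx.
have ib := @inQ c d x h1 (le_trans h2 h3) h4 hx.
have im := @inQ c m x h1 h2 (le_trans h3 h4) hx.
by rewrite (intgE h3 (is_int_cat h2 h3 ib im)); ring.
Qed.

Let circ_split a m b c k d : a0 <= a -> a <= m -> m <= b -> b <= b0 ->
  c0 <= c -> c <= k -> k <= d -> d <= d0 ->
  circ a b c d = circ a m c k + circ m b c k + circ a m k d + circ m b k d.
Proof.
move=> h1 h2 h3 h4 k1 k2 k3 k4.
have mb : a0 <= m <= b0 by rewrite (le_trans h1) // (le_trans h3).
have bb : a0 <= b <= b0 by rewrite h4 (le_trans h1) // (le_trans h2).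
have aa : a0 <= a <= b0 by rewrite h1 (le_trans h2) // (le_trans h3).
have cc : c0 <= c <= d0 by rewrite k1 (le_trans k2) // (le_trans k3).
have dd : c0 <= d <= d0 by rewrite k4 (le_trans k1) // (le_trans k2).
rewrite /circ (@catP a m b c) // (@catP a m b d) // (@catQ c k d a) // (@catQ c k d b) //.
ring.
Qed.

Let w := b0 - a0.
Let h := d0 - c0.

Let sub_rect (s : R * R) (n : nat) :=
  [/\ a0 <= s.1, s.1 + w / 2 ^+ n <= b0, c0 <= s.2 & s.2 + h / 2 ^+ n <= d0].
Let circn (s : R * R) (n : nat) :=
  circ s.1 (s.1 + w / 2 ^+ n) s.2 (s.2 + h / 2 ^+ n).

Let good (s : R * R) (n : nat) (s' : R * R) := sub_rect s' n.+1 /\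
  [/\ `|circn s n| <= 4 * `|circn s' n.+1|,
  s.1 <= s'.1, s'.1 + w / 2 ^+ n.+1 <= s.1 + w / 2 ^+ n,
  s.2 <= s'.2 & s'.2 + h / 2 ^+ n.+1 <= s.2 + h / 2 ^+ n].

Let wn n : 0 <= w / 2 ^+ n.
Proof. by rewrite divr_ge0 ?subr_ge0 ?exprn_ge0. Qed.
Let hn n : 0 <= h / 2 ^+ n.
Proof. by rewrite divr_ge0 ?subr_ge0 ?exprn_ge0. Qed.
Let wS n : w / 2 ^+ n = w / 2 ^+ n.+1 + w / 2 ^+ n.+1.
Proof. by rewrite exprS; field; rewrite expf_neq0 ?pnatr_eq0. Qed.
Let hS n : h / 2 ^+ n = h / 2 ^+ n.+1 + h / 2 ^+ n.+1.
Proof. by rewrite exprS; field; rewrite expf_neq0 ?pnatr_eq0. Qed.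

(** The circulations of the four quarters add up to that of the rectangle, so they cannot all be
    smaller in modulus than a quarter of it. *)
Let bisect s n : sub_rect s n -> exists s', good s n s'.
Proof.
case: s => x y [/= h1 h2 h3 h4].
have w0 := wn n.+1; have v0 := hn n.+1; have w2 := wS n; have v2 := hS n.
set u := w / 2 ^+ n.+1 in w0 w2 *; set v := h / 2 ^+ n.+1 in v0 v2 *.
have := @circ_split x (x + u) (x + w / 2 ^+ n) y (y + v) (y + h / 2 ^+ n) h1.
rewrite w2 v2 in h2 h4 *.
do 7 (case/(_ _)/Wrap; first by lra).
set J := circ _ _ _ _; set J1 := circ x _ y _; set J2 := circ _ _ y _.
set J3 := circ x _ _ _; set J4 := circ (x + u) _ (y + v) _ => -[JE].
have tri : `|J| <= `|J1| + `|J2| + `|J3| + `|J4|.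
  by rewrite JE; do 2 (apply: le_trans (ler_normD _ _) _; apply: lerD => //); exact: ler_normD.
have E s : circn s n.+1 = circ s.1 (s.1 + u) s.2 (s.2 + v) by [].
have En : circn (x, y) n = J by rewrite /circn /= w2 v2.
have K1 : good (x, y) n (x, y) \/ 4 * `|J1| < `|J|.
  case: (leP `|J| (4 * `|J1|)) => hJ; [left|by right].
  by rewrite /good /sub_rect /= En E /= -/u -/v w2 v2; do 2 split=> //; lra.
have K2 : good (x, y) n (x + u, y) \/ 4 * `|J2| < `|J|.
  case: (leP `|J| (4 * `|J2|)) => hJ; [left|by right].
  rewrite /good /sub_rect /= En E /= -/u -/v w2 v2; do 2 split=> //; try lra.
  by rewrite -addrA.
have K3 : good (x, y) n (x, y + v) \/ 4 * `|J3| < `|J|.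
  case: (leP `|J| (4 * `|J3|)) => hJ; [left|by right].
  rewrite /good /sub_rect /= En E /= -/u -/v w2 v2; do 2 split=> //; try lra.
  by rewrite -addrA.
have K4 : good (x, y) n (x + u, y + v) \/ 4 * `|J4| < `|J|.
  case: (leP `|J| (4 * `|J4|)) => hJ; [left|by right].
  rewrite /good /sub_rect /= En E /= -/u -/v w2 v2; do 2 split=> //; try lra.
  by rewrite -!addrA.
case: K1 => [|L1]; first by exists (x, y).
case: K2 => [|L2]; first by exists (x + u, y).
case: K3 => [|L3]; first by exists (x, y + v).
case: K4 => [|L4]; first by exists (x + u, y + v).
lra.
Qed.

Let step s n := xget s [set s' | good s n s'].
Fixpoint corner n : R * R := if n is k.+1 then step (corner k) k else (a0, c0).

Let corner_sub n : sub_rect (corner n) n.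
Proof.
elim: n => [|n IH]; first by rewrite /sub_rect /= expr0 !divr1 /w /h; split=> //; lra.
rewrite /= /step; case: xgetP => [s' -> []//|hn'].
by have [s' /hn'] := bisect IH.
Qed.

Let corner_good n : good (corner n) n (corner n.+1).
Proof.
rewrite /= /step; case: xgetP => [s' -> //|hn'].
by have [s' /hn'] := bisect (corner_sub n).
Qed.

Let corner_mono m n : (m <= n)%N -> [/\ (corner m).1 <= (corner n).1,
  (corner n).1 + w / 2 ^+ n <= (corner m).1 + w / 2 ^+ m,
  (corner m).2 <= (corner n).2 &
  (corner n).2 + h / 2 ^+ n <= (corner m).2 + h / 2 ^+ m].
Proof.
move=> /subnK <-; elim: (n - m)%N => [|k [h1 h2 h3 h4]]; first by rewrite add0n; split.
have [_ [_ g1 g2 g3 g4]] := corner_good (k + m); rewrite addSn.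
by split; [exact: le_trans h1 g1|exact: le_trans g2 h2|exact: le_trans h3 g3|exact: le_trans g4 h4].
Qed.

(** By nesting every left edge lies to the left of every right edge, so the suprema of the lower
    left corners belong to all the rectangles. *)
Let limit : exists x y, forall n, [/\ (corner n).1 <= x, x <= (corner n).1 + w / 2 ^+ n,
  (corner n).2 <= y & y <= (corner n).2 + h / 2 ^+ n].
Proof.
have hb m n : (corner m).1 <= (corner n).1 + w / 2 ^+ n /\ (corner m).2 <= (corner n).2 + h / 2 ^+ n.
  have wm := wn m; have wn' := wn n; have hm := hn m; have hn' := hn n.
  case/orP: (leq_total m n) => /corner_mono[h1 h2 h3 h4]; split; lra.
pose S1 := [set (corner n).1 | n in [set: nat]]; pose S2 := [set (corner n).2 | n in [set: nat]].
have hs1 : has_sup S1.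
  split; first by exists (corner 0).1, 0%N.
  by exists ((corner 0).1 + w / 2 ^+ 0) => _ [m _ <-]; have [] := hb m 0%N.
have hs2 : has_sup S2.
  split; first by exists (corner 0).2, 0%N.
  by exists ((corner 0).2 + h / 2 ^+ 0) => _ [m _ <-]; have [] := hb m 0%N.
exists (sup S1), (sup S2) => n; split.
- by apply: ub_le_sup; [case: hs1|exists n].
- by apply: ge_sup; [case: hs1|move=> _ [m _ <-]; have [] := hb m n].
- by apply: ub_le_sup; [case: hs2|exists n].
- by apply: ge_sup; [case: hs2|move=> _ [m _ <-]; have [] := hb m n].
Qed.

Let circ_corner n : `|circ a0 b0 c0 d0| <= 4 ^+ n * `|circn (corner n) n|.
Proof.
elim: n => [|n IH].
  rewrite expr0 mul1r /circn /= expr0 !divr1 /w /h.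
  by rewrite !subrKC.
apply: le_trans IH _; have [_ [g1 _ _ _ _]] := corner_good n.
by rewrite exprSr -mulrA ler_wpM2l // exprn_ge0.
Qed.

(** At the common point of the nested rectangles P and Q are affine up to e times the side lengths,
    and the affine part has zero circulation since the y-derivative of P is the x-derivative of Q.
    The error is quadratic in the sides, which balances the factor [4 ^+ n]. *)
Lemma goursat_rectangle :
  intg (P^~ c0) a0 b0 + intg (Q b0) c0 d0 - intg (P^~ d0) a0 b0 - intg (Q a0) c0 d0 = 0.
Proof.
rewrite -/(circ a0 b0 c0 d0); apply/eqP; rewrite -normr_le0; apply/ler_addgt0Pl => eta eta0.
rewrite addr0.
have [x [y hxy]] := limit.
have [h1 h2 h3 h4] := hxy 0%N; rewrite /= expr0 !divr1 /w /h in h1 h2 h3 h4.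
have hx : a0 <= x <= b0 by apply/andP; split; lra.
have hy : c0 <= y <= d0 by apply/andP; split; lra.
have [A [B [D [dP dQ]]]] := closedPQ hx hy.
pose L := w + h; have w0 : 0 <= w by rewrite subr_ge0.
have h0 : 0 <= h by rewrite subr_ge0.
have L0 : 0 <= L by rewrite addr_ge0.
(* [2 * L ^+ 2] is the factor in the final error bound; adding 1 keeps the divisor positive for a
   rectangle reduced to a point. *)
have L1 : 0 < 2 * L ^+ 2 + 1 by rewrite ltr_pwDr // mulr_ge0 // exprn_ge0.
pose e := eta / (2 * L ^+ 2 + 1); have e0 : 0 < e by rewrite divr_gt0.
have [dp dp0 hP] := dP e e0; have [dq dq0 hQ] := dQ e e0.
pose dl := Num.min dp dq; have dl0 : 0 < dl by rewrite lt_min dp0.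
have [n hn1] : exists n, L / 2 ^+ n < dl.
  have [n hn1] : exists n : nat, L / dl < n%:R.
    have := Num.Theory.archi_boundP (divr_ge0 L0 (ltW dl0)).
    by move=> hb; eexists; exact: hb.
  exists n; rewrite ltr_pdivrMr ?exprn_gt0 // mulrC -ltr_pdivrMr //.
  apply: lt_trans hn1 _; rewrite -natrX ltr_nat; exact: ltn_expl.
have [g1 g2 g3 g4] := hxy n; have [s1 s2 s3 s4] := corner_sub n.
have wn0 := wn n; have hn0 := hn n.
have Ln : L / 2 ^+ n = w / 2 ^+ n + h / 2 ^+ n by rewrite /L mulrDl.
set X := (corner n).1 in g1 g2 s1 s2; set Y := (corner n).2 in g3 g4 s3 s4.
set u := w / 2 ^+ n in wn0 g2 s2 Ln; set v := h / 2 ^+ n in hn0 g4 s4 Ln.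
have cP := circ_corner n.
pose eu := e * (u + v).
have bnd T A' B' : (forall h k, `|h| < dl -> `|k| < dl ->
    `|T (x + h) (y + k) - T x y - A' * h - B' * k| <= e * (`|h| + `|k|)) ->
    forall x' y', X <= x' <= X + u -> Y <= y' <= Y + v ->
    `|T x' y' - (T x y + A' * (x' - x) + B' * (y' - y))| <= eu.
  move=> hT x' y' hx' hy'.
  have xx : `|x' - x| <= u by apply: (@dist_le_length X) => //; rewrite g1.
  have yy : `|y' - y| <= v by apply: (@dist_le_length Y) => //; rewrite g3.
  have [ud vd] : u < dl /\ v < dl.
    by split; apply: le_lt_trans hn1; rewrite Ln ?lerDl ?lerDr.
  have := hT (x' - x) (y' - y); rewrite !subrKC.
  case/(_ _)/Wrap; first by exact: le_lt_trans xx ud.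
  case/(_ _)/Wrap; first by exact: le_lt_trans yy vd.
  move=> hh; apply: le_trans (le_trans _ hh) _.
    by rewrite le_eqVlt; apply/orP; left; apply/eqP; congr (`| _ |); ring.
  by rewrite /eu ler_pM2l // lerD.
have dlp (z : R) : `|z| < dl -> `|z| < dp by rewrite lt_min => /andP[].
have dlq (z : R) : `|z| < dl -> `|z| < dq by rewrite lt_min => /andP[].
have {}hP := @bnd P A B (fun h k hh hk => hP h k (dlp h hh) (dlp k hk)).
have {}hQ := @bnd Q B D (fun h k hh hk => hQ h k (dlq h hh) (dlq k hk)).
have XX : X <= X + u by rewrite lerDl.
have YY : Y <= Y + v by rewrite lerDl.
have nP t : Y <= t <= Y + v -> `|intg (P^~ t) X (X + u) -
    ((P x y + B * (t - y)) * (X + u - X) + A * ((X + u - x) ^+ 2 - (X - x) ^+ 2) / 2)| <= eu * u.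
  move=> ht; have -> : eu * u = eu * (X + u - X) by congr (_ * _); ring.
  apply: is_int_near (is_int_affine _ _ x _ _) _ => //.
    by apply: inP => //; case/andP: ht => t1 t2; rewrite (le_trans s3 t1) (le_trans t2 s4).
  by move=> x' hx'; rewrite -addrA (addrC (B * _)) addrA; exact: hP.
have nQ t : X <= t <= X + u -> `|intg (Q t) Y (Y + v) -
    ((Q x y + B * (t - x)) * (Y + v - Y) + D * ((Y + v - y) ^+ 2 - (Y - y) ^+ 2) / 2)| <= eu * v.
  move=> ht; have -> : eu * v = eu * (Y + v - Y) by congr (_ * _); ring.
  apply: is_int_near (is_int_affine _ _ y _ _) _ => //.
    by apply: inQ => //; case/andP: ht => t1 t2; rewrite (le_trans s1 t1) (le_trans t2 s2).
  by move=> y' hy'; exact: hQ.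
have n1 := nP Y; rewrite lexx YY in n1; have {}n1 := n1 isT.
have n2 := nP (Y + v); rewrite lexx YY in n2; have {}n2 := n2 isT.
have n3 := nQ X; rewrite lexx XX in n3; have {}n3 := n3 isT.
have n4 := nQ (X + u); rewrite lexx XX in n4; have {}n4 := n4 isT.
have Jn : `|circn (corner n) n| <= 2 * e * (u + v) ^+ 2.
  rewrite /circn -/X -/Y -/u -/v /circ.
  move: n1 n2 n3 n4; set I1 := intg _ _ _; set I2 := intg _ _ _.
  set I3 := intg _ _ _; set I4 := intg _ _ _.
  set J1 := (X in `|I1 - X|); set J2 := (X in `|I2 - X|).
  set J3 := (X in `|I3 - X|); set J4 := (X in `|I4 - X|) => n1 n2 n3 n4.
  (* The affine parts J1 + J4 - J2 - J3 cancel because P and Q share the coefficient B. *)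
  have -> : I1 + I4 - I2 - I3 = (I1 - J1) + (I4 - J4) - (I2 - J2) - (I3 - J3).
    by rewrite /J1 /J2 /J3 /J4; field.
  apply: le_trans (ler_normB _ _) _; apply: le_trans (lerD (ler_normB _ _) n3) _.
  apply: le_trans (lerD (lerD (ler_normD _ _) n2) (lexx _)) _.
  apply: le_trans (lerD (lerD (lerD n1 n4) (lexx _)) (lexx _)) _.
  by rewrite /eu le_eqVlt; apply/orP; left; apply/eqP; ring.
apply: le_trans cP _; apply: le_trans (ler_wpM2l (exprn_ge0 _ _) Jn) _ => //.
rewrite -Ln expr_div_n -exprM mulnC exprM -[2 ^+ 2]/(2 * 2) -natrM.
have -> : 4 ^+ n * (2 * e * (L ^+ 2 / (2 * 2)%:R ^+ n)) = 2 * e * L ^+ 2.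
  by field; rewrite expf_neq0.
have -> : 2 * e * L ^+ 2 = eta * (2 * L ^+ 2 / (2 * L ^+ 2 + 1)).
  by rewrite /e; field; rewrite gt_eqF.
by apply: ler_piMr; [exact: ltW|rewrite ler_pdivrMr // mul1r lerDl].
Qed.
End Rectangle.
End RealGoursat.

(** * Complex functions of one variable *)

Section ComplexCalculus.
Variable R : realType.
Notation C := R[i].
Notation nc := (@Normc.normc R).
Implicit Types (z w h l x : C) (f g : C -> C) (e d : R).

Definition rc (a : R) : C := Complex a 0.

Lemma rcM (a b : R) : rc (a * b) = rc a * rc b.
Proof. by apply/eqP; rewrite eq_complex /= !mulr0 mul0r subr0 addr0 !eqxx. Qed.
Lemma rcD (a b : R) : rc (a + b) = rc a + rc b.
Proof. by apply/eqP; rewrite eq_complex /= addr0 !eqxx. Qed.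
Lemma rcN (a : R) : rc (- a) = - rc a.
Proof. by apply/eqP; rewrite eq_complex /= oppr0 !eqxx. Qed.

Lemma ncE z : nc z = Num.sqrt (complex.Re z ^+ 2 + complex.Im z ^+ 2).
Proof. by case: z. Qed.
Lemma ncD z w : nc (z + w) <= nc z + nc w.
Proof. exact: le_normcD. Qed.
Lemma ncN z : nc (- z) = nc z.
Proof. exact: normcN. Qed.
Lemma ncB z w : nc (z - w) <= nc z + nc w.
Proof. by rewrite -(ncN w) ncD. Qed.
Lemma nc_sub z w : nc (z - w) = nc (w - z).
Proof. by rewrite -ncN opprB. Qed.
Lemma nc_ge0 z : 0 <= nc z.
Proof. by rewrite ncE sqrtr_ge0. Qed.
Lemma ncM z w : nc (z * w) = nc z * nc w.
Proof. exact: Normc.normcM. Qed.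
Lemma nc0 : nc 0 = 0. Proof. exact: Normc.normc0. Qed.
Lemma nc1 : nc 1 = 1. Proof. exact: Normc.normc1. Qed.
Lemma nc_eq0 z : (nc z == 0) = (z == 0).
Proof. by apply/eqP/eqP => [/Normc.eq0_normc|->]; rewrite ?nc0. Qed.
Lemma nc_gt0 z : (0 < nc z) = (z != 0).
Proof. by rewrite lt_def nc_ge0 andbT nc_eq0. Qed.
Lemma ncV z : nc z^-1 = (nc z)^-1.
Proof. exact: Normc.normcV. Qed.
Lemma nc_rc (a : R) : nc (rc a) = `|a|.
Proof. by rewrite ncE /= expr0n addr0 sqrtr_sqr. Qed.
Lemma rc_eq0 (a : R) : (rc a == 0) = (a == 0).
Proof. by rewrite eq_complex /= eqxx andbT. Qed.
Lemma nc_Re z : `|complex.Re z| <= nc z.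
Proof. by rewrite ncE -sqrtr_sqr ler_wsqrtr // lerDl sqr_ge0. Qed.
Lemma nc_Im z : `|complex.Im z| <= nc z.
Proof. by rewrite ncE -sqrtr_sqr ler_wsqrtr // lerDr sqr_ge0. Qed.
Lemma nc_le z : nc z <= `|complex.Re z| + `|complex.Im z|.
Proof.
rewrite ncE -[leRHS]ger0_norm ?addr_ge0// -sqrtr_sqr ler_wsqrtr // sqrrD.
rewrite !real_normK ?num_real //.
have := mulr_ge0 (normr_ge0 (complex.Re z)) (normr_ge0 (complex.Im z)); lra.
Qed.
Lemma ncJ z : nc (conjc z) = nc z.
Proof. by rewrite !ncE; case: z => a b /=; rewrite sqrrN. Qed.
Lemma nc_sqr z : nc z ^+ 2 = complex.Re z ^+ 2 + complex.Im z ^+ 2.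
Proof. by rewrite ncE sqr_sqrtr // addr_ge0 ?sqr_ge0. Qed.
Lemma nc_lerB z w : nc z - nc w <= nc (z - w).
Proof. by rewrite lerBlDr; apply: le_trans (ncD _ _); rewrite subrK. Qed.

Definition ccont f z := forall e, 0 < e -> exists2 d, 0 < d &
  forall w, nc (w - z) < d -> nc (f w - f z) < e.

(** Caratheodory's form of complex differentiability: the sum, product and inverse rules become
    identities between slope functions. *)
Definition chol f z := exists phi, ccont phi z /\ exists2 d, 0 < d &
  forall w, nc (w - z) < d -> f w - f z = phi w * (w - z).

Lemma ccont_cst (a : C) z : ccont (fun=> a) z.
Proof. by move=> e e0; exists 1 => // w _; rewrite subrr nc0. Qed.

Lemma ccont_id z : ccont id z.
Proof. by move=> e e0; exists e. Qed.

Lemma ccontD f g z : ccont f z -> ccont g z -> ccont (fun w => f w + g w) z.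
Proof.
move=> cf cg e e0; have e2 : 0 < e / 2 by rewrite divr_gt0.
have [d1 d10 h1] := cf _ e2; have [d2 d20 h2] := cg _ e2.
exists (Num.min d1 d2); first by rewrite lt_min d10.
move=> w; rewrite lt_min => /andP[/h1 k1 /h2 k2].
have -> : f w + g w - (f z + g z) = (f w - f z) + (g w - g z) by ring.
by apply: le_lt_trans (ncD _ _) _; rewrite [e]splitr ltrD.
Qed.

Lemma ccontM f g z : ccont f z -> ccont g z -> ccont (fun w => f w * g w) z.
Proof.
move=> cf cg e e0.
pose m := nc (f z) + nc (g z) + 1.
have m0 : 0 < m by rewrite ltr_pwDr // addr_ge0 ?nc_ge0.
have em : 0 < e / (2 * m) by rewrite divr_gt0 // mulr_gt0.
have [d1 d10 h1] := cf _ em; have [d2 d20 h2] := cg _ em; have [d3 d30 h3] := cg _ ltr01.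
exists (Num.min d1 (Num.min d2 d3)); first by rewrite !lt_min d10 d20.
move=> w; rewrite !lt_min => /and3P[/h1 k1 /h2 k2 /h3 k3].
have -> : f w * g w - f z * g z = (f w - f z) * g w + f z * (g w - g z) by ring.
apply: le_lt_trans (ncD _ _) _; rewrite !ncM.
have gm : nc (g w) <= m.
  rewrite -(subrK (g z) (g w)); apply: le_trans (ncD _ _) _.
  by rewrite /m addrAC lerD // ?(ltW k3) // addrC; have := nc_ge0 (f z); have := ltW k3; lra.
have fm : nc (f z) <= m by rewrite /m; have := nc_ge0 (g z); lra.
have {1}-> : e = e / (2 * m) * m + m * (e / (2 * m)) by field; rewrite gt_eqF.
have j1 : nc (f w - f z) * nc (g w) <= nc (f w - f z) * m by rewrite ler_wpM2l ?nc_ge0.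
have j2 : nc (f w - f z) * m < e / (2 * m) * m by rewrite ltr_pM2r.
apply: ltr_leD; first exact: le_lt_trans j1 j2.
by apply: ler_pM; rewrite ?nc_ge0 // ltW.
Qed.

Lemma ccontN f z : ccont f z -> ccont (fun w => - f w) z.
Proof.
move=> cf e e0; have [d d0 h] := cf e e0; exists d => // w /h.
by rewrite -opprD ncN.
Qed.

Lemma ccontB f g z : ccont f z -> ccont g z -> ccont (fun w => f w - g w) z.
Proof. by move=> cf cg; apply: ccontD => //; exact: ccontN. Qed.

Lemma ccont_neq0 f z : ccont f z -> f z != 0 -> exists2 d, 0 < d &
  forall w, nc (w - z) < d -> nc (f z) / 2 < nc (f w).
Proof.
move=> cf fz; have [|d d0 h] := cf (nc (f z) / 2); first by rewrite divr_gt0 // nc_gt0.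
exists d => // w /h; have := nc_lerB (f z) (f w); rewrite nc_sub; lra.
Qed.

Lemma ccontV f z : ccont f z -> f z != 0 -> ccont (fun w => (f w)^-1) z.
Proof.
move=> cf fz e e0; have [d1 d10 h1] := ccont_neq0 cf fz.
have f0 : 0 < nc (f z) by rewrite nc_gt0.
have [|d2 d20 h2] := cf (e * (nc (f z) ^+ 2 / 2)).
  by rewrite mulr_gt0 // divr_gt0 // exprn_gt0.
exists (Num.min d1 d2); first by rewrite lt_min d10.
move=> w; rewrite lt_min => /andP[/h1 k1 /h2 k2].
have fw : f w != 0 by rewrite -nc_gt0; apply: lt_trans k1; rewrite divr_gt0.
have -> : (f w)^-1 - (f z)^-1 = (f z - f w) / (f w * f z) by field; rewrite fw fz.
rewrite ncM ncV ltr_pdivrMr ?nc_gt0 ?mulf_neq0 // nc_sub.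
apply: lt_trans k2 _; rewrite ltr_pM2l // ncM expr2.
by rewrite mulrAC ltr_pM2r.
Qed.

Lemma ccont_near f g z d : 0 < d -> (forall w, nc (w - z) < d -> f w = g w) -> ccont f z -> ccont g z.
Proof.
move=> d0 fg cf e e0; have [d1 d10 h1] := cf _ e0.
exists (Num.min d d1); first by rewrite lt_min d0.
move=> w; rewrite lt_min => /andP[k1 /h1]; rewrite !fg //.
by rewrite subrr nc0.
Qed.

Lemma chol_near f g z d : 0 < d -> (forall w, nc (w - z) < d -> f w = g w) -> chol f z -> chol g z.
Proof.
move=> d0 fg [phi [cp [d1 d10 h1]]]; exists phi; split=> //.
exists (Num.min d d1); first by rewrite lt_min d0.
move=> w; rewrite lt_min => /andP[k1 /h1 <-]; rewrite !fg //.
by rewrite subrr nc0.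
Qed.

Lemma chol_ccont f z : chol f z -> ccont f z.
Proof.
move=> [phi [cp [d d0 h]]].
apply: (@ccont_near (fun w => phi w * (w - z) + f z) f z d d0).
  by move=> w /h <-; rewrite subrK.
apply: ccontD; last exact: ccont_cst.
apply: ccontM => //; apply: ccontB; [exact: ccont_id|exact: ccont_cst].
Qed.

Lemma chol_cst (a : C) z : chol (fun=> a) z.
Proof. by exists (fun=> 0); split; [exact: ccont_cst|exists 1 => // w _; rewrite subrr mul0r]. Qed.

Lemma chol_id z : chol id z.
Proof. by exists (fun=> 1); split; [exact: ccont_cst|exists 1 => // w _; rewrite mul1r]. Qed.

Lemma cholD f g z : chol f z -> chol g z -> chol (fun w => f w + g w) z.
Proof.
move=> [phi [cp [d1 d10 h1]]] [psi [cq [d2 d20 h2]]].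
exists (fun w => phi w + psi w); split; first exact: ccontD.
exists (Num.min d1 d2); first by rewrite lt_min d10.
by move=> w; rewrite lt_min mulrDl => /andP[/h1 <- /h2 <-]; ring.
Qed.

Lemma cholM f g z : chol f z -> chol g z -> chol (fun w => f w * g w) z.
Proof.
move=> cf cg; have ccg := chol_ccont cg; move: cf cg => [phi [cp [d1 d10 h1]]] [psi [cq [d2 d20 h2]]].
exists (fun w => phi w * g w + f z * psi w); split.
  by apply: ccontD; apply: ccontM => //; exact: ccont_cst.
exists (Num.min d1 d2); first by rewrite lt_min d10.
move=> w; rewrite lt_min => /andP[/h1 k1 /h2 k2].
have -> : (phi w * g w + f z * psi w) * (w - z) = (phi w * (w - z)) * g w + f z * (psi w * (w - z)) by ring.
by rewrite -k1 -k2; ring.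
Qed.

Lemma cholN f z : chol f z -> chol (fun w => - f w) z.
Proof.
move=> hf; apply: (@chol_near (fun w => -1 * f w) _ z 1) => //; first by move=> w _; ring.
by apply: cholM => //; exact: chol_cst.
Qed.

Lemma cholB f g z : chol f z -> chol g z -> chol (fun w => f w - g w) z.
Proof. by move=> cf cg; apply: cholD => //; exact: cholN. Qed.

Lemma cholV f z : chol f z -> f z != 0 -> chol (fun w => (f w)^-1) z.
Proof.
move=> cf fz; have ccf := chol_ccont cf; move: cf => [phi [cp [d1 d10 h1]]].
have [d2 d20 h2] := ccont_neq0 ccf fz.
exists (fun w => - phi w * ((f w)^-1 * (f z)^-1)); split.
  apply: ccontM; first exact: ccontN.
  by apply: ccontM; [exact: ccontV|exact: ccont_cst].
exists (Num.min d1 d2); first by rewrite lt_min d10.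
move=> w; rewrite lt_min => /andP[/h1 k1 /h2 k2].
have fw : f w != 0 by rewrite -nc_gt0; apply: le_lt_trans k2; rewrite divr_ge0 ?nc_ge0.
have -> : - phi w * ((f w)^-1 * (f z)^-1) * (w - z) = - (phi w * (w - z)) * ((f w)^-1 * (f z)^-1) by ring.
by rewrite -k1; field; rewrite fw fz.
Qed.

Lemma chol_sum (I : Type) (r : seq I) (F : I -> C -> C) z :
  (forall i, chol (F i) z) -> chol (fun w => \sum_(i <- r) F i w) z.
Proof.
move=> h; elim: r => [|i r IH].
  by apply: (@chol_near (fun=> 0) _ z 1) => //; [move=> w _; rewrite big_nil|exact: chol_cst].
apply: (@chol_near (fun w => F i w + \sum_(i <- r) F i w) _ z 1) => //.
  by move=> w _; rewrite big_cons.
exact: cholD.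
Qed.

(** Reflection in the real axis; polarization needs it to make sesquilinear expressions in f(y) and
    f at the conjugate of y holomorphic. *)
Lemma chol_conj f z : chol f z -> chol (fun w => conjc (f (conjc w))) (conjc z).
Proof.
move=> [phi [cp [d d0 h]]]; exists (fun w => conjc (phi (conjc w))).
have E w : nc (conjc w - z) = nc (w - conjc z).
  by rewrite -ncJ rmorphB /= conjcK.
split.
  move=> e e0; have [d1 d10 h1] := cp _ e0; exists d1 => // w hw.
  by rewrite conjcK -rmorphB ncJ; apply: h1; rewrite E.
exists d => // w hw; rewrite conjcK -rmorphB h ?E // rmorphM rmorphB /= conjcK.
by [].
Qed.

Lemma chol_shift f z b : chol f (b + z) -> chol (fun w => f (b + w)) z.
Proof.
have E w : b + w - (b + z) = w - z by ring.
move=> [phi [cp [d d0 h]]]; exists (fun w => phi (b + w)); split.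
  move=> e e0; have [d1 d10 h1] := cp _ e0; exists d1 => // w hw.
  by apply: h1; rewrite E.
by exists d => // w hw; rewrite h E.
Qed.

Lemma ccont_shift f z b : ccont f (b + z) -> ccont (fun w => f (b + w)) z.
Proof.
have E w : b + w - (b + z) = w - z by ring.
move=> cp e e0; have [d1 d10 h1] := cp _ e0; exists d1 => // w hw.
by apply: h1; rewrite E.
Qed.

Lemma chol_eps f z : chol f z -> exists l, forall e, 0 < e -> exists2 d, 0 < d &
  forall w, nc (w - z) < d -> nc (f w - f z - l * (w - z)) <= e * nc (w - z).
Proof.
move=> [phi [cp [d d0 h]]]; exists (phi z) => e e0.
have [d1 d10 h1] := cp _ e0; exists (Num.min d d1); first by rewrite lt_min d0.
move=> w; rewrite lt_min => /andP[/h -> /h1 k].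
by rewrite -mulrBl ncM ler_wpM2r ?nc_ge0 // ltW.
Qed.

End ComplexCalculus.

(** * The mean value property in logarithmic polar coordinates *)

Section MeanValue.
Variable R : realType.
Notation C := R[i].
Notation nc := (@Normc.normc R).
Implicit Types (z w l : C) (f g : C -> C) (x t h k e d : R).

Lemma is_derive_eps (phi : R -> R) x (l : R) : is_derive x 1 phi l ->
  forall e, 0 < e -> exists2 d, 0 < d &
    forall h, `|h| < d -> `|phi (x + h) - phi x - l * h| <= e * `|h|.
Proof.
move=> [hd hl] e e0.
have {hd} : h^-1 *: ((phi \o shift x) (h *: 1) - phi x) @[h --> 0^'] --> l.
  by rewrite -hl; exact: hd.
move/cvgrPdist_le => /(_ e e0) [/= d d0 hd]; exists d => // h hh.
have [->|h0] := eqVneq h 0; first by rewrite addr0 mulr0 subr0 subrr normr0 mulr0.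
have := hd h; rewrite /= sub0r normrN => /(_ hh h0).
rewrite /GRing.scale /= mulr1 distrC => hb.
have -> : phi (x + h) - phi x - l * h = (h^-1 * (phi (h + x) - phi x) - l) * h.
  by rewrite (addrC x h); field.
by rewrite normrM ler_wpM2r.
Qed.

Definition cis t : C := Complex (cos t) (sin t).
(** The exponential of x + i t: composition with it preserves holomorphy and turns circles about 0
    into vertical segments. *)
Definition polar x t : C := rc (expR x) * cis t.

Lemma nc_cis t : nc (cis t) = 1.
Proof. by rewrite ncE /= cos2Dsin2 sqrtr1. Qed.

Lemma nc_polar x t : nc (polar x t) = expR x.
Proof. by rewrite ncM nc_cis mulr1 nc_rc ger0_norm // expR_ge0. Qed.

Lemma polarD x t h k : polar (x + h) (t + k) = polar x t * polar h k.
Proof.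
rewrite /polar /cis /rc expRD cosD sinD; apply/eqP; rewrite eq_complex /=.
by apply/andP; split; apply/eqP; ring.
Qed.

(** The exponential has derivative 1 at 0, by the real derivatives of exp, cos and sin; [polarD]
    then carries this to every point. *)
Lemma polar_eps0 e : 0 < e -> exists2 d, 0 < d & forall h k, `|h| < d -> `|k| < d ->
  nc (polar h k - 1 - Complex h k) <= e * (`|h| + `|k|).
Proof.
move=> e0; have e4 : 0 < e / 4 by rewrite divr_gt0.
have [d1 d10 h1] := is_derive_eps (is_derive_expR 0) e4.
have [d2 d20 h2] := is_derive_eps (is_derive_cos 0) e4.
have [d3 d30 h3] := is_derive_eps (is_derive_sin 0) e4.
(* This radius gives (e / 2 + 1) |k| <= e / 2, which bounds [cis k - 1] in the cross term with h. *)
have d40 : 0 < e / 2 / (e / 2 + 1) by rewrite divr_gt0 ?addr_gt0 // divr_gt0.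
exists (Num.min (Num.min d1 d2) (Num.min d3 (e / 2 / (e / 2 + 1)))).
  by rewrite !lt_min d10 d20 d30 d40.
move=> h k; rewrite !lt_min => /andP[/andP[/h1 b1 _] _] /andP[/andP[_ /h2 b2] /andP[/h3 b3 b4]].
move: b1 b2 b3; rewrite !add0r expR0 cos0 sin0 oppr0 mul0r !mul1r !subr0 addr0 => b1 b2 b3.
have c1 : nc (cis k - 1 - Complex 0 k) <= e / 2 * `|k|.
  apply: le_trans (nc_le _) _; rewrite /= !subr0.
  by apply: le_trans (lerD b2 b3) _; rewrite le_eqVlt; apply/orP; left; apply/eqP; field.
have c2 : nc (cis k - 1) <= e / 2.
  have -> : cis k - 1 = (cis k - 1 - Complex 0 k) + Complex 0 k by rewrite subrK.
  apply: le_trans (ncD _ _) _.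
  have -> : nc (Complex 0 k) = `|k| by rewrite ncE /= expr0n add0r sqrtr_sqr.
  apply: le_trans (lerD c1 (lexx _)) _.
  rewrite -[X in _ + X]mul1r -mulrDl -ler_pdivlMl ?addr_gt0 ?divr_gt0 //.
  by rewrite mulrC ltW.
have -> : polar h k - 1 - Complex h k = (rc (expR h) - 1 - rc h) * cis k +
    (rc h * (cis k - 1) + (cis k - 1 - Complex 0 k)).
  have -> : Complex h k = rc h + Complex 0 k.
    by apply/eqP; rewrite eq_complex /= addr0 add0r !eqxx.
  by rewrite /polar; ring.
apply: le_trans (ncD _ _) _; rewrite ncM nc_cis mulr1.
have -> : nc (rc (expR h) - 1 - rc h) = `|expR h - 1 - h|.
  by rewrite ncE /= !subr0 expr0n addr0 sqrtr_sqr.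
apply: le_trans (lerD b1 (ncD _ _)) _; rewrite ncM nc_rc.
have c3 : `|h| * nc (cis k - 1) <= `|h| * (e / 2) by rewrite ler_wpM2l.
apply: le_trans (lerD (lexx _) (lerD c3 c1)) _.
have := mulr_ge0 (ltW e0) (normr_ge0 h); have := mulr_ge0 (ltW e0) (normr_ge0 k); lra.
Qed.

Lemma polar_eps x t e : 0 < e -> exists2 d, 0 < d & forall h k, `|h| < d -> `|k| < d ->
  nc (polar (x + h) (t + k) - polar x t - polar x t * Complex h k) <= e * (`|h| + `|k|).
Proof.
move=> e0; have [|d d0 hd] := @polar_eps0 (e / expR x); first by rewrite divr_gt0 ?expR_gt0.
exists d => // h k hh hk.
have -> : polar (x + h) (t + k) - polar x t - polar x t * Complex h k =
  polar x t * (polar h k - 1 - Complex h k) by rewrite polarD; ring.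
rewrite ncM nc_polar -ler_pdivlMl ?expR_gt0 //.
by apply: le_trans (hd _ _ hh hk) _; rewrite mulrA (mulrC _ e).
Qed.

Lemma polar_chol_eps f x t : chol f (polar x t) -> exists m : C, forall e, 0 < e ->
  exists2 d, 0 < d & forall h k, `|h| < d -> `|k| < d ->
    nc (f (polar (x + h) (t + k)) - f (polar x t) - m * Complex h k) <= e * (`|h| + `|k|).
Proof.
move=> /chol_eps[l hl]; exists (l * polar x t) => e e0.
pose K := nc (polar x t) + 1; have K0 : 0 < K by rewrite ltr_pwDr // nc_ge0.
pose L := nc l + 1; have L0 : 0 < L by rewrite ltr_pwDr // nc_ge0.
have [|d1 d10 h1] := hl (e / 2 / K); first by rewrite !divr_gt0.
have [d2 d20 h2] := @polar_eps x t 1 ltr01.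
have [|d3 d30 h3] := @polar_eps x t (e / 2 / L); first by rewrite !divr_gt0.
exists (Num.min (Num.min d2 d3) (d1 / (2 * K))).
  by rewrite !lt_min d20 d30 divr_gt0 // mulr_gt0.
move=> h k; rewrite !lt_min => /andP[/andP[hh2 hh3] hh1] /andP[/andP[hk2 hk3] hk1].
have ncC : nc (Complex h k) <= `|h| + `|k| by exact: nc_le.
have s1 : nc (polar (x + h) (t + k) - polar x t) <= K * (`|h| + `|k|).
  rewrite -(subrK (polar x t * Complex h k) (_ - _)).
  apply: le_trans (ncD _ _) _; rewrite ncM.
  apply: le_trans (lerD (h2 _ _ hh2 hk2) (ler_wpM2l (nc_ge0 _) ncC)) _.
  by rewrite -mulrDl addrC.
have s2 : nc (polar (x + h) (t + k) - polar x t) < d1.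
  apply: le_lt_trans s1 _; rewrite -ltr_pdivlMl //.
  have -> : K^-1 * d1 = d1 / (2 * K) + d1 / (2 * K) by field; rewrite gt_eqF.
  exact: ltrD.
have -> : f (polar (x + h) (t + k)) - f (polar x t) - l * polar x t * Complex h k =
  (f (polar (x + h) (t + k)) - f (polar x t) - l * (polar (x + h) (t + k) - polar x t)) +
  l * (polar (x + h) (t + k) - polar x t - polar x t * Complex h k) by ring.
apply: le_trans (ncD _ _) _; rewrite ncM [e]splitr mulrDl; apply: lerD.
  apply: le_trans (h1 _ s2) _.
  rewrite -mulrA ler_pM2l ?divr_gt0 // -ler_pdivlMl ?invr_gt0 // invrK.
  exact: s1.
apply: le_trans (ler_wpM2l (nc_ge0 _) (h3 _ _ hh3 hk3)) _.
rewrite mulrA ler_wpM2r ?addr_ge0 //.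
have -> : nc l * (e / 2 / L) = (e / 2) * (nc l / L) by ring.
by apply: ler_piMr; rewrite ?divr_ge0 ?(ltW e0) // ler_pdivrMr // mul1r lerDl.
Qed.

Lemma Re_mul z w : complex.Re (z * w) = complex.Re z * complex.Re w - complex.Im z * complex.Im w.
Proof. by case: z => a b; case: w. Qed.
Lemma Im_mul z w : complex.Im (z * w) = complex.Re z * complex.Im w + complex.Im z * complex.Re w.
Proof. by case: z => a b; case: w. Qed.
Lemma ReD z w : complex.Re (z + w) = complex.Re z + complex.Re w.
Proof. by case: z => a b; case: w. Qed.
Lemma ImD z w : complex.Im (z + w) = complex.Im z + complex.Im w.
Proof. by case: z => a b; case: w. Qed.
Lemma ReN z : complex.Re (- z) = - complex.Re z.
Proof. by case: z. Qed.
Lemma ImN z : complex.Im (- z) = - complex.Im z.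
Proof. by case: z. Qed.

(** Cauchy-Riemann for g(x + i t) = f(polar x t) with derivative m: the form Im g dx + Re g dt is
    the imaginary part of g d(x + i t), and both its cross derivatives equal Re m. *)
Lemma polar_diff2 f x t : chol f (polar x t) -> exists A B D,
  diff2 (fun x t => complex.Im (f (polar x t))) x t A B /\
  diff2 (fun x t => complex.Re (f (polar x t))) x t B D.
Proof.
move=> /polar_chol_eps[m hm].
exists (complex.Im m), (complex.Re m), (- complex.Im m); split=> e /hm[d d0 hd];
  exists d => // h k hh hk; apply: le_trans (hd _ _ hh hk).
- apply: le_trans (nc_Im _); rewrite !ImD !ImN Im_mul /=.
  by rewrite le_eqVlt; apply/orP; left; apply/eqP; congr (`| _ |); ring.
- apply: le_trans (nc_Re _); rewrite !ReD !ReN Re_mul /=.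
  by rewrite le_eqVlt; apply/orP; left; apply/eqP; congr (`| _ |); ring.
Qed.

Lemma polar_continuous_int f x : (forall t, chol f (polar x t)) ->
  is_int (fun t => complex.Re (f (polar x t))) 0 (pi *+ 2)
    (intg (fun t => complex.Re (f (polar x t))) 0 (pi *+ 2)).
Proof.
move=> hf; apply: intgP; apply: is_int_exists => [|t _].
  by rewrite mulrn_wge0 // pi_ge0.
have [A [B [D [_ h2]]]] := polar_diff2 (hf t).
exact: diff2_continuousr h2.
Qed.

(** On the rectangle [x, x0] x [0, 2 pi] the edges t = 0 and t = 2 pi cancel by periodicity, so the
    circle integral is independent of the radius, and continuity at 0 gives its limit. Holomorphy is
    asked on the punctured disc only, which lets the centre be an exceptional point. *)
Lemma mean_value f (r0 : R) : ccont f 0 -> (forall z, 0 < nc z < r0 -> chol f z) ->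
  forall x, expR x < r0 ->
  is_int (fun t => complex.Re (f (polar x t))) 0 (pi *+ 2) (pi *+ 2 * complex.Re (f 0)).
Proof.
move=> cf hf x0 x0r.
pose Q x t := complex.Re (f (polar x t)); pose P x t := complex.Im (f (polar x t)).
have pi2 : 0 <= pi *+ 2 :> R by rewrite mulrn_wge0 // pi_ge0.
have hol x t : x <= x0 -> chol f (polar x t).
  by move=> xx; apply: hf; rewrite nc_polar expR_gt0 (le_lt_trans _ x0r) // ler_expR.
suff <- : intg (Q x0) 0 (pi *+ 2) = pi *+ 2 * complex.Re (f 0).
  by apply: polar_continuous_int => t; exact: hol.
have const x : x <= x0 -> intg (Q x0) 0 (pi *+ 2) = intg (Q x) 0 (pi *+ 2).
  move=> xx; have := @goursat_rectangle R P Q x x0 0 (pi *+ 2) xx pi2.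
  case/(_ _)/Wrap => [y t /andP[_ y2] _|]; first by apply: polar_diff2; exact: hol.
  have -> : P^~ (pi *+ 2) = P^~ 0.
    apply/funext => y; rewrite /P /polar /cis.
    by rewrite cos2pi sin2pi cos0 sin0.
  have E (a b c : R) : a + b - a - c = 0 -> b = c by move=> h; lra.
  exact: E.
apply/eqP; rewrite -subr_eq0 -normr_le0; apply/ler_addgt0Pl => eta eta0; rewrite addr0.
have [|d d0 hd] := cf (eta / (pi *+ 2 + 1)); first by rewrite divr_gt0 // ltr_pwDr.
(* x lies so far to the left that the circle of radius [expR x] stays where f is within the
   tolerance of f(0). *)
pose x := Num.min x0 (ln (d / 2)).
have xx : x <= x0 by rewrite ge_min lexx.
have xd : expR x < d.
  apply: (@le_lt_trans _ _ (d / 2)); last by rewrite ltr_divn.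
  rewrite -[leRHS]lnK ?posrE ?divr_gt0 // ler_expR ge_min lexx orbT //.
rewrite (const x xx).
have i1 : is_int (Q x) 0 (pi *+ 2) (intg (Q x) 0 (pi *+ 2)).
  by apply: polar_continuous_int => t; exact: hol.
have i2 := is_int_affine (complex.Re (f 0)) 0 0 0 (pi *+ 2 : R).
have := is_int_near (e := eta / (pi *+ 2 + 1)) pi2 i1 i2.
case/(_ _)/Wrap => [t _|].
  rewrite mul0r addr0 -ReN -ReD; apply: le_trans (nc_Re _) _.
  by apply/ltW/hd; rewrite subr0 nc_polar.
rewrite mul0r mul0r addr0 subr0 (mulrC (complex.Re _)) => h.
apply: le_trans h _; rewrite -mulrA; apply: ler_piMr; first exact: ltW.
by rewrite mulrC ler_pdivrMr ?ltr_pwDr // mul1r lerDl.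
Qed.

End MeanValue.

(** * The maximum principle and the identity theorem on a disc *)

Section MaximumPrinciple.
Variable R : realType.
Notation C := R[i].
Notation nc := (@Normc.normc R).
Implicit Types (z w l b x : C) (f g : C -> C) (t e d rho : R) (k : nat) (E : seq C).

Definition rcont (v : C -> R) z := forall e, 0 < e -> exists2 d, 0 < d &
  forall w, nc (w - z) < d -> `|v w - v z| < e.

Lemma nc_leP z rho : 0 <= rho -> (nc z <= rho) = (complex.Re z ^+ 2 + complex.Im z ^+ 2 <= rho ^+ 2).
Proof. by move=> r0; rewrite -nc_sqr ler_sqr ?nnegrE ?nc_ge0. Qed.

Lemma disc_max (v : C -> R) rho : 0 <= rho -> (forall z, nc z <= rho -> rcont v z) ->
  exists2 b, nc b <= rho & forall z, nc z <= rho -> v z <= v b.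
Proof.
move=> r0 hv.
pose A := [set p : R * R | p.1 ^+ 2 + p.2 ^+ 2 <= rho ^+ 2].
pose F (p : R * R) := v (Complex p.1 p.2).
have cA : closed A.
  have -> : A = (fun p : R * R => p.1 ^+ 2 + p.2 ^+ 2) @^-1` [set x | x <= rho ^+ 2] by [].
  apply: closed_comp; last exact: closed_le.
  move=> p _; apply: (@continuousD R _ _ (fun p : R * R => p.1 ^+ 2) (fun p => p.2 ^+ 2));
    [apply: (@continuous_comp _ _ _ fst (fun x : R => x ^+ 2)); first exact: cvg_fst|apply: (@continuous_comp _ _ _ snd (fun x : R => x ^+ 2)); first exact: cvg_snd];
    exact: exprn_continuous.
have kA : compact A.
  apply: (subclosed_compact cA (compact_setX (@segment_compact R (- rho) rho) (@segment_compact R (- rho) rho))).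
  move=> [x y]; rewrite /A /= => hxy; split; rewrite /= in_itv /= -ler_norml;
    rewrite -ler_sqr ?nnegrE // real_normK ?num_real //; apply: le_trans hxy;
    by rewrite ?lerDl ?lerDr sqr_ge0.
have A0 : A !=set0 by exists (0, 0); rewrite /A /= expr0n addr0 exprn_ge0.
have cF : {within A, continuous F}.
  apply: continuous_in_subspaceT => -[x y]; rewrite inE /A /= => hxy.
  apply/cvgrPdist_lt => /= e e0.
  have [|d d0 hd] := hv (Complex x y) _ e e0; first by rewrite nc_leP.
  have d2 : 0 < d / 2 by rewrite divr_gt0.
  exists (ball x (d / 2), ball y (d / 2)) => /=; first by split; exact: nbhsx_ballx.
  move=> [a b] [/= h1 h2]; rewrite distrC; apply: hd; apply: le_lt_trans (nc_le _) _.
  by rewrite /= [d]splitr ltrD // distrC.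
have [[x y] cAx hmax] := compact_EVT_max A0 kA cF.
exists (Complex x y); first by move: cAx; rewrite inE nc_leP.
move=> [x' y']; rewrite nc_leP // => hz; apply: (hmax (x', y')).
by rewrite inE.
Qed.

Lemma ccont_rcont f z : ccont f z -> rcont (fun w => complex.Re (f w)) z.
Proof.
move=> hf e /hf[d d0 hd]; exists d => // w /hd; apply: le_lt_trans.
by rewrite -ReN -ReD nc_Re.
Qed.

Lemma ccont_nc f z : ccont f z -> rcont (fun w => nc (f w)) z.
Proof.
move=> hf e /hf[d d0 hd]; exists d => // w /hd; apply: le_lt_trans.
rewrite ler_norml lerNl opprB; apply/andP; split; last exact: nc_lerB.
by rewrite nc_sub nc_lerB.
Qed.

Lemma rcontD (u v : C -> R) z : rcont u z -> rcont v z -> rcont (fun w => u w + v w) z.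
Proof.
move=> cf cg e e0; have e2 : 0 < e / 2 by rewrite divr_gt0.
have [d1 d10 h1] := cf _ e2; have [d2 d20 h2] := cg _ e2.
exists (Num.min d1 d2); first by rewrite lt_min d10.
move=> w; rewrite lt_min => /andP[/h1 k1 /h2 k2].
have -> : u w + v w - (u z + v z) = (u w - u z) + (v w - v z) by ring.
by apply: le_lt_trans (ler_normD _ _) _; rewrite [e]splitr ltrD.
Qed.

(* [f] may fail to be differentiable at the points of [E], where it is still continuous. *)
Definition nice rho E f := (forall z, nc z <= rho -> ccont f z) /\
  (forall z, nc z < rho -> z \notin E -> chol f z).

Lemma isolated E b : exists2 r, 0 < r & forall z, 0 < nc (z - b) < r -> z \notin E.
Proof.
elim: E => [|a E [r r0 IH]]; first by exists 1.
have [->|ab] := eqVneq a b.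
  exists r => // z /andP[z0 zr]; rewrite in_cons negb_or IH ?z0 // andbT.
  by move: z0; rewrite nc_gt0 subr_eq0.
exists (Num.min r (nc (a - b))); first by rewrite lt_min r0 nc_gt0 subr_eq0.
move=> z; rewrite lt_min => /and3P[z0 z1 z2]; rewrite in_cons negb_or IH ?z0 // andbT.
by apply: contraTneq z2 => ->; rewrite ltxx.
Qed.

(** Adding ep |z|^2 makes the circle mean about an interior point exceed the central value by ep
    r^2, so the perturbed function has no interior maximum; ep is arbitrarily small. *)
Lemma nice_max_Re rho E f M : 0 <= rho -> nice rho E f ->
  (forall z, nc z = rho -> complex.Re (f z) <= M) -> forall z, nc z <= rho -> complex.Re (f z) <= M.
Proof.
move=> r0 [cf hf] hM z hz; apply/ler_addgt0Pl => eta eta0.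
pose ep := eta / (rho ^+ 2 + 1).
have ep0 : 0 < ep by rewrite divr_gt0 // ltr_pwDr // sqr_ge0.
have r20 : 0 <= rho ^+ 2 by rewrite sqr_ge0.
pose v w := complex.Re (f w) + ep * (nc w ^+ 2).
have hv w : nc w <= rho -> rcont v w.
  move=> hw; apply: rcontD; first exact/ccont_rcont/cf.
  (* The continuity of ep |w|^2 is read off from the real part of this complex function. *)
  have : ccont (fun w => rc ep * (w * conjc w)) w.
    apply: ccontM; first exact: ccont_cst.
    apply: ccontM; first exact: ccont_id.
    by move=> e e0; exists e => // u; rewrite -rmorphB ncJ.
  move/ccont_rcont => h e /h[d d0 hd]; exists d => // u /hd.
  by rewrite !Re_mul !Im_mul !nc_sqr /=; case: u => u1 u2; case: (w) => w1 w2 /=; rewrite !mulrN !opprK !mul0r !subr0 -!expr2.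
have [b hb hmax] := disc_max r0 hv.
suff vb : v b <= M + ep * rho ^+ 2.
  have := hmax _ hz; have hn := nc_ge0 z.
  have : 0 <= ep * nc z ^+ 2 by rewrite mulr_ge0 ?sqr_ge0 ?ltW.
  have : ep * rho ^+ 2 <= eta.
    by rewrite /ep mulrAC -mulrA ler_piMr ?(ltW eta0) // ler_pdivrMr ?ltr_pwDr // mul1r lerDl.
  rewrite /v in vb *; lra.
have [hbr|] := ltP (nc b) rho; last first.
  move=> rb; have {rb hb} hb : nc b = rho by apply/eqP; rewrite eq_le hb.
  by rewrite /v hb lerD2r hM.
have [r1 r10 hr1] := isolated E b.
(* The circle about b must stay inside the disc and miss every point of E except possibly b. *)
pose r2 := Num.min r1 (rho - nc b).
have r20' : 0 < r2 by rewrite lt_min r10 subr_gt0.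
have [] := @mean_value R (fun w => f (b + w)) r2 _ _ (ln (r2 / 2)).
- by apply: ccont_shift; rewrite addr0; apply: cf.
- move=> w /andP[w0]; rewrite lt_min => /andP[w1 w2]; apply: chol_shift; apply: hf.
    by apply: le_lt_trans (ncD _ _) _; rewrite addrC -ltrBrDr.
  by apply: hr1; have -> : b + w - b = w; [ring|rewrite w0].
- by rewrite lnK ?posrE ?divr_gt0 // ltr_divn.
set lr := ln _ => Phi [hPhi hE]; rewrite addr0 in hE.
pose r := expR lr; have r_gt0 : 0 < r by exact: expR_gt0.
have rr2 : r < r2 by rewrite /r /lr lnK ?posrE ?divr_gt0 // ltr_divn.
have pi2 : 0 < pi *+ 2 :> R by rewrite mulrn_wgt0 // pi_gt0.
pose b1 := complex.Re b; pose b2 := complex.Im b.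
(* A primitive of v along the circle: the added term integrates ep |b + r e^(it)|^2 explicitly, and
   its trigonometric part drops out over a full turn. *)
pose Psi t := Phi t + ep * ((nc b ^+ 2 + r ^+ 2) * t + 2 * r * (b1 * sin t - b2 * cos t)).
have dPsi t : 0 <= t <= pi *+ 2 -> is_derive t 1 Psi (v (b + polar lr t)).
  move=> ht; have h1 := hPhi t ht.
  have nE : nc (b + polar lr t) ^+ 2 = nc b ^+ 2 + r ^+ 2 + 2 * r * (b1 * cos t + b2 * sin t).
    rewrite !nc_sqr ReD ImD /polar Re_mul Im_mul /= -/r -/b1 -/b2.
    have -> : r ^+ 2 = r ^+ 2 * (cos t ^+ 2 + sin t ^+ 2) by rewrite cos2Dsin2 mulr1.
    by ring.
  apply: is_derive_eq; rewrite /v nE /GRing.scale /=; ring.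
have [||c hc] := @MVT R Psi (fun t => v (b + polar lr t)) 0 (pi *+ 2) pi2.
- by move=> t; rewrite in_itv /= => /andP[/ltW t1 /ltW t2]; apply: dPsi; rewrite t1.
- apply: derivable_within_continuous => t; rewrite in_itv /= => ht.
  by have [] := dPsi t ht.
rewrite subr0 /Psi cos2pi sin2pi cos0 sin0 => hMVT.
have k1 : v (b + polar lr c) * (pi *+ 2) = (v b + ep * r ^+ 2) * (pi *+ 2).
  rewrite -hMVT /v; have -> : Phi (pi *+ 2) = pi *+ 2 * complex.Re (f b) + Phi 0.
    by rewrite hE subrK.
  by ring.
have k2 : v (b + polar lr c) = v b + ep * r ^+ 2.
  by apply: (mulIf _ k1); rewrite gt_eqF.
have : v (b + polar lr c) <= v b.
  apply: hmax; apply: le_trans (ncD _ _) _; rewrite nc_polar -/r.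
  by move: rr2; rewrite lt_min => /andP[_]; lra.
have : 0 < ep * r ^+ 2 by rewrite mulr_gt0 ?exprn_gt0.
by rewrite k2; lra.
Qed.

(** Multiplying f by the unit number [om] that rotates f(z) onto the positive axis reduces the
    modulus at z to a real part. *)
Lemma maximum_principle rho E f M : 0 <= rho -> nice rho E f ->
  (forall z, nc z = rho -> nc (f z) <= M) -> forall z, nc z <= rho -> nc (f z) <= M.
Proof.
move=> r0 [cf hf] hM z hz.
have [->|fz] := eqVneq (f z) 0.
  rewrite nc0; apply: le_trans (nc_ge0 (f (rc rho))) (hM (rc rho) _).
  by rewrite nc_rc ger0_norm.
pose om := conjc (f z) / rc (nc (f z)).
have fz0 : nc (f z) != 0 by rewrite nc_eq0.
have nom : nc om = 1 by rewrite ncM ncV ncJ nc_rc ger0_norm ?nc_ge0 // divff.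
have -> : nc (f z) = complex.Re (om * f z).
  rewrite /om mulrAC (mulrC (conjc _)).
  have -> : f z * conjc (f z) = rc (nc (f z) ^+ 2).
    rewrite nc_sqr /rc; case: (f z) => a c; apply/eqP; rewrite eq_complex /=.
    by apply/andP; split; apply/eqP; ring.
  have -> : rc (nc (f z) ^+ 2) = rc (nc (f z)) * rc (nc (f z)) by rewrite expr2 rcM.
  by rewrite mulfK // rc_eq0.
apply: (@nice_max_Re rho E (fun w => om * f w) M r0 _ _ z hz).
  split=> w hw; first by apply: ccontM; [exact: ccont_cst|exact: cf].
  by move=> wE; apply: cholM; [exact: chol_cst|exact: hf].
move=> w hw; apply: le_trans (ler_norm _) _; apply: le_trans (nc_Re _) _.
by rewrite ncM nom mul1r hM.
Qed.

(** The quotient extends continuously over x by the slope of f; its differentiability there is not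
    known, so x joins the exceptional points. *)
Lemma nice_divide rho E f x : nice rho E f -> nc x < rho -> x \notin E -> f x = 0 ->
  exists2 g, nice rho (x :: E) g & forall z, f z = g z * (z - x).
Proof.
move=> [cf hf] hx xE fx; have [phi [cp [d d0 hphi]]] := hf x hx xE.
pose g z := if z == x then phi x else f z / (z - x).
have gE z : z != x -> g z = f z / (z - x) by rewrite /g => /negbTE ->.
have gnear z : z != x -> exists2 r, 0 < r & forall w, nc (w - z) < r -> f w / (w - x) = g w.
  move=> zx; exists (nc (z - x)); first by rewrite nc_gt0 subr_eq0.
  move=> w hw; rewrite gE //; apply: contraTneq hw => ->.
  by rewrite nc_sub ltxx.
exists g; last first.
  move=> z; rewrite /g; case: eqVneq => [->|zx]; first by rewrite subrr mulr0.
  by rewrite divfK // subr_eq0.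
split=> z hz.
  have [->|zx] := eqVneq z x.
    apply: (@ccont_near _ phi g x d d0) => // w hw; rewrite /g; case: eqVneq => [-> //|wx].
    by have := hphi w hw; rewrite fx subr0 => ->; rewrite mulfK // subr_eq0.
  have [r rr hr] := gnear z zx; apply: (@ccont_near _ _ _ _ _ rr hr).
  apply: ccontM; first exact: cf.
  apply: ccontV; last by rewrite subr_eq0.
  by apply: ccontB; [exact: ccont_id|exact: ccont_cst].
rewrite in_cons negb_or => /andP[zx zE].
have [r rr hr] := gnear z zx; apply: (@chol_near _ _ _ _ _ rr hr).
apply: cholM; first exact: hf.
apply: cholV; last by rewrite subr_eq0.
by apply: cholB; [exact: chol_id|exact: chol_cst].
Qed.

(** Each new zero of f is taken so close to 0 that it differs from the earlier ones, hence it is a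
    zero of the cofactor g. *)
Lemma nice_divide_many rho f de : 0 < de -> de <= rho -> nice rho [::] f ->
  (forall e, 0 < e -> exists x, [/\ 0 < nc x, nc x < e & f x = 0]) ->
  forall k, exists xs g, [/\ size xs = k, all (fun x => 0 < nc x < de) xs,
    nice rho xs g & forall z, f z = g z * \prod_(x <- xs) (z - x)].
Proof.
move=> de0 der nf acc; elim=> [|k [xs [g [hs ha ng hg]]]].
  by exists [::], f; split=> // z; rewrite big_nil mulr1.
have [e e0 he] : exists2 e, 0 < e & forall x, nc x < e -> 0 < nc x -> x \notin xs.
  have [r r0 hr] := isolated xs 0; exists r => // x x1 x2.
  by apply: hr; rewrite subr0 x2.
have [|x [x0 x1 fx]] := acc (Num.min e de); first by rewrite lt_min e0.
move: x1; rewrite lt_min => /andP[x1 x2]; have xxs := he x x1 x0.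
have gx : g x = 0.
  move: (hg x); rewrite fx => /esym/eqP; rewrite mulf_eq0 => /orP[/eqP //|].
  rewrite prodf_seq_eq0 => /hasP[y yxs]; rewrite /= subr_eq0 => /eqP xy.
  by move: xxs; rewrite xy yxs.
have [h nh hh] := nice_divide ng (lt_le_trans x2 der) xxs gx.
exists (x :: xs), h; split=> //=; first by rewrite hs.
  by rewrite x0 x2.
by move=> z; rewrite big_cons hg hh mulrA.
Qed.

(* With k distinct zeros in a small disc, the maximum principle for
   f / prod (z - x_i) makes f decay geometrically in k. *)
Theorem identity_disc f (r : R) : (forall z, nc z < r -> chol f z) ->
  (forall e, 0 < e -> exists x, [/\ 0 < nc x, nc x < e & f x = 0]) ->
  forall z, nc z < r -> f z = 0.
Proof.
move=> hf acc z hz.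
pose rho := (nc z + r) / 2; have zr : nc z < rho by rewrite /rho; lra.
have rhor : rho < r by rewrite /rho; lra.
have z0 := nc_ge0 z.
have rho0 : 0 <= rho by apply: le_trans z0 (ltW zr).
(* A quarter of the gap gives |z| + de < rho - de, so the ratio q below is less than 1. *)
pose de := (rho - nc z) / 4; have de0 : 0 < de by rewrite /de; lra.
have der : de <= rho by rewrite /de; lra.
have cf w : nc w <= rho -> ccont f w by move=> hw; apply/chol_ccont/hf/(le_lt_trans hw).
have nf : nice rho [::] f.
  by split=> // w hw _; apply: hf; apply: lt_trans hw rhor.
have [b hb hM] := disc_max rho0 (fun w hw => ccont_nc (cf w hw)).
set M := nc (f b) in hM; have M0 : 0 <= M by exact: nc_ge0.
pose q := (nc z + de) / (rho - de).
have rd0 : 0 < rho - de by rewrite /de; lra.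
have q0 : 0 <= q by apply: divr_ge0; [apply: addr_ge0 z0 (ltW de0)|exact: ltW].
have q1 : q < 1 by rewrite ltr_pdivrMr // mul1r /de; lra.
have bound k : nc (f z) <= M * q ^+ k.
  have [xs [g [hs ha ng hg]]] := nice_divide_many de0 der nf acc k.
  have pge w : nc w = rho -> (rho - de) ^+ k <= nc (\prod_(x <- xs) (w - x)).
    move=> hw; rewrite -hs; elim: (xs) ha => [|x ys IH] /=; first by rewrite big_nil nc1 expr0.
    move=> /andP[/andP[_ hx] /IH h]; rewrite big_cons ncM exprS; apply: ler_pM => //.
    - exact: ltW.
    - by rewrite exprn_ge0 ?ltW.
    - by apply: le_trans (nc_lerB _ _); rewrite hw lerD2l lerN2 ltW.
  have ple : nc (\prod_(x <- xs) (z - x)) <= (nc z + de) ^+ k.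
    rewrite -hs; elim: (xs) ha => [|x ys IH] /=; first by rewrite big_nil nc1 expr0.
    move=> /andP[/andP[_ hx] /IH h]; rewrite big_cons ncM exprS; apply: ler_pM => //.
    - exact: nc_ge0.
    - exact: nc_ge0.
    - by apply: le_trans (ncB _ _) _; rewrite lerD2l ltW.
  have gM w : nc w <= rho -> nc (g w) <= M / (rho - de) ^+ k.
    apply: maximum_principle ng _ w => // w hw.
    rewrite ler_pdivlMr ?exprn_gt0 //.
    apply: le_trans (hM w _); last by rewrite hw.
    by rewrite hg ncM ler_wpM2l ?nc_ge0 // pge.
  rewrite hg ncM; apply: le_trans (ler_pM _ _ (gM z (ltW zr)) ple) _; rewrite ?nc_ge0 //.
  by rewrite /q expr_div_n mulrA mulrAC.
apply/eqP; rewrite -nc_eq0; apply/eqP/le_anti; rewrite nc_ge0 andbT.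
have cvg0 : M * q ^+ k @[k --> \oo] --> M * 0.
  apply: cvgMr; apply: cvg_expr; by rewrite ger0_norm.
rewrite mulr0 in cvg0.
have -> : 0 = lim (M * q ^+ k @[k --> \oo]) by apply/esym/cvg_lim.
apply: limr_ge; first by apply/cvg_ex; exists 0.
by near=> k; apply: bound.
Unshelve. all: by end_near. Qed.

End MaximumPrinciple.

(** * Several complex variables *)

Section SeveralVariables.
Variables (R : realType) (n : nat).
Notation C := R[i].
Notation V := 'rV[R[i]]_n.
Notation nc := (@Normc.normc R).
Implicit Types (a b t : C) (x y z w c v : V) (F G : V -> C) (e d : R).

(** A norm with real values; the norm of the space itself takes values in [R[i]]. *)
Definition vn z : R := \sum_j nc (z 0 j).

Lemma vn_ge0 z : 0 <= vn z.
Proof. by apply: sumr_ge0 => j _; exact: nc_ge0. Qed.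
Lemma vn_coord z j : nc (z 0 j) <= vn z.
Proof. by rewrite /vn (bigD1 j) //= lerDl sumr_ge0 // => i _; exact: nc_ge0. Qed.
Lemma vnD z w : vn (z + w) <= vn z + vn w.
Proof. by rewrite -big_split /=; apply: ler_sum => j _; rewrite mxE ncD. Qed.
Lemma vnZ t z : vn (t *: z) = nc t * vn z.
Proof. by rewrite /vn mulr_sumr; apply: eq_bigr => j _; rewrite mxE ncM. Qed.
Lemma vnN z : vn (- z) = vn z.
Proof. by rewrite /vn; apply: eq_bigr => j _; rewrite mxE ncN. Qed.
Lemma vnB z w : vn (z - w) <= vn z + vn w.
Proof. by rewrite -(vnN w) vnD. Qed.
Lemma vn_sub z w : vn (z - w) = vn (w - z).
Proof. by rewrite -vnN opprB. Qed.
Lemma vn0 : vn 0 = 0.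
Proof. by rewrite /vn big1 // => j _; rewrite mxE nc0. Qed.
Lemma vn_dist z w x : vn (z - w) <= vn (z - x) + vn (x - w).
Proof. by rewrite -[z - w](subrKA x) vnD. Qed.

Definition vcont F z := forall e, 0 < e -> exists2 d, 0 < d &
  forall w, vn (w - z) < d -> nc (F w - F z) < e.

Lemma vcont_cst a z : vcont (fun=> a) z.
Proof. by move=> e e0; exists 1 => // w _; rewrite subrr nc0. Qed.

Lemma vcont_coord j z : vcont (fun w => w 0 j) z.
Proof.
move=> e e0; exists e => // w; apply: le_lt_trans.
by have := vn_coord (w - z) j; rewrite !mxE.
Qed.

Lemma vcontD F G z : vcont F z -> vcont G z -> vcont (fun w => F w + G w) z.
Proof.
move=> cf cg e e0; have e2 : 0 < e / 2 by rewrite divr_gt0.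
have [d1 d10 h1] := cf _ e2; have [d2 d20 h2] := cg _ e2.
exists (Num.min d1 d2); first by rewrite lt_min d10.
move=> w; rewrite lt_min => /andP[/h1 k1 /h2 k2].
have -> : F w + G w - (F z + G z) = (F w - F z) + (G w - G z) by ring.
by apply: le_lt_trans (ncD _ _) _; rewrite [e]splitr ltrD.
Qed.

Lemma vcontM F G z : vcont F z -> vcont G z -> vcont (fun w => F w * G w) z.
Proof.
move=> cf cg e e0.
pose m := nc (F z) + nc (G z) + 1.
have m0 : 0 < m by rewrite ltr_pwDr // addr_ge0 ?nc_ge0.
have em : 0 < e / (2 * m) by rewrite divr_gt0 // mulr_gt0.
have [d1 d10 h1] := cf _ em; have [d2 d20 h2] := cg _ em; have [d3 d30 h3] := cg _ ltr01.
exists (Num.min d1 (Num.min d2 d3)); first by rewrite !lt_min d10 d20.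
move=> w; rewrite !lt_min => /and3P[/h1 k1 /h2 k2 /h3 k3].
have -> : F w * G w - F z * G z = (F w - F z) * G w + F z * (G w - G z) by ring.
apply: le_lt_trans (ncD _ _) _; rewrite !ncM.
have gm : nc (G w) <= m.
  rewrite -(subrK (G z) (G w)); apply: le_trans (ncD _ _) _.
  by rewrite /m; have := nc_ge0 (F z); have := ltW k3; lra.
have fm : nc (F z) <= m by rewrite /m; have := nc_ge0 (G z); lra.
have {1}-> : e = e / (2 * m) * m + m * (e / (2 * m)) by field; rewrite gt_eqF.
have j1 : nc (F w - F z) * nc (G w) <= nc (F w - F z) * m by rewrite ler_wpM2l ?nc_ge0.
have j2 : nc (F w - F z) * m < e / (2 * m) * m by rewrite ltr_pM2r.
apply: ltr_leD; first exact: le_lt_trans j1 j2.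
by apply: ler_pM; rewrite ?nc_ge0 // ltW.
Qed.

Lemma vcontN F z : vcont F z -> vcont (fun w => - F w) z.
Proof. by move=> cf e /cf[d d0 h]; exists d => // w /h; rewrite -opprD ncN. Qed.

Lemma vcont_conj F z : vcont F z -> vcont (fun w => conjc (F w)) z.
Proof. by move=> cf e /cf[d d0 h]; exists d => // w /h; rewrite -rmorphB ncJ. Qed.

Lemma vcont_sum (I : Type) (r : seq I) (G : I -> V -> C) z :
  (forall i, vcont (G i) z) -> vcont (fun w => \sum_(i <- r) G i w) z.
Proof.
move=> h; elim: r => [|i r IH].
  by move=> e e0; exists 1 => // w _; rewrite !big_nil subrr nc0.
move=> e e0; have [d d0 hd] := vcontD (h i) IH e0.
by exists d => // w; rewrite !big_cons; exact: hd.
Qed.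

Definition vhol F z := exists l : 'I_n -> C, forall e, 0 < e -> exists2 d, 0 < d &
  forall w, vn (w - z) < d -> nc (F w - F z - \sum_j l j * (w - z) 0 j) <= e * vn (w - z).

Lemma vhol_vcont F z : vhol F z -> vcont F z.
Proof.
move=> [l hl] e e0; have [d1 d10 h1] := hl 1 ltr01.
pose K := \sum_j nc (l j); have K0 : 0 <= K by apply: sumr_ge0 => j _; exact: nc_ge0.
have K1 : 0 < K + 1 by rewrite ltr_pwDr.
exists (Num.min d1 (e / (K + 1))); first by rewrite lt_min d10 divr_gt0.
move=> w; rewrite lt_min => /andP[/h1 k1 k2].
rewrite -(subrK (\sum_j l j * (w - z) 0 j) (F w - F z)).
apply: le_lt_trans (ncD _ _) _.
have k3 : nc (\sum_j l j * (w - z) 0 j) <= K * vn (w - z).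
  rewrite /K mulr_suml; elim/big_ind2 : _ => [|a1 b1 a2 b2 h h'|j _].
  - by rewrite nc0.
  - by apply: le_trans (ncD _ _) _; exact: lerD.
  - by rewrite ncM ler_wpM2l ?nc_ge0 // vn_coord.
apply: le_lt_trans (lerD k1 k3) _; rewrite mul1r -[X in X + _]mul1r -mulrDl addrC.
by rewrite mulrC -ltr_pdivlMr // addrC.
Qed.

Lemma chol_of_eps (g : C -> C) t (l : C) : (forall e, 0 < e -> exists2 d, 0 < d &
  forall s, nc (s - t) < d -> nc (g s - g t - l * (s - t)) <= e * nc (s - t)) -> chol g t.
Proof.
move=> hl; exists (fun s => if s == t then l else (g s - g t) / (s - t)); split; last first.
  exists 1 => // s _; case: eqVneq => [->|st]; first by rewrite !subrr mulr0.
  by rewrite divfK // subr_eq0.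
move=> e e0; have e2 : 0 < e / 2 by rewrite divr_gt0.
have [d d0 hd] := hl _ e2; exists d => // s hs; rewrite eqxx.
case: eqVneq => [_|st]; first by rewrite subrr nc0.
have st0 : s - t != 0 by rewrite subr_eq0.
apply: (@le_lt_trans _ _ (e / 2)); last by rewrite ltr_divn.
have -> : (g s - g t) / (s - t) - l = (g s - g t - l * (s - t)) / (s - t) by field.
by rewrite ncM ncV ler_pdivrMr ?nc_gt0 // hd.
Qed.

Lemma vhol_chain F (c : C -> V) t : vhol F (c t) -> (forall j, chol (fun s => c s 0 j) t) ->
  chol (fun s => F (c s)) t.
Proof.
move=> [l hl] hc.
have /(@fin_all_exists _ _ _)[m hm] := fun j => chol_eps (hc j).
pose K := \sum_j (nc (m j) + 1); have K0 : 0 <= K.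
  by apply: sumr_ge0 => j _; rewrite addr_ge0 ?nc_ge0.
pose L := \sum_j nc (l j); have L0 : 0 <= L by apply: sumr_ge0 => j _; exact: nc_ge0.
have near (e : R) : 0 < e -> exists2 d, 0 < d & forall j s, nc (s - t) < d ->
    nc (c s 0 j - c t 0 j - m j * (s - t)) <= e * nc (s - t).
  move=> e0; have /(@fin_all_exists2 _ _ _ _)[d d0 hd] := fun j => hm j e e0.
  exists (\big[Num.min/1]_j d j); first by apply: lt_bigmin.
  by move=> j s hs; apply: hd; apply: lt_le_trans hs _; exact: bigmin_le.
apply: (@chol_of_eps _ _ (\sum_j l j * m j)) => e e0.
have [|d1 d10 h1] := hl (e / 2 / (K + 1)); first by rewrite !divr_gt0 // ltr_pwDr.
have [d2 d20 h2] := near 1 ltr01.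
have [|d3 d30 h3] := near (e / 2 / (L + 1)); first by rewrite !divr_gt0 // ltr_pwDr.
exists (Num.min (d1 / (K + 1)) (Num.min d2 d3)).
  by rewrite !lt_min d20 d30 divr_gt0 // ltr_pwDr.
move=> s; rewrite !lt_min => /and3P[k1 k2 k3].
have b1 : vn (c s - c t) <= K * nc (s - t).
  rewrite /K mulr_suml; apply: ler_sum => j _; rewrite !mxE mulrDl.
  rewrite -(subrK (m j * (s - t)) (_ - _)) addrC.
  by apply: le_trans (ncD _ _) _; rewrite ncM lerD2l (h2 j s k2).
have b2 : K * nc (s - t) <= (K + 1) * nc (s - t) by rewrite ler_wpM2r ?nc_ge0 // lerDl.
have b3 : vn (c s - c t) < d1.
  by apply: le_lt_trans b1 _; apply: le_lt_trans b2 _; rewrite mulrC -ltr_pdivlMr // ltr_pwDr.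
have -> : F (c s) - F (c t) - (\sum_j l j * m j) * (s - t) =
    (F (c s) - F (c t) - \sum_j l j * (c s - c t) 0 j) +
    \sum_j l j * (c s 0 j - c t 0 j - m j * (s - t)).
  rewrite -[RHS]addrA; congr (_ + _); rewrite addrC -sumrB mulr_suml -sumrN.
  by apply: eq_bigr => j _; rewrite !mxE; ring.
apply: le_trans (ncD _ _) _; rewrite [e]splitr mulrDl; apply: lerD.
  apply: le_trans (h1 _ b3) _; apply: le_trans (ler_wpM2l _ (le_trans b1 b2)) _.
    by rewrite !divr_ge0 ?ltW // ltr_pwDr.
  by rewrite mulrA divfK // gt_eqF // ltr_pwDr.
apply: (@le_trans _ _ (L * (e / 2 / (L + 1) * nc (s - t)))).
  rewrite /L mulr_suml; elim/big_ind2 : _ => [|a1 a1' a2 a2' h h'|j _].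
  - by rewrite nc0.
  - by apply: le_trans (ncD _ _) _; exact: lerD.
  - by rewrite ncM ler_wpM2l ?nc_ge0 // h3.
rewrite mulrA ler_wpM2r ?nc_ge0 //.
have -> : L * (e / 2 / (L + 1)) = e / 2 * (L / (L + 1)) by ring.
by apply: ler_piMr; rewrite ?divr_ge0 ?(ltW e0) // ler_pdivrMr ?ltr_pwDr // mul1r lerDl.
Qed.

Lemma chol_line j x v t : chol (fun s : C => (x + s *: v) 0 j) t.
Proof.
apply: (@chol_near _ (fun s => x 0 j + s * v 0 j) _ _ 1) => //; first by move=> s _; rewrite !mxE.
apply: cholD; first exact: chol_cst.
by apply: cholM; [exact: chol_id|exact: chol_cst].
Qed.

Lemma vcont_line F x v t : vcont F (x + t *: v) -> ccont (fun s => F (x + s *: v)) t.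
Proof.
move=> cF e /cF[d d0 hd].
have v1 : 0 < vn v + 1 by rewrite ltr_pwDr // vn_ge0.
exists (d / (vn v + 1)); first by rewrite divr_gt0.
move=> s hs; apply: hd.
have -> : x + s *: v - (x + t *: v) = (s - t) *: v by rewrite opprD addrACA subrr add0r scalerBl.
rewrite vnZ; apply: (@le_lt_trans _ _ (nc (s - t) * (vn v + 1))).
  by rewrite ler_wpM2l ?nc_ge0 // lerDl.
by rewrite -ltr_pdivlMr.
Qed.

(* The zero set of q separates a positive from a negative point, so it meets
   a complex line through both in a set with an accumulation point. *)
Lemma sign_change_limit (q : C -> R) : (forall t, rcont q t) -> 0 < q 0 -> q 1 < 0 ->
  exists2 t0 : R, 0 <= t0 <= 1 & forall e, 0 < e -> exists t : C, [/\ 0 < nc t, nc t < e & q (rc t0 + t) = 0].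
Proof.
move=> cq q0 q1.
(* At the supremum t0 of A the function q vanishes; positive values accumulate at t0 from the left,
   while q <= 0 on its right. *)
pose A := [set s : R | 0 <= s <= 1 /\ 0 < q (rc s)].
have A0 : A 0 by rewrite /A /= lexx ler01.
have hsA : has_sup A by split; [exists 0|exists 1 => s [/andP[]]].
pose t0 := sup A.
have t00 : 0 <= t0 by apply: ub_le_sup => //; case: hsA.
have t01 : t0 <= 1 by apply: ge_sup; [case: hsA|move=> s [/andP[]]].
have near (s e : R) : 0 < e -> exists2 d, 0 < d & forall u : C, nc (u - rc s) < d -> `|q u - q (rc s)| < e.
  exact: cq.
have left e : 0 < e -> exists2 s, A s & t0 - e < s.
  by move=> e0; have [s As hs] := sup_adherent e0 hsA; exists s.
have right s : t0 < s -> s <= 1 -> q (rc s) <= 0.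
  move=> s0 s1; rewrite leNgt; apply/negP => qs.
  have : s <= t0 by apply: ub_le_sup; [case: hsA|split=> //; rewrite s1 andbT ltW // (le_lt_trans t00)].
  by rewrite leNgt s0.
have rcB (a b : R) : nc (rc a - rc b) = `|a - b| by rewrite -rcN -rcD nc_rc.
have q01 : q (rc 1) < 0 by [].
have qt0 : q (rc t0) <= 0.
  rewrite leNgt; apply/negP => qp.
  have t1 : t0 < 1.
    by rewrite lt_neqAle t01 andbT; apply: contraTneq q01 => <-; rewrite -leNgt ltW.
  have [d d0 hd] := near t0 _ qp.
  pose s := Num.min 1 (t0 + d / 2).
  have d2 : 0 < d / 2 by rewrite divr_gt0.
  have s0 : t0 < s by rewrite lt_min t1 ltrDl.
  have sd : s - t0 < d by rewrite ltrBlDl gt_min; apply/orP; right; rewrite ltrD2l ltr_divn.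
  have := hd (rc s); rewrite rcB gtr0_norm ?subr_gt0 // => /(_ sd).
  rewrite ltr_norml => /andP[h _].
  have := right s s0; rewrite ge_min lexx /= => /(_ isT); lra.
have Alt s : A s -> s < t0.
  move=> As; rewrite lt_neqAle ub_le_sup ?andbT //; last by case: hsA.
  by apply/eqP => st; case: As => _; rewrite st ltNge qt0.
have qt : q (rc t0) = 0.
  apply/eqP; rewrite eq_le qt0 leNgt; apply/negP => qn.
  have [|d d0 hd] := near t0 (- q (rc t0)); first by rewrite oppr_gt0.
  have [s As hs] := left d d0; have := Alt s As => st.
  have := hd (rc s); rewrite rcB ltr0_norm ?subr_lt0 // opprB => /(_ _)/Wrap; case; first lra.
  by rewrite ltr_norml => /andP[_ h]; case: As => _; lra.
have t1 : t0 < 1.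
  by rewrite lt_neqAle t01 andbT; apply: contraTneq q01 => <-; rewrite qt ltxx.
exists t0; first by rewrite t00.
move=> e e0; have e2 : 0 < e / 2 by rewrite divr_gt0.
pose s2 := Num.min 1 (t0 + e / 4).
have e4 : 0 < e / 4 by rewrite divr_gt0.
have s20 : t0 < s2 by rewrite lt_min t1 ltrDl.
have s21 : s2 <= 1 by rewrite ge_min lexx.
have s2e : s2 - t0 < e / 2.
  have : s2 <= t0 + e / 4 by rewrite ge_min lexx orbT.
  by lra.
(* Either q vanishes at s2, or the strict signs at s1 and s2 persist at height ep above the real
   axis, where the intermediate value theorem gives a zero that is not real and so differs from
   t0. *)
have := right s2 s20 s21; rewrite le_eqVlt => /predU1P[qs|qs].
  exists (rc (s2 - t0)); rewrite nc_rc gtr0_norm ?subr_gt0 //; split=> //; first lra.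
  by rewrite -rcD subrKC.
have [s1 As1 hs1] := left _ e2; have s1t := Alt _ As1; case: As1 => _ q1p.
have [d1 d10 hd1] := near s1 _ q1p.
have [|d2 d20 hd2] := near s2 (- q (rc s2)); first by rewrite oppr_gt0.
pose ep := Num.min (e / 2) (Num.min d1 d2) / 2.
have mp : 0 < Num.min (e / 2) (Num.min d1 d2) by rewrite !lt_min e2 d10.
have ep0 : 0 < ep by rewrite divr_gt0.
have epm : ep < Num.min (e / 2) (Num.min d1 d2) by rewrite /ep ltr_divn.
move: epm; rewrite !lt_min => /and3P[epe epd1 epd2].
have ncE1 (s : R) : nc (Complex s ep - rc s) = ep.
  by rewrite ncE /= subrr expr0n add0r subr0 sqrtr_sqr gtr0_norm.
have h1 : 0 < q (Complex s1 ep).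
  have := hd1 (Complex s1 ep); rewrite ncE1 => /(_ epd1).
  by rewrite ltr_norml => /andP[]; lra.
have h2 : q (Complex s2 ep) < 0.
  have := hd2 (Complex s2 ep); rewrite ncE1 => /(_ epd2).
  by rewrite ltr_norml => /andP[]; lra.
have s12 : s1 <= s2 by rewrite ltW // (lt_trans s1t).
have [||s] := @IVT R (fun s => q (Complex s ep)) s1 s2 0 s12.
- apply: continuous_subspaceT => s; apply/cvgrPdist_lt => /= e' e'0.
  have [d d0 hd] := cq (Complex s ep) e' e'0.
  near=> u; rewrite distrC; apply: hd.
  have -> : nc (Complex u ep - Complex s ep) = `|u - s|.
    by rewrite ncE /= subrr expr0n addr0 sqrtr_sqr.
  by rewrite distrC; near: u; exact: cvgr_dist_lt.
- by rewrite ge_min le_max (ltW h1) (ltW h2) orbT.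
rewrite in_itv /= => /andP[hs1' hs2'] qs0.
exists (Complex s ep - rc t0); split.
- rewrite nc_gt0 subr_eq0 eq_complex /= negb_and orbC.
  by rewrite gt_eqF.
- apply: le_lt_trans (nc_le _) _; rewrite /= subr0 (gtr0_norm ep0).
  have : `|s - t0| < e / 2 by rewrite ltr_norml; apply/andP; split; lra.
  by lra.
- by rewrite subrKC.
Unshelve. all: by end_near. Qed.

Section SignChange.
Variables (S : V -> Prop) (c : V) (r : R) (Q psi : V -> C).
Hypothesis r0 : 0 < r.
Hypothesis lineS : forall y y' t, S y -> S y' -> S (y + t *: (y' - y)).
Hypothesis holpsi : forall y y' t, S y -> S y' -> vn (y + t *: (y' - y) - c) < r ->
  chol (fun s => psi (y + s *: (y' - y))) t.
Hypothesis contQ : forall z, vcont Q z.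
Hypothesis zeroQ : forall z, S z -> vn (z - c) < r -> complex.Re (Q z) = 0 -> psi z = 0.

(** The radii add up: r / 8 for y, and at most 3 times r / 4 for the step, as y and y' are within r
    / 4 of each other. *)
Let in_ball y y' t : vn (y - c) < r / 8 -> vn (y' - c) < r / 8 -> nc t < 3 ->
  vn (y + t *: (y' - y) - c) < r.
Proof.
move=> h1 h2 ht; rewrite addrAC; apply: le_lt_trans (vnD _ _) _; rewrite vnZ.
have h3 : vn (y' - y) <= r / 4.
  by apply: le_trans (vn_dist _ _ c) _; rewrite (vn_sub c y); lra.
apply: le_lt_trans (lerD (ltW h1) (ler_pM (nc_ge0 t) (vn_ge0 _) (ltW ht) h3)) _.
by have := r0; lra.
Qed.

(** On the complex line through y and y' the zeros of psi accumulate at t0, so psi vanishes for all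
    parameters within 2 of t0, among them the parameter 0 of y. *)
Lemma sign_change_vanish_pos y y' : S y -> S y' -> vn (y - c) < r / 8 -> vn (y' - c) < r / 8 ->
  0 < complex.Re (Q y) -> complex.Re (Q y') < 0 -> psi y = 0.
Proof.
move=> Sy Sy' hy hy' qy qy'.
pose L t := y + t *: (y' - y).
have L0 : L 0 = y by rewrite /L scale0r addr0.
have L1 : L 1 = y' by rewrite /L scale1r subrKC.
have cq t : rcont (fun t => complex.Re (Q (L t))) t.
  by apply: ccont_rcont; apply: vcont_line; exact: contQ.
have [||t0 /andP[t00 t01] acc] := sign_change_limit cq; rewrite ?L0 ?L1 //.
have nt0 : nc (rc t0) <= 1 by rewrite nc_rc ger0_norm.
have b3 t : nc t < 2 -> nc (rc t0 + t) < 3.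
  by move=> ht; apply: le_lt_trans (ncD _ _) _; lra.
have := @identity_disc R (fun t => psi (L (rc t0 + t))) 2 _ _ (- rc t0).
rewrite subrr L0 ncN; apply; last by lra.
- move=> t ht; apply: (@chol_shift _ (fun t => psi (L t))).
  by apply: holpsi => //; apply: in_ball => //; exact: b3.
- move=> e e0; have [|t [h1 h2 h3]] := acc (Num.min e 2); first by rewrite lt_min e0 ltr0n.
  move: h2; rewrite lt_min => /andP[h2 h4]; exists t; split=> //.
  apply: zeroQ => //; first exact: lineS.
  by apply: in_ball => //; exact: b3.
Qed.

End SignChange.

(** S plays the part of a complex affine subspace on which Q must already be indefinite. A point y
    with Re Q nonzero is joined to whichever of y1 and y2 has the opposite sign. *)
Lemma sign_change_vanish (S : V -> Prop) (c : V) (r : R) (Q psi : V -> C) y1 y2 : 0 < r ->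
  (forall y y' t, S y -> S y' -> S (y + t *: (y' - y))) ->
  (forall y y' t, S y -> S y' -> vn (y + t *: (y' - y) - c) < r ->
    chol (fun s => psi (y + s *: (y' - y))) t) ->
  (forall z, vcont Q z) ->
  (forall z, S z -> vn (z - c) < r -> complex.Re (Q z) = 0 -> psi z = 0) ->
  S y1 -> S y2 -> vn (y1 - c) < r / 8 -> vn (y2 - c) < r / 8 ->
  0 < complex.Re (Q y1) -> complex.Re (Q y2) < 0 ->
  forall y, S y -> vn (y - c) < r / 8 -> psi y = 0.
Proof.
move=> r0 hS hpsi cQ zQ S1 S2 h1 h2 q1 q2 y Sy hy.
case: (ltgtP 0 (complex.Re (Q y))) => [qy|qy|qy].
- exact: (@sign_change_vanish_pos S c r Q psi _ _ _ _ _ y y2).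
- apply: (@sign_change_vanish_pos S c r (fun w => - Q w) psi _ _ _ _ _ y y1);
    rewrite ?ReN ?oppr_gt0 ?oppr_lt0 //; first by move=> z; exact: vcontN.
  by move=> z Sz hz; rewrite ReN => /eqP; rewrite oppr_eq0 => /eqP; exact: zQ.
- by apply: zQ => //; apply: lt_trans hy _; rewrite ltr_divn.
Qed.

(** Each y is joined to y0 by a complex line; parameters below 3 / 2 stay within r / 4 + (3 / 2)(r /
    2) = r of c, so the identity theorem reaches y at t = 1. *)
Lemma identity_ball (c y0 : V) (r de : R) (psi : V -> C) :
  (forall y v t, vn (y + t *: v - c) < r -> chol (fun s => psi (y + s *: v)) t) ->
  0 < de -> vn (y0 - c) < r / 4 -> (forall y, vn (y - y0) < de -> psi y = 0) ->
  forall y, vn (y - c) < r / 4 -> psi y = 0.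
Proof.
move=> hpsi de0 hy0 h0 y hy.
have vy : vn (y - y0) < r / 2 by apply: le_lt_trans (vn_dist _ _ c) _; rewrite (vn_sub c y0); lra.
have v1 : 0 < vn (y - y0) + 1 by rewrite ltr_pwDr // vn_ge0.
have := @identity_disc R (fun t => psi (y0 + t *: (y - y0))) (3 / 2) _ _ 1.
rewrite scale1r subrKC nc1; apply; last by lra.
- move=> t ht; apply: hpsi; rewrite addrAC; apply: le_lt_trans (vnD _ _) _; rewrite vnZ.
  apply: lt_le_trans (ltr_leD hy0 (ler_pM (nc_ge0 t) (vn_ge0 _) (ltW ht) (ltW vy))) _.
  lra.
- move=> e e0; pose s := Num.min (e / 2) (de / (vn (y - y0) + 1) / 2).
  have s0 : 0 < s by rewrite lt_min !divr_gt0.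
  exists (rc s); rewrite nc_rc gtr0_norm //; split=> //.
    apply: (@le_lt_trans _ _ (e / 2)); first by rewrite ge_min lexx.
    by rewrite ltr_divn.
  apply: h0; rewrite addrC addKr vnZ nc_rc gtr0_norm //.
  apply: (@le_lt_trans _ _ (s * (vn (y - y0) + 1))); first by apply: ler_wpM2l; [exact: ltW|rewrite lerDl].
  rewrite -ltr_pdivlMr //; apply: (@le_lt_trans _ _ (de / (vn (y - y0) + 1) / 2)).
    by rewrite ge_min lexx orbT.
  by rewrite ltr_pdivrMr // ltr_pMr ?divr_gt0 // ltr1n.
Qed.

End SeveralVariables.

(** * Hermitian forms and polarization *)

Section HermitianForm.
Variables (R : realType) (n : nat) (eps : 'I_n -> R).
Notation C := R[i].
Notation V := 'rV[R[i]]_n.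
Notation nc := (@Normc.normc R).
Implicit Types (a b t : C) (x y z w v u : V).

(** Arbitrary real weights treat the signature form, its negative and its radical directions
    alike. *)
Definition hf z w : C := \sum_j rc (eps j) * (z 0 j * conjc (w 0 j)).
Definition hq z : R := complex.Re (hf z z).

Lemma conjcM (a b : C) : conjc (a * b) = conjc a * conjc b. Proof. exact: rmorphM. Qed.
Lemma conjcD (a b : C) : conjc (a + b) = conjc a + conjc b. Proof. exact: rmorphD. Qed.
Lemma conjcN (a : C) : conjc (- a) = - conjc a. Proof. exact: rmorphN. Qed.
Lemma conjc_rc (a : R) : conjc (rc a) = rc a.
Proof. by rewrite /rc /= oppr0. Qed.

Lemma hfDl x y w : hf (x + y) w = hf x w + hf y w.
Proof. by rewrite -big_split /=; apply: eq_bigr => j _; rewrite mxE; ring. Qed.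
Lemma hfZl t x w : hf (t *: x) w = t * hf x w.
Proof. by rewrite mulr_sumr; apply: eq_bigr => j _; rewrite mxE; ring. Qed.
Lemma hfC x y : hf y x = conjc (hf x y).
Proof.
rewrite /hf (big_morph conjc conjcD (conjc0 R)); apply: eq_bigr => j _.
by rewrite !conjcM conjc_rc conjcK (mulrC (y 0 j)).
Qed.
Lemma hfDr x y w : hf w (x + y) = hf w x + hf w y.
Proof. by rewrite hfC hfDl conjcD -!hfC. Qed.
Lemma hfZr t x w : hf w (t *: x) = conjc t * hf w x.
Proof. by rewrite hfC hfZl conjcM -hfC. Qed.
Lemma hfNl x w : hf (- x) w = - hf x w.
Proof. by rewrite -scaleN1r hfZl mulN1r. Qed.
Lemma hfNr x w : hf w (- x) = - hf w x.
Proof. by rewrite hfC hfNl conjcN -hfC. Qed.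
Lemma hf0l w : hf 0 w = 0.
Proof. by rewrite -(scale0r 0) hfZl mul0r. Qed.
Lemma hf0r w : hf w 0 = 0.
Proof. by rewrite hfC hf0l rmorph0. Qed.
Lemma hf_suml (I : Type) (s : seq I) (P : pred I) (F : I -> V) w :
  hf (\sum_(i <- s | P i) F i) w = \sum_(i <- s | P i) hf (F i) w.
Proof. by elim/big_rec2: _ => [|i a b _ <-]; rewrite ?hf0l ?hfDl. Qed.

Lemma mulcJ (z : C) : z * conjc z = rc (nc z ^+ 2).
Proof. by rewrite nc_sqr; case: z => a b; apply/eqP; rewrite eq_complex /=; apply/andP; split; apply/eqP; ring. Qed.

Lemma hf_real z : conjc (hf z z) = hf z z.
Proof. by rewrite -hfC. Qed.
Lemma hf_diag z : hf z z = rc (hq z).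
Proof.
rewrite /hq; have := hf_real z; case: (hf z z) => a b [hb].
by congr Complex; lra.
Qed.
Lemma hqE z : hq z = \sum_j eps j * nc (z 0 j) ^+ 2.
Proof.
rewrite /hq /hf; under eq_bigr do rewrite mulcJ -rcM.
by elim/big_rec2: _ => [//|j a b _ <-]; case: b => b1 b2.
Qed.
Lemma hq0 z : hf z z = 0 -> hq z = 0. Proof. by rewrite /hq => ->. Qed.
Lemma hf_hq0 z : hq z = 0 -> hf z z = 0. Proof. by rewrite hf_diag => ->. Qed.
Lemma hqZ t z : hq (t *: z) = nc t ^+ 2 * hq z.
Proof. by rewrite /hq hfZl hfZr mulrA mulcJ hf_diag -rcM. Qed.

Definition hbound : R := \sum_j `|eps j|.
Lemma hbound_ge0 : 0 <= hbound. Proof. exact: sumr_ge0. Qed.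
Lemma hf_bound z w : nc (hf z w) <= hbound * vn z * vn w.
Proof.
rewrite /hf /hbound !mulr_suml; elim/big_ind2: _ => [|a1 b1 a2 b2 h h'|j _].
- by rewrite nc0.
- by apply: le_trans (ncD _ _) _; exact: lerD.
rewrite !ncM ncJ nc_rc -mulrA ler_wpM2l //.
by apply: ler_pM; rewrite ?nc_ge0 ?vn_coord.
Qed.

Lemma vcont_hfl w z : vcont (fun u => hf u w) z.
Proof.
apply: vcont_sum => j; apply: vcontM; first exact: vcont_cst.
by apply: vcontM; [exact: vcont_coord|exact: vcont_cst].
Qed.
Lemma vcont_hfr w z : vcont (fun u => hf w u) z.
Proof.
apply: vcont_sum => j; apply: vcontM; first exact: vcont_cst.
by apply: vcontM; [exact: vcont_cst|apply/vcont_conj/vcont_coord].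
Qed.
Lemma vcont_hq z : vcont (fun u => hf u u) z.
Proof.
apply: vcont_sum => j; apply: vcontM; first exact: vcont_cst.
by apply: vcontM; [exact: vcont_coord|apply/vcont_conj/vcont_coord].
Qed.

End HermitianForm.

(** * Null curves and preservation of orthogonality *)

Section Polarization.
Variables (R : realType) (n n' : nat) (eps : 'I_n -> R) (eps' : 'I_n' -> R).
Notation C := R[i].
Notation V := 'rV[R[i]]_n.
Notation W := 'rV[R[i]]_n'.
Notation nc := (@Normc.normc R).
Notation H := (hf eps).
Notation H' := (hf eps').
Let ii : C := Complex 0 1.

Lemma iiM : ii * ii = -1.
Proof. by apply/eqP; rewrite eq_complex /=; apply/andP; split; apply/eqP; ring. Qed.
Lemma conjc_ii : conjc ii = - ii.
Proof. by apply/eqP; rewrite eq_complex /= oppr0 !eqxx. Qed.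

Lemma half_le_sub (h X T : R) : T * 6 <= h -> X <= T + 2 * T -> h / 2 <= h - X.
Proof. by move=> ? ?; lra. Qed.

Lemma half_double (x : V) : 2^-1 *: (x + x) = x.
Proof.
have -> : x + x = (2 : C) *: x by rewrite scaler_nat mulr2n.
by rewrite scalerA mulVf ?scale1r // pnatr_eq0.
Qed.

(* The curve v below is holomorphic, takes null values at real parameters, and
   passes through z and w at the conjugate parameters -i and i. *)
Section NullCurve.
Variables (q m d : V).
Hypothesis q0 : H q q = 0.
(** For real y and u = m + i y d, A y is H u u and D y is H q u, so subtracting A / (2 D) times the
    null vector q makes u null. Both are polynomials in y, hence v is holomorphic where D is
    nonzero. At y = -i and y = i, A equals H (m + d) (m - d) or its conjugate. *)
Let A (y : C) := H m m + ii * y * (H d m - H m d) + y * y * H d d.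
Let D (y : C) := H q m - ii * y * H q d.
Let v (y : C) := m + (ii * y) *: d + (- (A y / (2 * D y))) *: q.

Let null_curve_real (s : R) : D (rc s) != 0 -> H (v (rc s)) (v (rc s)) = 0.
Proof.
move=> D0; have cs : conjc (ii * rc s) = - (ii * rc s) by rewrite conjcM conjc_ii conjc_rc mulNr.
pose u := m + (ii * rc s) *: d.
have uu : H u u = A (rc s).
  rewrite /u !hfDl !hfDr !hfZl !hfZr cs /A.
  have -> : ii * rc s * (- (ii * rc s) * H d d) = - (ii * ii) * (rc s * rc s * H d d) by ring.
  by rewrite iiM; ring.
have qu : H q u = D (rc s) by rewrite /u hfDr hfZr cs /D; ring.
have uq : H u q = conjc (D (rc s)) by rewrite hfC qu.
have Ar : conjc (A (rc s)) = A (rc s) by rewrite -uu hf_real.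
have E (x : V) a : H (x + a *: q) (x + a *: q) = H x x + conjc a * H x q + a * H q x.
  by rewrite !hfDl !hfDr !hfZl !hfZr q0; ring.
rewrite /v E -/u uu qu uq conjcN conjcM conjc_inv conjcM Ar.
have -> : conjc (2 : C) = 2 by rewrite conjc_nat.
have D0' : conjc (D (rc s)) != 0 by rewrite conjc_eq0.
by field; rewrite D0 D0'.
Qed.

Let null_curve_ends : H (m + d) (m - d) = 0 -> v (- ii) = m + d /\ v ii = m - d.
Proof.
move=> h; have h' : H (m - d) (m + d) = 0 by rewrite hfC h rmorph0.
have A1 : A (- ii) = 0.
  rewrite -h /A !hfDl !hfDr !hfNr.
  have -> : ii * - ii * (H d m - H m d) = - (ii * ii) * (H d m - H m d) by ring.
  have -> : - ii * - ii * H d d = (ii * ii) * H d d by ring.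
  by rewrite iiM; ring.
have A2 : A ii = 0.
  by rewrite -h' /A !hfDl !hfDr !hfNl iiM; ring.
rewrite /v A1 A2 !mul0r oppr0 !scale0r !addr0 mulrN iiM opprK scale1r scaleN1r.
by split.
Qed.

Variables (f : V -> W) (p : V) (r : R).
Hypothesis holf : forall z i, vn (z - p) < r -> vhol (fun z => f z 0 i) z.
Hypothesis nullf : forall z, vn (z - p) < r -> H z z = 0 -> H' (f z) (f z) = 0.
Hypothesis curve_in : forall y, nc y < 2 -> D y != 0 /\ vn (v y - p) < r.

(** The product of f(v y) with f at v of the conjugate parameter is holomorphic in y by reflection
    and vanishes at real y, where v y is null; its value at -i is the claim. *)
Lemma polarization_curve : H (m + d) (m - d) = 0 -> H' (f (m + d)) (f (m - d)) = 0.
Proof.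
move=> h; have [v1 v2] := null_curve_ends h.
pose phi y := \sum_i rc (eps' i) * (f (v y) 0 i * conjc (f (v (conjc y)) 0 i)).
have cv j y : nc y < 2 -> chol (fun y => v y 0 j) y.
  move=> /curve_in[D0 _].
  have hD : chol D y.
    apply: cholB; first exact: chol_cst.
    apply: cholM; last exact: chol_cst.
    by apply: cholM; [exact: chol_cst|exact: chol_id].
  have hA : chol A y.
    apply: cholD; [apply: cholD|]; [exact: chol_cst| |]; apply: cholM; try exact: chol_cst.
      by apply: cholM; [exact: chol_cst|exact: chol_id].
    by apply: cholM; exact: chol_id.
  apply: (@chol_near _ (fun y => m 0 j + (ii * y) * d 0 j + (- (A y * (2 * D y)^-1)) * q 0 j) _ _ 1) => //.
    by move=> w _; rewrite /v !mxE.
  apply: cholD.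
    apply: cholD; first exact: chol_cst.
    apply: cholM; last exact: chol_cst.
    by apply: cholM; [exact: chol_cst|exact: chol_id].
  apply: cholM; last exact: chol_cst.
  apply/cholN/cholM => //; apply: cholV.
    by apply: cholM; [exact: chol_cst|].
  by rewrite mulf_neq0 // pnatr_eq0.
have cf i y : nc y < 2 -> chol (fun y => f (v y) 0 i) y.
  move=> hy; have [_ hv] := curve_in hy.
  apply: (@vhol_chain _ _ (fun z => f z 0 i) v); first exact: holf.
  by move=> j; exact: cv.
have cphi y : nc y < 2 -> chol phi y.
  move=> hy; apply: chol_sum => i; apply: cholM; first exact: chol_cst.
  apply: cholM; first exact: cf.
  have := @chol_conj R (fun y => f (v y) 0 i) (conjc y); rewrite conjcK; apply.
  by apply: cf; rewrite ncJ.
have nii : nc ii < 2 by rewrite ncE /= expr0n expr1n add0r sqrtr1 ltr1n.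
have <- : phi (- ii) = H' (f (m + d)) (f (m - d)).
  by rewrite /phi conjcN -/ii conjc_ii opprK v1 v2.
have idd := @identity_disc R phi 2 cphi; apply: idd; last by rewrite ncN.
move=> e e0; pose s := Num.min (e / 2) 1.
have s0 : 0 < s by rewrite lt_min ltr01 divr_gt0.
have s1 : s <= 1 by rewrite ge_min lexx orbT.
have nr : nc (rc s) < 2 by rewrite nc_rc gtr0_norm //; lra.
exists (rc s); rewrite nc_rc gtr0_norm //; split=> //.
  apply: (@le_lt_trans _ _ (e / 2)); first by rewrite ge_min lexx.
  by rewrite ltr_divn.
have [D0 hv] := curve_in nr.
by rewrite /phi conjc_rc; apply: nullf => //; exact: null_curve_real.
Qed.

End NullCurve.

(** One null vector q not orthogonal to p serves all pairs near p: D stays close to H q p, and A is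
    small because it vanishes for z = w = p. *)
Lemma polarization (f : V -> W) (p q : V) (r : R) : 0 < r -> H q q = 0 -> H p p = 0 -> H q p != 0 ->
  (forall z i, vn (z - p) < r -> vhol (fun z => f z 0 i) z) ->
  (forall z, vn (z - p) < r -> H z z = 0 -> H' (f z) (f z) = 0) ->
  exists2 rho, 0 < rho & forall z w, vn (z - p) < rho -> vn (w - p) < rho ->
    H z w = 0 -> H' (f z) (f w) = 0.
Proof.
move=> r0 q0 p0 qp holf nullf.
pose K := hbound eps; have K0 : 0 <= K := hbound_ge0 eps.
have vp := vn_ge0 p; have vq := vn_ge0 q.
pose h0 := nc (H q p); have h00 : 0 < h0 by rewrite nc_gt0.
(* For |y| < 2: [rho * K1] bounds A, [rho * K3 <= h0] keeps |D| above h0 / 2, and [rho * K2] bounds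
   the distance from the curve to p. *)
pose K1 := K * (6 * vn p + 9); have K10 : 0 <= K1 by rewrite mulr_ge0 // addr_ge0 // mulr_ge0.
pose K2 := 3 + K1 * vn q / h0.
have K20 : 0 < K2 by apply: ltr_pwDl => //; apply: divr_ge0; [exact: mulr_ge0|exact: ltW].
pose K3 := 6 * (K * vn q) + 1.
have K30 : 0 < K3 by rewrite ltr_pwDr // !mulr_ge0.
pose rho := Num.min 1 (Num.min (h0 / K3) (r / K2 / 2)).
have rho0 : 0 < rho by rewrite !lt_min ltr01 /= divr_gt0 // !divr_gt0.
have rho1 : rho <= 1 by rewrite ge_min lexx.
have rho2 : rho * K3 <= h0 by rewrite -ler_pdivlMr // !ge_min lexx orbT.
have rho3 : rho * K2 < r.
  apply: (@le_lt_trans _ _ (r / 2)); last by rewrite ltr_divn.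
  by rewrite -ler_pdivlMr // mulrAC !ge_min lexx !orbT.
exists rho => // z w hz hw hzw.
pose m := 2^-1 *: (z + w); pose d := 2^-1 *: (z - w).
have zE : z = m + d by rewrite /m /d -scalerDr addrACA subrr addr0 half_double.
have wE : w = m - d by rewrite /m /d -scalerBr opprB addrC subrKA half_double.
have n2 : nc (2^-1 : C) = 2^-1.
  rewrite ncV; congr (_^-1).
  have -> : (2 : C) = rc 2 by apply/eqP; rewrite eq_complex /= addr0 !eqxx.
  by rewrite nc_rc ger0_norm.
have hzp := vn_ge0 (z - p); have hwp := vn_ge0 (w - p).
have mp : vn (m - p) <= rho.
  have -> : m - p = 2^-1 *: ((z - p) + (w - p)).
    rewrite /m addrACA -opprD scalerBr; congr (_ - _).
    by rewrite half_double.
  by rewrite vnZ n2; have := vnD (z - p) (w - p); lra.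
have dp : vn d <= rho.
  have -> : d = 2^-1 *: ((z - p) - (w - p)) by rewrite /d opprB addrA subrK.
  by rewrite vnZ n2; have := vnB (z - p) (w - p); lra.
have mn : vn m <= vn p + 1.
  by rewrite -(subrK p m) addrC; apply: le_trans (vnD _ _) _; rewrite lerD2l (le_trans mp).
have hb a b : nc (H a b) <= K * vn a * vn b by exact: hf_bound.
rewrite zE wE in hzw *.
apply: (@polarization_curve q m d q0 f p r holf nullf _ hzw) => y hy.
have y0 := nc_ge0 y; have nii : nc ii = 1 by rewrite ncE /= expr0n expr1n add0r sqrtr1.
have vd := vn_ge0 d; have vm := vn_ge0 m; have vmp := vn_ge0 (m - p).
have KM a b c : 0 <= a -> a <= b -> 0 <= c -> K * c * a <= K * c * b.
  by move=> ? ? ?; rewrite ler_wpM2l // mulr_ge0.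
set D := H q m - ii * y * H q d.
have Dge : h0 / 2 <= nc D.
  have -> : D = H q p - (H q (p - m) + ii * y * H q d).
    by rewrite hfDr hfNr !opprD opprK !addrA subrr add0r.
  apply: le_trans (nc_lerB _ _); rewrite -/h0.
  have t1 : nc (H q (p - m)) <= K * vn q * rho.
    by apply: le_trans (hb _ _) _; rewrite vn_sub; apply: KM.
  have t2 : nc (ii * y * H q d) <= 2 * (K * vn q * rho).
    rewrite !ncM nii mul1r; apply: ler_pM; rewrite ?nc_ge0 ?(ltW hy) //.
    by apply: le_trans (hb _ _) _; apply: KM.
  have t3 := ncD (H q (p - m)) (ii * y * H q d).
  have t4 : K * vn q * rho * 6 <= h0.
    apply: le_trans rho2; have -> : rho * K3 = K * vn q * rho * 6 + rho by rewrite /K3; ring.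
    by rewrite lerDl ltW.
  exact: half_le_sub t4 (le_trans t3 (lerD t1 t2)).
have D0 : D != 0 by rewrite -nc_gt0; apply: lt_le_trans Dge; rewrite divr_gt0.
split=> //.
set A := H m m + ii * y * (H d m - H m d) + y * y * H d d.
have KB a b c e : 0 <= a -> 0 <= b -> a <= c -> b <= e -> K * a * b <= K * (c * e).
  by move=> ? ? ? ?; rewrite -mulrA ler_wpM2l // ler_pM.
have Ale : nc A <= rho * K1.
  have mm : H m m = H (m - p) m + H p (m - p).
    by rewrite hfDl hfNl hfDr hfNr p0; ring.
  have t1 : nc (H m m) <= K * (rho * (vn p + 1)) + K * (vn p * rho).
    rewrite mm; apply: le_trans (ncD _ _) _.
    by apply: lerD; apply: le_trans (hb _ _) _; apply: KB.
  have t2 : nc (ii * y * (H d m - H m d)) <= 2 * (K * (rho * (vn p + 1)) + K * ((vn p + 1) * rho)).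
    rewrite !ncM nii mul1r; apply: ler_pM; rewrite ?nc_ge0 ?(ltW hy) //.
    by apply: le_trans (ncB _ _) _; apply: lerD; apply: le_trans (hb _ _) _; apply: KB.
  have t3 : nc (y * y * H d d) <= 2 * 2 * (K * (rho * 1)).
    rewrite !ncM; apply: ler_pM; rewrite ?mulr_ge0 ?nc_ge0 //.
      by apply: ler_pM; rewrite ?nc_ge0 // ltW.
    by apply: le_trans (hb _ _) _; apply: KB => //; apply: le_trans rho1.
  apply: le_trans (ncD _ _) _; apply: le_trans (lerD (ncD _ _) (lexx _)) _.
  apply: le_trans (lerD (lerD t1 t2) t3) _.
  by rewrite /K1 le_eqVlt; apply/orP; left; apply/eqP; ring.
have Ky : nc (- (A / (2 * D))) <= rho * K1 / h0.
  rewrite ncN ncM ncV ncM ler_pdivrMr; last by rewrite mulr_gt0 ?nc_gt0 ?pnatr_eq0.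
  apply: le_trans Ale _.
  have n22 : nc (2 : C) = 2 by rewrite -[LHS]invrK -ncV n2 invrK.
  rewrite n22 -(mulrA (rho * K1)); apply: ler_peMr; first exact: mulr_ge0 (ltW rho0) K10.
  by rewrite mulrC ler_pdivlMr // mul1r -ler_pdivrMl // mulrC.
rewrite -/D -/A -(addrA m) addrAC.
apply: le_lt_trans (vnD _ _) _.
have t1 : vn ((ii * y) *: d + - (A / (2 * D)) *: q) <= 2 * rho + rho * K1 / h0 * vn q.
  apply: le_trans (vnD _ _) _; rewrite (vnZ _ d) (vnZ _ q); apply: lerD.
    rewrite ncM nii mul1r; exact: ler_pM y0 vd (ltW hy) dp.
  by rewrite ler_wpM2r.
apply: le_lt_trans (lerD mp t1) _.
have -> // : rho + (2 * rho + rho * K1 / h0 * vn q) = rho * K2 by rewrite /K2; field; rewrite gt_eqF.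
Qed.
End Polarization.

(** More unknowns than equations; imposing only the columns in P makes it possible to kill the
    coordinates of one sign. *)
Lemma kernel_vector (K : fieldType) (I J : finType) (P : {set J}) (M : I -> J -> K) :
  (#|P| < #|I|)%N -> exists c : I -> K, (exists i, c i != 0) /\
    forall j, j \in P -> \sum_i c i * M i j = 0.
Proof.
move=> hIJ.
pose A := \matrix_(i < #|I|, j < #|P|) M (enum_val i) (enum_val j).
have : kermx A != 0.
  rewrite kermx_eq0 /row_free; apply/negP => /eqP rA.
  by have := rank_leq_col A; rewrite rA leqNgt hIJ.
case/rowV0Pn => v /sub_kermxP vA v0.
exists (fun i => v 0 (enum_rank i)); split.
  case/rV0Pn: v0 => i vi; exists (enum_val i); by rewrite enum_valK.
move=> j jP; have := congr1 (fun X : 'rV_#|P| => X 0 (enum_rank_in jP j)) vA.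
rewrite !mxE => vj; apply: etrans vj.
rewrite (reindex (@enum_val I predT)) /=; last by apply: onW_bij; exact: enum_val_bij.
by apply: eq_bigr => i _; rewrite enum_valK !mxE enum_rankK_in.
Qed.

Section FormSigns.
Variables (R : realType) (n : nat) (eps : 'I_n -> R).
Notation C := R[i].
Notation V := 'rV[R[i]]_n.
Notation nc := (@Normc.normc R).
Notation H := (hf eps).
Notation N := (hq eps).

Definition supported (P : {set 'I_n}) (e : V) := forall j, j \notin P -> e 0 j = 0.
Definition Pos : {set 'I_n} := finset (fun j => 0 < eps j).
Definition Neg : {set 'I_n} := finset (fun j => eps j < 0).

Lemma supported_pos e : supported Pos e -> e != 0 -> 0 < N e.
Proof.
move=> se /rV0Pn[j ej]; rewrite hqE (bigD1 j) //=.
have ge i : 0 <= eps i * nc (e 0 i) ^+ 2.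
  case: (boolP (i \in Pos)) => [|/se ->]; last by rewrite nc0 expr0n mulr0.
  by rewrite inE => /ltW hi; rewrite mulr_ge0 // sqr_ge0.
rewrite ltr_pwDl ?sumr_ge0 //.
have : j \in Pos by apply: contraR ej => /se ->.
by rewrite inE => hj; rewrite mulr_gt0 // exprn_gt0 // nc_gt0.
Qed.

(** A dimension count in the span of the coordinate vectors of P, on which the form is definite when
    P is [Pos] or [Neg]. *)
Lemma exists_orth (P : {set 'I_n}) m (x : 'I_m -> V) : (m < #|P|)%N ->
  exists e, [/\ e != 0, supported P e & forall k, H e (x k) = 0].
Proof.
move=> mP.
have [|c [[i ci] hc]] := @kernel_vector C 'I_#|P| 'I_m (finset predT)
  (fun i k => H (delta_mx 0 (enum_val i)) (x k)); first by rewrite cardsE !card_ord.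
pose e : V := \sum_(i < #|P|) c i *: delta_mx 0 (enum_val i).
have eE j : e 0 j = \sum_(i < #|P|) c i * (j == enum_val i)%:R.
  by rewrite summxE; apply: eq_bigr => k _; rewrite !mxE.
exists e; split.
- apply/rV0Pn; exists (enum_val i); rewrite eE (bigD1 i) //= eqxx mulr1 big1 ?addr0 //.
  by move=> k ki; rewrite (inj_eq enum_val_inj) eq_sym (negbTE ki) mulr0.
- move=> j jP; rewrite eE big1 // => k _; case: eqP => [jk|]; last by rewrite mulr0.
  by move: jP; rewrite jk enum_valP.
- move=> k; rewrite hf_suml -[RHS](hc k _) ?inE //; apply: eq_bigr => l _.
  by rewrite hfZl.
Qed.

(** In the induction the next vector has to be orthogonal to the m earlier ones and to a and b: m +
    2 conditions against more than m + 2 positive coordinates. *)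
Lemma exists_orth_frame (a b : V) m : (m + 2 <= #|Pos|)%N -> exists es : nat -> V,
  (forall i, (i < m)%N -> [/\ 0 < N (es i), H (es i) a = 0 & H (es i) b = 0]) /\
  forall i j, (i < m)%N -> (j < m)%N -> i != j -> H (es i) (es j) = 0.
Proof.
elim: m => [|m IH] hm; first by exists (fun=> 0).
have [es [h1 h2]] := IH (ltnW hm).
pose x (k : 'I_(m + 2)) := if (k < m)%N then es k else if val k == m then a else b.
have [e [e0 se he]] := exists_orth (P := Pos) x hm.
have em k : (k < m)%N -> H e (es k) = 0.
  move=> km; have km2 : (k < m + 2)%N by rewrite (leq_trans km) // leq_addr.
  by have := he (Ordinal km2); rewrite /x /= km.
have ea : H e a = 0.
  have h : (m < m + 2)%N by rewrite addn2 ltnW.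
  by have := he (Ordinal h); rewrite /x /= ltnn eqxx.
have eb : H e b = 0.
  have h : (m.+1 < m + 2)%N by rewrite addn2.
  by have := he (Ordinal h); rewrite /x /= ltnNge leqnSn /= eqn_leq ltnn.
exists (fun i => if (i < m)%N then es i else e); split.
  move=> i; rewrite ltnS leq_eqVlt => /predU1P[->|im]; last by rewrite im; exact: h1.
  by rewrite ltnn; split=> //; exact: supported_pos.
move=> i j; rewrite !ltnS (leq_eqVlt i) (leq_eqVlt j).
move=> /predU1P[->|im] /predU1P[->|jm]; rewrite ?ltnn ?eqxx ?im ?jm //.
- by move=> _; exact: em.
- by move=> _; rewrite hfC em // rmorph0.
- exact: h2.
Qed.

End FormSigns.

Section NegatedForm.
Variables (R : realType) (n : nat) (eps : 'I_n -> R).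

Lemma hfN x y : hf (fun i => - eps i) x y = - hf eps x y.
Proof. by rewrite /hf -sumrN; apply: eq_bigr => i _; rewrite rcN mulNr. Qed.

Lemma hqN x : hq (fun i => - eps i) x = - hq eps x.
Proof. by rewrite !hqE -sumrN; apply: eq_bigr => i _; rewrite mulNr. Qed.

Lemma PosN : Pos (fun i => - eps i) = Neg eps.
Proof. by apply/setP => i; rewrite !inE oppr_gt0. Qed.

Lemma NegN : Neg (fun i => - eps i) = Pos eps.
Proof. by apply/setP => i; rewrite !inE oppr_lt0. Qed.

Lemma supported_neg e : supported (Neg eps) e -> e != 0 -> hq eps e < 0.
Proof. by move=> se e0; rewrite -oppr_gt0 -hqN; apply: supported_pos e0; rewrite PosN. Qed.

End NegatedForm.

(** * Minors expressing linear dependence *)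

Section Det3.
Variables (R : realType) (n : nat).
Notation C := R[i].
Notation V := 'rV[R[i]]_n.
Implicit Types (a b c : V) (i j k : 'I_n).

Definition det2 a b i j : C := a 0 i * b 0 j - a 0 j * b 0 i.
Definition det3 a b c i j k : C :=
  a 0 i * det2 b c j k - a 0 j * det2 b c i k + a 0 k * det2 b c i j.

Lemma det3_dependent (d0 d1 d2 : C) a b c : (d0 != 0) || (d1 != 0) || (d2 != 0) ->
  d0 *: a + d1 *: b + d2 *: c = 0 -> forall i j k, det3 a b c i j k = 0.
Proof.
move=> hd h0 i j k.
have E l : d0 * a 0 l + d1 * b 0 l + d2 * c 0 l = 0.
  by have := congr1 (fun X : V => X 0 l) h0; rewrite !mxE.
have M0 : d0 * det3 a b c i j k = 0.
  have Ea l : d0 * a 0 l = - (d1 * b 0 l + d2 * c 0 l) by apply/eqP; rewrite -addr_eq0 addrA E.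
  rewrite /det3 mulrDr mulrBr !mulrA !Ea /det2; ring.
have M1 : d1 * det3 a b c i j k = 0.
  have Ea l : d1 * b 0 l = - (d0 * a 0 l + d2 * c 0 l).
    by apply/eqP; rewrite -addr_eq0 addrCA addrA E.
  have -> : d1 * det3 a b c i j k = a 0 i * ((d1 * b 0 j) * c 0 k - (d1 * b 0 k) * c 0 j)
    - a 0 j * ((d1 * b 0 i) * c 0 k - (d1 * b 0 k) * c 0 i)
    + a 0 k * ((d1 * b 0 i) * c 0 j - (d1 * b 0 j) * c 0 i) by rewrite /det3 /det2; ring.
  by rewrite !Ea; ring.
have M2 : d2 * det3 a b c i j k = 0.
  have Ea l : d2 * c 0 l = - (d0 * a 0 l + d1 * b 0 l).
    by apply/eqP; rewrite -addr_eq0 addrC E.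
  have -> : d2 * det3 a b c i j k = a 0 i * (b 0 j * (d2 * c 0 k) - b 0 k * (d2 * c 0 j))
    - a 0 j * (b 0 i * (d2 * c 0 k) - b 0 k * (d2 * c 0 i))
    + a 0 k * (b 0 i * (d2 * c 0 j) - b 0 j * (d2 * c 0 i)) by rewrite /det3 /det2; ring.
  by rewrite !Ea; ring.
apply/eqP; case/orP: hd => [/orP[]|] hd.
- by move/eqP: M0; rewrite mulf_eq0 (negbTE hd).
- by move/eqP: M1; rewrite mulf_eq0 (negbTE hd).
- by move/eqP: M2; rewrite mulf_eq0 (negbTE hd).
Qed.

Lemma det3_span a b c i j : det2 a c i j != 0 -> (forall k, det3 a b c i j k = 0) ->
  exists al be, b = al *: a + be *: c.
Proof.
move=> d0 hd; exists (det2 b c i j / det2 a c i j), (det2 a b i j / det2 a c i j).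
apply/rowP => k; rewrite !mxE.
have h : b 0 k * det2 a c i j = det2 b c i j * a 0 k + det2 a b i j * c 0 k.
  by rewrite -[RHS]subr0 -(hd k) /det3 /det2; ring.
by apply: (mulIf d0); rewrite h; field.
Qed.

End Det3.

(** * Lines with dependent images *)

Section CholDet.
Variables (R : realType) (n : nat).
Notation C := R[i].

Lemma chol_ext (g h : C -> C) t : (forall s, g s = h s) -> chol g t -> chol h t.
Proof. by move=> gh; apply: (@chol_near _ _ _ _ 1). Qed.

Lemma chol_det3 (a b c : C -> 'rV[C]_n) t i j k : (forall l, chol (fun s => a s 0 l) t) ->
  (forall l, chol (fun s => b s 0 l) t) -> (forall l, chol (fun s => c s 0 l) t) ->
  chol (fun s => det3 (a s) (b s) (c s) i j k) t.
Proof.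
move=> ha hb hc.
have hd u v : chol (fun s => det2 (b s) (c s) u v) t by apply: cholB; apply: cholM.
by apply: cholD; [apply: cholB|]; apply: cholM.
Qed.

Lemma vcont_Re_gt (F : 'rV[C]_n -> C) z (m : R) : vcont F z -> m < complex.Re (F z) ->
  exists2 d, 0 < d & forall w, vn (w - z) < d -> m < complex.Re (F w).
Proof.
move=> cF hm; have [|d d0 hd] := cF (complex.Re (F z) - m); first by rewrite subr_gt0.
exists d => // w /hd h.
have := nc_Re (F w - F z); rewrite ReD ReN => h2.
by have := le_lt_trans h2 h; rewrite ltr_norml => /andP[]; lra.
Qed.

Lemma vcont_Re_lt (F : 'rV[C]_n -> C) z (m : R) : vcont F z -> complex.Re (F z) < m ->
  exists2 d, 0 < d & forall w, vn (w - z) < d -> complex.Re (F w) < m.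
Proof.
move=> /vcontN cF hm; have [|d d0 hd] := vcont_Re_gt (m := - m) cF; first by rewrite ReN ltrN2.
by exists d => // w /hd; rewrite ReN ltrN2.
Qed.

Lemma small_scale (v : 'rV[C]_n) (d : R) : 0 < d -> exists2 t : R, 0 < t & vn (rc t *: v) < d.
Proof.
move=> d0; have v0 := vn_ge0 v; have v1 : 0 < vn v + 1 by rewrite ltr_pwDr.
exists (d / (vn v + 1)); first by rewrite divr_gt0.
rewrite vnZ nc_rc ger0_norm ?divr_ge0 ?ltW // mulrAC ltr_pdivrMr // ltr_pM2l // ltrDl //.
Qed.

End CholDet.

(** Moving p along a positive vector orthogonal to it creates no cross terms, so the sign is that of
    the added vector. *)
Lemma exists_positive (R : realType) n (eps : 'I_n -> R) (p : 'rV[R[i]]_n) (d : R) :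
  (2 <= #|Pos eps|)%N -> hf eps p p = 0 -> 0 < d ->
  exists2 y, vn (y - p) < d & 0 < hq eps y.
Proof.
move=> pos2 pp d0; have [en [en0 sen /(_ ord0) hen]] := @exists_orth R n eps (Pos eps) 1 (fun=> p) pos2.
have [t t0 ht] := small_scale en d0.
exists (p + rc t *: en); first by rewrite addrC addKr.
have hpn : hf eps p en = 0 by rewrite hfC hen rmorph0.
rewrite /hq !hfDl !hfDr !hfZl !hfZr pp hen hpn !mulr0 !add0r conjc_rc mulrA -rcM.
by rewrite Re_mul /= mul0r subr0 pmulr_rgt0 ?mulr_gt0 //; exact: supported_pos.
Qed.

Lemma exists_negative (R : realType) n (eps : 'I_n -> R) (p : 'rV[R[i]]_n) (d : R) :
  (2 <= #|Neg eps|)%N -> hf eps p p = 0 -> 0 < d -> exists2 y, vn (y - p) < d & hq eps y < 0.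
Proof.
rewrite -PosN => neg2 pp d0.
have [|y hy Ny] := exists_positive neg2 (p := p) _ d0; first by rewrite hfN pp oppr0.
by exists y; rewrite // -oppr_gt0 -hqN.
Qed.

Section LocalMap.
Variables (R : realType) (n n' : nat) (eps : 'I_n -> R) (eps' : 'I_n' -> R).
Notation C := R[i].
Notation V := 'rV[R[i]]_n.
Notation W := 'rV[R[i]]_n'.
Notation nc := (@Normc.normc R).
Notation H := (hf eps).
Notation H' := (hf eps').
Notation N := (hq eps).
Notation N' := (hq eps').
Variables (f : V -> W) (p : V) (rho : R).
Notation B z := (vn (z - p) < rho).
Hypothesis rho0 : 0 < rho.
Hypothesis holf : forall z i, B z -> vhol (fun z => f z 0 i) z.
Hypothesis radf : forall z i, eps' i = 0 -> f z 0 i = 0.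
Hypothesis orthf : forall z w, B z -> B w -> H z w = 0 -> H' (f z) (f w) = 0.
Hypothesis posf : forall z, B z -> 0 < N z -> 0 < N' (f z).
Hypothesis pos2 : (2 <= #|Pos eps|)%N.
Hypothesis neg2 : (2 <= #|Neg eps|)%N.
Hypothesis posle : (#|Pos eps'| <= #|Pos eps|)%N.

Lemma chol_on_line x v t i : B (x + t *: v) -> chol (fun s => f (x + s *: v) 0 i) t.
Proof.
move=> hB; apply: (@vhol_chain _ _ (fun z => f z 0 i) (fun s => x + s *: v)); first exact: holf.
by move=> j; exact: chol_line.
Qed.

(* r - 2 orthogonal positive vectors orthogonal to the null line have positive
   orthogonal images; by the index bound only a 2-dimensional space is left
   for the image of the null line. *)
Lemma null_line_dependent a b (al be : 'I_3 -> C) : H a a = 0 -> H b b = 0 -> H a b = 0 ->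
  B a -> (forall k, B (al k *: a + be k *: b)) ->
  exists d : 'I_3 -> C, (exists k, d k != 0) /\ \sum_k d k *: f (al k *: a + be k *: b) = 0.
Proof.
move=> aa bb ab Ba Bx.
have ba : H b a = 0 by rewrite hfC ab rmorph0.
pose m := (#|Pos eps| - 2)%N.
have hm : (m + 2 <= #|Pos eps|)%N by rewrite subnK.
have [es [h1 h2]] := exists_orth_frame a b hm.
have [eta eta0 heta] : exists2 eta : R, 0 < eta & forall i, (i < m)%N -> B (a + rc eta *: es i).
  pose S := \sum_(i < m) vn (es i).
  have S0 : 0 <= S by apply: sumr_ge0 => i _; exact: vn_ge0.
  have ra : 0 < rho - vn (a - p) by rewrite subr_gt0.
  exists ((rho - vn (a - p)) / (S + 1)); first by rewrite divr_gt0 // ltr_pwDr.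
  move=> i im; rewrite addrAC; apply: le_lt_trans (vnD _ _) _; rewrite -ltrBrDl vnZ nc_rc.
  rewrite ger0_norm ?divr_ge0 ?(ltW ra) ?addr_ge0 // mulrAC ltr_pdivrMr ?ltr_pwDr // ltr_pM2l //.
  have : vn (es i) <= S by rewrite /S (bigD1 (Ordinal im)) //= lerDl sumr_ge0 // => k _; exact: vn_ge0.
  by lra.
(* Adding the null vector a, orthogonal to every e_i, brings multiples of the e_i near a and leaves
   their products unchanged up to the factor eta^2. *)
pose y (i : 'I_m) := a + rc eta *: es i.
pose x k := al k *: a + be k *: b.
have esa i : (i < m)%N -> H a (es i) = 0 by move=> /h1[_ h _]; rewrite hfC h rmorph0.
have yy i j : H (y i) (y j) = rc (eta ^+ 2) * H (es i) (es j).
  have [_ ia _] := h1 i (ltn_ord i); have ja := esa j (ltn_ord j).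
  rewrite /y !hfDl !hfDr !hfZl !hfZr aa ia ja conjc_rc expr2 rcM; ring.
have yx i k : H (y i) (x k) = 0.
  have [_ ia ib] := h1 i (ltn_ord i).
  by rewrite /y /x !hfDl !hfDr !hfZl !hfZr aa ia ib ab; ring.
have xx k l : H (x k) (x l) = 0.
  by rewrite /x !hfDl !hfDr !hfZl !hfZr aa bb ab ba; ring.
pose F (s : 'I_m + 'I_3) : W := match s with inl i => f (y i) | inr k => f (x k) end.
(* Since m + 2 = [#|Pos eps|], the m + 3 images outnumber the positive coordinates, and some
   nontrivial combination u + v has all of these equal to zero. *)
have [|c [cn0 hc]] := @kernel_vector C ('I_m + 'I_3)%type 'I_n' (Pos eps') (fun s j => F s 0 j).
  rewrite card_sum !card_ord; apply: leq_ltn_trans posle _.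
  by rewrite /m -[X in (X < _)%N](subnK pos2) ltn_add2l.
pose u := \sum_(i < m) c (inl i) *: f (y i); pose v := \sum_k c (inr k) *: f (x k).
have uvE j : (u + v) 0 j = \sum_s c s * F s 0 j.
  by rewrite big_sumType /= mxE /u /v !summxE; congr (_ + _); apply: eq_bigr => i _; rewrite mxE.
have uv0 j : eps' j != 0 -> j \notin Neg eps' -> (u + v) 0 j = 0.
  move=> ej; rewrite inE -leNgt => ej'; rewrite uvE hc // inE lt_def ej //.
have uf w : H' u w = \sum_(i < m) c (inl i) * H' (f (y i)) w.
  by rewrite /u hf_suml; apply: eq_bigr => i _; rewrite hfZl.
have vf w : H' v w = \sum_k c (inr k) * H' (f (x k)) w.
  by rewrite /v hf_suml; apply: eq_bigr => i _; rewrite hfZl.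
have By i : B (y i) by exact: heta.
have fu w i : H' w (f (y i)) = conjc (H' (f (y i)) w) by rewrite hfC.
have uv : H' u v = 0.
  rewrite uf big1 // => i _; rewrite hfC vf big1 ?rmorph0 ?mulr0 // => k _.
  by rewrite hfC orthf ?rmorph0 ?mulr0 //; exact: Bx.
have vv : H' v v = 0.
  rewrite vf big1 // => k _; rewrite hfC vf big1 ?rmorph0 ?mulr0 // => l _.
  by rewrite orthf ?mulr0 //; exact: Bx.
have yi i : H' (f (y i)) u = conjc (c (inl i)) * H' (f (y i)) (f (y i)).
  rewrite hfC uf (bigD1 i) //= big1 ?addr0; last first.
    move=> j ji; rewrite orthf ?mulr0 // yy h2 ?mulr0 //.
  by rewrite conjcM -hfC.
have uu : H' u u = rc (\sum_(i < m) nc (c (inl i)) ^+ 2 * N' (f (y i))).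
  rewrite uf; transitivity (\sum_(i < m) rc (nc (c (inl i)) ^+ 2 * N' (f (y i)))).
    by apply: eq_bigr => i _; rewrite yi mulrA mulcJ hf_diag -rcM.
  by elim/big_rec2: _ => [//|i p1 p2 _ ->]; rewrite rcD.
have Nuv : N' (u + v) = \sum_(i < m) nc (c (inl i)) ^+ 2 * N' (f (y i)).
  have vu : H' v u = 0 by rewrite hfC uv rmorph0.
  by rewrite /hq !hfDl !hfDr uu uv vu vv !addr0.
have pN i : 0 < N' (f (y i)).
  apply: posf => //; have [h _ _] := h1 i (ltn_ord i).
  by rewrite /hq yy hf_diag -rcM /= mulr_gt0 // exprn_gt0.
have tge i : 0 <= nc (c (inl i)) ^+ 2 * N' (f (y i)) by rewrite mulr_ge0 ?sqr_ge0 // ltW.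
have tle j : eps' j * nc ((u + v) 0 j) ^+ 2 <= 0.
  have [->|ej] := eqVneq (eps' j) 0; first by rewrite mul0r.
  case: (boolP (j \in Neg eps')) => [|jN]; last by rewrite uv0 // nc0 expr0n mulr0.
  by rewrite inE => /ltW hj; rewrite mulr_le0_ge0 // sqr_ge0.
(* Coordinates show that the norm of u + v is nonpositive, orthogonality that it is a sum of
   nonnegative terms. So every coefficient of an f(y_i) vanishes and only the points of the null
   line remain in the relation. *)
have Nle : N' (u + v) <= 0.
  by rewrite hqE -oppr_ge0 -sumrN sumr_ge0 // => j _; rewrite oppr_ge0.
have Nz : N' (u + v) = 0.
  by apply/eqP; rewrite eq_le Nle Nuv sumr_ge0.
have c0 i : c (inl i) = 0.
  move: Nz; rewrite Nuv => /eqP; rewrite psumr_eq0 // => /allP /(_ i (mem_index_enum _)) /=.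
  by rewrite mulf_eq0 (gt_eqF (pN i)) orbF expf_eq0 /= nc_eq0 => /eqP.
have u0 : u = 0 by rewrite /u big1 // => i _; rewrite c0 scale0r.
exists (fun k => c (inr k)); split.
  by case: cn0 => -[i|k] ck; [rewrite c0 eqxx in ck|exists k].
(* Radical coordinates vanish by [radf], positive ones by the choice of c, and negative ones because
   the norm of u + v is zero. *)
rewrite -/v; apply/rowP => j; rewrite [RHS]mxE.
have [ej|ej] := eqVneq (eps' j) 0.
  by rewrite /v summxE big1 // => k _; rewrite mxE radf ?mulr0.
case: (boolP (j \in Neg eps')) => jN; last by have := uv0 j ej jN; rewrite u0 add0r.
move/eqP: Nz; rewrite -oppr_eq0 hqE -sumrN psumr_eq0; last by move=> k _; rewrite oppr_ge0.
move=> /allP /(_ j (mem_index_enum _)) /=.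
by rewrite oppr_eq0 mulf_eq0 (negbTE ej) /= expf_eq0 /= nc_eq0 u0 add0r => /eqP.
Qed.

Lemma null_line_det3 a b (a0 a1 a2 b0 b1 b2 : C) : H a a = 0 -> H b b = 0 -> H a b = 0 ->
  B a -> B (a0 *: a + b0 *: b) -> B (a1 *: a + b1 *: b) -> B (a2 *: a + b2 *: b) ->
  forall i j k, det3 (f (a0 *: a + b0 *: b)) (f (a1 *: a + b1 *: b)) (f (a2 *: a + b2 *: b)) i j k = 0.
Proof.
move=> aa bb ab Ba B0 B1 B2.
pose al (k : 'I_3) := nth 0 [:: a0; a1; a2] k; pose be (k : 'I_3) := nth 0 [:: b0; b1; b2] k.
have [|d [[k dk] hd]] := @null_line_dependent a b al be aa bb ab Ba.
  by case=> [[|[|[|k]]] hk]; [exact: B0|exact: B1|exact: B2|case: (notF hk)].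
apply: (@det3_dependent _ _ (d ord0) (d (lift ord0 ord0)) (d (lift ord0 (lift ord0 ord0)))).
  move: dk; case: k => [[|[|[|k]]] hk] //= dk.
  - by rewrite (_ : ord0 = Ordinal hk) ?dk //; exact: val_inj.
  - by rewrite (_ : lift ord0 ord0 = Ordinal hk) ?dk ?orbT //; exact: val_inj.
  - by rewrite (_ : lift ord0 (lift ord0 ord0) = Ordinal hk) ?dk ?orbT //; exact: val_inj.
by rewrite -hd !big_ord_recl big_ord0 addr0 addrA.
Qed.

(** The points lie in the span of the null p0 and a vector e orthogonal to it. For null e this is a
    null line; the form stays indefinite on the vectors orthogonal to p0, so the sign change
    argument in e reaches every small e. *)
Lemma degenerate_line_det3 p0 e (a0 a1 a2 b0 b1 b2 : C) : H p0 p0 = 0 -> H e p0 = 0 ->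
  B p0 -> vn e < rho / 64 ->
  nc b0 <= 3 -> nc b1 <= 3 -> nc b2 <= 3 ->
  vn (a0 *: p0 - p) < rho / 2 -> vn (a1 *: p0 - p) < rho / 2 -> vn (a2 *: p0 - p) < rho / 2 ->
  forall i j k, det3 (f (a0 *: p0 + b0 *: e)) (f (a1 *: p0 + b1 *: e)) (f (a2 *: p0 + b2 *: e)) i j k = 0.
Proof.
move=> pp ep Bp he hb0 hb1 hb2 ha0 ha1 ha2 i j k.
have inB a b y : vn (a *: p0 - p) < rho / 2 -> nc b <= 3 -> vn y < rho / 8 -> B (a *: p0 + b *: y).
  move=> h1 h2 h3; rewrite addrAC; apply: le_lt_trans (vnD _ _) _; rewrite vnZ.
  have := ler_pM (nc_ge0 b) (vn_ge0 y) h2 (ltW h3); have := rho0; lra.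
have cl a b y w t l : B (a *: p0 + b *: (y + t *: w)) -> chol (fun s => f (a *: p0 + b *: (y + s *: w)) 0 l) t.
  have E s : a *: p0 + b *: (y + s *: w) = (a *: p0 + b *: y) + s *: (b *: w).
    by rewrite scalerDr addrA !scalerA mulrC.
  by rewrite E => hB; apply: chol_ext (chol_on_line _ hB) => s; rewrite E.
have [ep1 [ep10 sep1 hep1]] := @exists_orth R n eps (Pos eps) 1 (fun=> p0) pos2.
have [en [en0 sen hen]] := @exists_orth R n eps (Neg eps) 1 (fun=> p0) neg2.
(* The sign change argument runs in the ball of radius rho / 8 and concludes on an eighth of it,
   whence rho / 64 in the statement. *)
have r8 : 0 < rho / 8 / 8 by rewrite !divr_gt0.
have [t1 t10 ht1] := small_scale ep1 r8; have [t2 t20 ht2] := small_scale en r8.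
have nz (t : R) : 0 < t -> 0 < nc (rc t) ^+ 2 by move=> h; rewrite nc_rc exprn_gt0 // normr_gt0 gt_eqF.
have := @sign_change_vanish R n (fun e => H e p0 = 0) 0 (rho / 8) (fun e => H e e)
  (fun e => det3 (f (a0 *: p0 + b0 *: e)) (f (a1 *: p0 + b1 *: e)) (f (a2 *: p0 + b2 *: e)) i j k)
  (rc t1 *: ep1) (rc t2 *: en).
apply; rewrite ?subr0 //.
- by rewrite divr_gt0.
- by move=> y y' t hy hy'; rewrite hfDl hfZl hfDl hfNl hy hy' subr0 mulr0 addr0.
- move=> y y' t _ _; rewrite subr0 => hy.
  by apply: chol_det3 => l; apply: cl; apply: inB.
- by move=> z; exact: vcont_hq.
- move=> z Sz; rewrite subr0 => hz hq0; apply: null_line_det3 => //; try exact: inB.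
    by apply: hf_hq0.
  by rewrite hfC Sz rmorph0.
- by rewrite hfZl (hep1 ord0) mulr0.
- by rewrite hfZl (hen ord0) mulr0.
- by rewrite -/(hq eps _) hqZ mulr_gt0 ?nz //; exact: supported_pos.
- by rewrite -/(hq eps _) hqZ pmulr_rlt0 ?nz //; exact: supported_neg.
- by rewrite -mulrA -invfM -natrM.
Qed.

End LocalMap.

(** * Inequalities between the radii *)

Section Estimates.
Variables (R : realFieldType) (rho : R).
Hypothesis rho0 : 0 < rho.
Implicit Types (a b k m r x y : R).

Lemma est_radius r : r <= rho / 1000 -> r < rho.
Proof. by have := rho0; lra. Qed.
Lemma est_eighth r : r <= rho / 1000 -> r / 8 <= rho.
Proof. by have := rho0; lra. Qed.
Lemma est_quarter a : a < rho / 200 -> a < rho / 4.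
Proof. by have := rho0; lra. Qed.
Lemma est_two_steps a b r : a < r -> r <= rho / 1000 -> b < rho / 400 -> a + b < rho / 200.
Proof. by have := rho0; lra. Qed.
Lemma est_norm a b : a < rho / 200 -> a + b <= b + rho + 1.
Proof. by have := rho0; lra. Qed.
Lemma est_center b : b <= b + rho + 1.
Proof. by have := rho0; lra. Qed.
Lemma est_interpolation a b r : a <= 2 * (rho / 200) -> b <= 1 * r -> r <= rho / 1000 -> a + b < rho.
Proof. by have := rho0; lra. Qed.
Lemma est_slope k m r : 0 < r -> r * (4 * (k + 1)) <= m -> k * r + k * r <= m / 2.
Proof. by lra. Qed.
Lemma est_bound k : k <= 1 / 4 * (4 * (k + 1)).
Proof. by lra. Qed.
Lemma est_halves x : x / 2 * (1 / 4) <= x / 8.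
Proof. by lra. Qed.
Lemma est_last r m x : r * (m / 2) < r * x -> 0 < r * m -> r * m / 8 < r / 2 * x.
Proof. by lra. Qed.

End Estimates.

(** * Lines through a positive point *)

Section GoodPoints.
Variables (R : realType) (n n' : nat) (eps : 'I_n -> R) (eps' : 'I_n' -> R).
Notation C := R[i].
Notation V := 'rV[R[i]]_n.
Notation W := 'rV[R[i]]_n'.
Notation nc := (@Normc.normc R).
Notation H := (hf eps).
Notation H' := (hf eps').
Notation N := (hq eps).
Notation N' := (hq eps').
Variables (f : V -> W) (p : V) (rho : R).
Notation B z := (vn (z - p) < rho).
Hypothesis rho0 : 0 < rho.
Hypothesis holf : forall z i, B z -> vhol (fun z => f z 0 i) z.
Hypothesis radf : forall z i, eps' i = 0 -> f z 0 i = 0.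
Hypothesis orthf : forall z w, B z -> B w -> H z w = 0 -> H' (f z) (f w) = 0.
Hypothesis posf : forall z, B z -> 0 < N z -> 0 < N' (f z).
Hypothesis pos2 : (2 <= #|Pos eps|)%N.
Hypothesis neg2 : (2 <= #|Neg eps|)%N.
Hypothesis posle : (#|Pos eps'| <= #|Pos eps|)%N.
Hypothesis pp : H p p = 0.

Let K := hbound eps.
Let ka := vn p + rho + 1.
Let K0 : 0 <= K. Proof. exact: hbound_ge0. Qed.
Let ka0 : 0 < ka. Proof. by rewrite /ka; have := vn_ge0 p; have := rho0; lra. Qed.

(* x' = x - s z is the null point of the degenerate line through z and x. *)
Lemma degenerate_through z x th (s0 : R) : N z != 0 -> vn (z - p) < rho / 200 ->
  vn (x - p) < rho / 1000 -> nc th <= 1 -> nc (H x z / H z z) <= s0 -> s0 <= 1 / 4 -> s0 * ka <= rho / 1000 ->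
  complex.Re (H z z * H x x - H x z * conjc (H x z)) = 0 ->
  forall i j k, det3 (f z) (f x) (f ((1 - th) *: z + th *: x)) i j k = 0.
Proof.
move=> Nz hz hx hth; set s := H x z / H z z => hs s04 s0k q0.
have vp := vn_ge0 p.
have Hz0 : H z z != 0.
  by rewrite hf_diag rc_eq0.
pose x' := x - s *: z; pose e := z - x'.
have xz : H x' z = 0 by rewrite /x' hfDl hfNl hfZl /s divfK // subrr.
have zx : H z x' = 0 by rewrite hfC xz rmorph0.
have xx : H x' x' = 0.
  (* The left side is the Gram determinant of z and x, whose real part vanishes by hypothesis. *)
  have E : H z z * H x' x' = H z z * H x x - H x z * conjc (H x z).
    have -> : H x' x' = H x' x by rewrite {2}/x' hfDr hfNr hfZr xz mulr0 subr0.
    rewrite /x' hfDl hfNl hfZl /s (hfC eps x z) mulrBr; congr (_ - _).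
    by rewrite mulrA mulrCA mulfV // mulr1.
  have : complex.Re (H z z * H x' x') = 0 by rewrite E.
  rewrite !hf_diag -rcM /= => /eqP; rewrite mulf_eq0 (negbTE Nz) => /eqP ->.
  by [].
have ex : H e x' = 0 by rewrite /e hfDl hfNl zx xx subrr.
have s00 : 0 <= s0 := le_trans (nc_ge0 s) hs.
have vz : vn z <= ka.
  by rewrite -(subrK p z); apply: le_trans (vnD _ _) _; rewrite /ka; have := rho0; lra.
have nsz : vn (s *: z) <= rho / 1000.
  by rewrite vnZ; apply: le_trans (ler_pM (nc_ge0 s) (vn_ge0 z) hs vz) s0k.
have x'p : vn (x' - p) < rho / 500.
  by rewrite /x' addrAC; apply: le_lt_trans (vnB _ _) _; have := rho0; lra.
have vx' : vn x' <= ka.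
  by rewrite -(subrK p x'); apply: le_trans (vnD _ _) _; rewrite /ka; have := rho0; lra.
have ve : vn e < rho / 64.
  by apply: le_lt_trans (vn_dist _ _ p) _; rewrite (vn_sub p); have := rho0; lra.
have zE : z = 1 *: x' + 1 *: e by rewrite !scale1r /e subrKC.
have xE : x = (1 + s) *: x' + s *: e.
  have E (a b : V) : (1 + s) *: a + s *: (b - a) = a + s *: b.
    by apply/rowP => j; rewrite !mxE; ring.
  by rewrite /e E /x' subrK.
have tE : (1 - th) *: z + th *: x = (1 + th * s) *: x' + (1 - th + th * s) *: e.
  have E (a b : V) : (1 - th) *: (1 *: a + 1 *: b) + th *: ((1 + s) *: a + s *: b) =
      (1 + th * s) *: a + (1 - th + th * s) *: b.
    by apply/rowP => j; rewrite !mxE; ring.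
  by rewrite -E -zE -xE.
have aB (c : C) : nc c <= s0 -> vn ((1 + c) *: x' - p) < rho / 2.
  move=> hc; rewrite scalerDl scale1r addrAC; apply: le_lt_trans (vnD _ _) _; rewrite vnZ.
  have := ler_pM (nc_ge0 c) (vn_ge0 x') hc vx'; have := rho0; lra.
have ts : nc (th * s) <= s0.
  rewrite ncM -[s0]mul1r; exact: ler_pM (nc_ge0 _) (nc_ge0 _) hth hs.
have -> : f x = f ((1 + s) *: x' + s *: e) by rewrite -xE.
have -> : f z = f ((1 + 0) *: x' + 1 *: e) by rewrite addr0 -zE.
rewrite tE.
apply: (@degenerate_line_det3 R n n' eps eps' f p rho) => //.
- by apply: lt_trans x'p _; have := rho0; lra.
- by rewrite nc1; lra.
- by apply: le_trans hs _; lra.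
- apply: le_trans (ncD _ _) _; apply: le_trans (lerD (ncB _ _) ts) _.
  by rewrite nc1; lra.
- by apply: aB; rewrite nc0.
- exact: aB.
- exact: aB.
Qed.

(** The line through z and x is degenerate when the Gram determinant Q of z and x vanishes. For
    fixed z it takes both signs as x runs near p, so the sign change argument yields all x near p.
    The points z fill an open set to leave room for the further conditions H p z != 0 and
    nondegeneracy of the differential. *)
Theorem good_points : exists z0 sg rho3, [/\ 0 < sg, 0 < rho3, rho3 <= rho &
  forall z, vn (z - z0) < sg -> [/\ vn (z - p) < rho / 4, 0 < N z, vn ((H p z / H z z) *: z) < rho3 / 2 &
    forall x th, vn (x - p) < rho3 -> nc th <= 1 ->
      forall i j k, det3 (f z) (f x) (f ((1 - th) *: z + th *: x)) i j k = 0]].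
Proof.
have vp := vn_ge0 p.
have [ep [ep0 sep /(_ ord0) hep]] := @exists_orth R n eps (Pos eps) 1 (fun=> p) pos2.
have [en [en0 sen /(_ ord0) hen]] := @exists_orth R n eps (Neg eps) 1 (fun=> p) neg2.
have Nep : 0 < N ep := supported_pos sep ep0.
have Nen : N en < 0 := supported_neg sen en0.
have nz (t : R) : 0 < t -> 0 < nc (rc t) ^+ 2 by move=> h; rewrite nc_rc exprn_gt0 // normr_gt0 gt_eqF.
have r400 : 0 < rho / 400 by have := rho0; lra.
have [de de0 hde] := small_scale ep r400.
have hpe : H p ep = 0 by rewrite hfC hep rmorph0.
(* z0 is positive and orthogonal to p, so projecting p off a point z near z0 moves p very little. *)
pose z0 := p + rc de *: ep.
have z00 : H z0 z0 = rc (de ^+ 2) * H ep ep.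
  by rewrite /z0 !hfDl !hfDr !hfZl !hfZr pp hep hpe conjc_rc expr2 rcM; ring.
pose nu := N z0; have nuE : nu = de ^+ 2 * N ep.
  by rewrite /nu /hq z00 hf_diag -rcM.
have nu0 : 0 < nu by rewrite nuE mulr_gt0 // exprn_gt0.
have pz0 : H p z0 = 0 by rewrite /z0 hfDr hfZr pp hpe mulr0 addr0.
(* s0 bounds the coefficient s in x' = x - s z, which keeps x' near p. *)
pose s0 := Num.min (1 / 4) (rho / 1000 / ka).
have r1000 : 0 < rho / 1000 by have := rho0; lra.
have s00 : 0 < s0 by rewrite lt_min (divr_gt0 r1000 ka0) andbT; lra.
have s04 : s0 <= 1 / 4 by rewrite ge_min lexx.
have s0k : s0 * ka <= rho / 1000 by rewrite -ler_pdivlMr // ge_min lexx orbT.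
pose L := 4 * (K * ka + 1).
have Kk : 0 <= K * ka by rewrite mulr_ge0 // ltW.
have L0 : 0 < L by rewrite mulr_gt0 // ltr_pwDr.
pose rho2 := Num.min (rho / 1000) (s0 * nu / L).
have rho20 : 0 < rho2 by rewrite lt_min r1000 divr_gt0 // mulr_gt0.
have rho21 : rho2 <= rho / 1000 by rewrite ge_min lexx.
have rho22 : rho2 * L <= s0 * nu by rewrite -ler_pdivlMr // ge_min lexx orbT.
clearbody rho2.
(* The sign change argument shrinks the radius by a factor 8. *)
pose rho3 := rho2 / 8; have rho30 : 0 < rho3 by rewrite divr_gt0.
have [e3 [e30 se3 /(_ ord0) he3]] := @exists_orth R n eps (Pos eps) 1 (fun=> z0) pos2.
have Ne3 : 0 < N e3 := supported_pos se3 e30.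
have [t1 t10 ht1] := small_scale e3 rho30; have [t2 t20 ht2] := small_scale en rho30.
(* The sign makes the cross term with p nonnegative, so y1 is positive and orthogonal to z0, giving
   a positive Gram determinant; the negative vector y2 gives a negative one. *)
pose t1' := if 0 <= complex.Re (H p e3) then t1 else - t1.
have nt1' : `|t1'| = t1 by rewrite /t1'; case: ifP => _; rewrite ?normrN gtr0_norm.
pose y1 := p + rc t1' *: e3; pose y2 := p + rc t2 *: en.
have y1p : vn (y1 - p) < rho3.
  by rewrite /y1 addrC addKr vnZ nc_rc nt1'; move: ht1; rewrite vnZ nc_rc gtr0_norm.
have y2p : vn (y2 - p) < rho3 by rewrite /y2 addrC addKr.
pose Q y z := H z z * H y y - H y z * conjc (H y z).
have cQz y z : vcont (Q y) z.
  apply: vcontD; first by apply: vcontM; [exact: vcont_hq|exact: vcont_cst].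
  by apply/vcontN/vcontM; [exact: vcont_hfr|exact/vcont_conj/vcont_hfr].
have cQy z y : vcont (Q^~ z) y.
  apply: vcontD; first by apply: vcontM; [exact: vcont_cst|exact: vcont_hq].
  by apply/vcontN/vcontM; [exact: vcont_hfl|exact/vcont_conj/vcont_hfl].
have Re_rc (a : R) (c : C) : complex.Re (rc a * c) = a * complex.Re c.
  by rewrite Re_mul /= mul0r subr0.
have Q1 : 0 < complex.Re (Q y1 z0).
  have h : H y1 z0 = 0 by rewrite /y1 hfDl hfZl pz0 he3 mulr0 addr0.
  rewrite /Q h mul0r subr0 hf_diag Re_rc -/nu mulr_gt0 //.
  rewrite /y1 !hfDl !hfDr !hfZl !hfZr pp conjc_rc add0r !ReD !Re_rc.
  have -> : complex.Re (H e3 p) = complex.Re (H p e3) by rewrite hfC; case: (H p e3).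
  have : 0 <= t1' * complex.Re (H p e3).
    rewrite /t1'; case: ifP => [h1|/negbT]; first by rewrite mulr_ge0 // ltW.
    by rewrite -ltNge => h1; rewrite mulNr oppr_ge0 mulr_ge0_le0 // ltW.
  have : 0 < t1' * (t1' * complex.Re (H e3 e3)).
    by rewrite mulrA mulr_gt0 // -expr2 -(real_normK (num_real t1')) nt1' exprn_gt0.
  lra.
have Q2 : complex.Re (Q y2 z0) < 0.
  have h : N y2 < 0.
    have hpn : H p en = 0 by rewrite hfC hen rmorph0.
    rewrite /hq /y2 !hfDl !hfDr !hfZl !hfZr pp hen hpn !mulr0 !add0r conjc_rc mulrA -rcM Re_rc.
    by rewrite pmulr_rlt0 // mulr_gt0.
  rewrite /Q mulcJ hf_diag ReD Re_rc ReN -/nu /=.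
  have : nu * complex.Re (H y2 y2) < 0 by rewrite pmulr_rlt0.
  have := sqr_ge0 (nc (H y2 z0)); lra.
have [d1 d10 hd1] := vcont_Re_gt (cQz y1 z0) Q1.
have [d2 d20 hd2] := vcont_Re_lt (cQz y2 z0) Q2.
have [|d3 d30 hd3] := @vcont_Re_gt _ _ (fun z => H z z) z0 (nu / 2) (vcont_hq eps z0).
  by rewrite -/(hq eps z0) -/nu ltr_divn.
pose L4 := 4 * (K * ka * ka + 1).
have L40 : 0 < L4 by rewrite mulr_gt0 // ltr_pwDr // mulr_ge0 // ltW.
pose sg := Num.min (Num.min d1 (Num.min d2 d3)) (Num.min rho2 (rho3 * nu / L4 / 2)).
exists z0, sg, rho3.
have sg0 : 0 < sg by rewrite !lt_min d10 d20 d30 rho20 !divr_gt0 // mulr_gt0.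
split=> //.
  exact: (est_eighth rho0 rho21).
move=> z; rewrite !lt_min => /andP[/and3P[/hd1 q1 /hd2 q2 /hd3 q3] /andP[z1 z2]].
have Nz : nu / 2 < N z by [].
have Nz0 : 0 < N z by apply: lt_trans Nz; rewrite divr_gt0.
have zp : vn (z - p) < rho / 200.
  apply: le_lt_trans (vn_dist _ _ z0) _.
  have h : vn (z0 - p) < rho / 400 by rewrite /z0 addrC addKr.
  exact: est_two_steps z1 rho21 h.
have vz : vn z <= ka.
  by rewrite -(subrK p z); apply: le_trans (vnD _ _) _; exact: est_norm.
have nzz : nc (H z z) = N z by rewrite hf_diag nc_rc gtr0_norm.
have pz : nc (H p z) <= K * ka * vn (z - z0).
  have -> : H p z = H p (z - z0) by rewrite hfDr hfNr pz0 subr0.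
  apply: le_trans (hf_bound _ _ _) _; rewrite ler_wpM2r ?vn_ge0 // ler_wpM2l //.
  exact: (est_center rho0).
have sbound x : vn (x - p) < rho2 -> nc (H x z / H z z) <= s0.
  move=> hx; rewrite ncM ncV nzz ler_pdivrMr //.
  have -> : H x z = H (x - p) z + H p z by rewrite hfDl hfNl subrK.
  apply: le_trans (ncD _ _) _.
  have b1 : nc (H (x - p) z) <= K * ka * rho2.
    apply: le_trans (hf_bound _ _ _) _; rewrite -!mulrA ler_wpM2l // mulrC.
    by apply: ler_pM; rewrite ?vn_ge0 // ltW.
  have b2 : nc (H p z) <= K * ka * rho2.
    by apply: le_trans pz _; rewrite ler_wpM2l // ltW.
  have b3 : s0 * nu / 2 <= s0 * N z.
    by rewrite -mulrA ler_pM2l // ltW.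
  apply: le_trans (lerD b1 b2) (le_trans _ b3).
  exact: est_slope rho20 rho22.
split=> //.
- exact: (est_quarter rho0 zp).
- rewrite vnZ ncM ncV nzz mulrAC ltr_pdivrMr //.
  have b1 : nc (H p z) * vn z <= K * ka * ka * (rho3 * nu / L4 / 2).
    rewrite mulrAC; apply: ler_pM; rewrite ?nc_ge0 ?vn_ge0 //.
    by apply: le_trans pz _; rewrite ler_wpM2l // ltW.
  apply: le_lt_trans b1 _.
  have b2 : K * ka * ka * (rho3 * nu / L4 / 2) <= rho3 * nu / 8.
    have -> : K * ka * ka * (rho3 * nu / L4 / 2) = rho3 * nu / 2 * (K * ka * ka / L4).
      by field; rewrite gt_eqF.
    have h : K * ka * ka / L4 <= 1 / 4.
      by rewrite ler_pdivrMr //; exact: est_bound.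
    have h2 : 0 <= rho3 * nu / 2 by rewrite divr_ge0 // mulr_ge0 // ltW.
    by apply: le_trans (ler_wpM2l h2 h) _; exact: est_halves.
  apply: le_lt_trans b2 _.
  by apply: est_last; [rewrite ltr_pM2l|rewrite mulr_gt0].
- move=> x th hx hth i j k.
  have := @sign_change_vanish R n (fun=> True) p rho2 (Q^~ z)
    (fun x => det3 (f z) (f x) (f ((1 - th) *: z + th *: x)) i j k) y1 y2 rho20.
  apply=> //.
  + move=> y y' t _ _ hB.
    have yB : B (y + t *: (y' - y)) by apply: lt_trans hB _; exact: est_radius.
    have E s : (1 - th) *: z + th *: (y + s *: (y' - y)) =
       ((1 - th) *: z + th *: y) + s *: (th *: (y' - y)).
      by rewrite scalerDr addrA !scalerA mulrC.
    apply: chol_det3 => l; first exact: chol_cst.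
      exact: (chol_on_line holf l yB).
    have hB2 : B ((1 - th) *: z + th *: (y + t *: (y' - y))).
      have -> : (1 - th) *: z + th *: (y + t *: (y' - y)) - p =
        (1 - th) *: (z - p) + th *: (y + t *: (y' - y) - p).
        rewrite !scalerBr addrACA -opprD -scalerDl subrK scale1r //.
      apply: le_lt_trans (vnD _ _) _; rewrite !vnZ.
      have n1 : nc (1 - th) <= 2 by apply: le_trans (ncB _ _) _; rewrite nc1; exact: lerD.
      have h1 := ler_pM (nc_ge0 _) (vn_ge0 _) n1 (ltW zp).
      have h2 := ler_pM (nc_ge0 _) (vn_ge0 _) hth (ltW hB).
      exact: est_interpolation h1 h2 rho21.
    rewrite E in hB2; by apply: chol_ext (chol_on_line holf l hB2) => s; rewrite E.
  + move=> x' _ hx' q0.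
    apply: (@degenerate_through z x' th s0) => //; rewrite ?gt_eqF //.
      exact: lt_le_trans hx' rho21.
    exact: sbound.
Qed.

End GoodPoints.

(** * Differentials and the linear similarity *)

Section ZeroDerivative.
Variable R : realType.
Notation C := R[i].
Notation nc := (@Normc.normc R).

Lemma zero_slope_is_derive (phi : R -> R) (s : R) : (forall e : R, 0 < e -> exists2 d, 0 < d &
   forall h, `|h| < d -> `|phi (s + h) - phi s| <= e * `|h|) -> is_derive s 1 phi 0.
Proof.
move=> hphi.
have hc : h^-1 *: ((phi \o shift s) (h *: 1) - phi s) @[h --> 0^'] --> (0 : R).
  apply/cvgrPdist_le => e /hphi[d d0 hd]; exists d => // h /= hh h0.
  move: hh; rewrite sub0r normrN => /hd; rewrite sub0r normrN /GRing.scale /= mulr1 (addrC h) => hb.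
  by rewrite normrM normfV mulrC ler_pdivrMr ?normr_gt0.
apply: DeriveDef; first by apply/cvg_ex; exists 0.
exact: cvg_lim hc.
Qed.

Lemma zero_slope_const (g : C -> C) : (forall s : R, 0 <= s <= 1 -> forall e : R, 0 < e ->
    exists2 d, 0 < d & forall t : C, nc t < d -> nc (g (rc s + t) - g (rc s)) <= e * nc t) ->
  g (rc 1) = g (rc 0).
Proof.
move=> hg.
have key (part : C -> R) : (forall z w, part (z - w) = part z - part w) ->
    (forall z, `|part z| <= nc z) -> part (g (rc 1)) = part (g (rc 0)).
  move=> pB pn; pose phi s := part (g (rc s)).
  have dphi (s : R) : 0 <= s <= 1 -> is_derive s 1 phi 0.
    move=> hs; apply: zero_slope_is_derive => e e0; have [d d0 hd] := hg s hs e e0.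
    exists d => // h hh; rewrite /phi -pB; apply: le_trans (pn _) _.
    by rewrite rcD; have := hd (rc h); rewrite nc_rc; apply.
  have [||c _] := @MVT R phi (fun=> 0) 0 1 ltr01.
  - by move=> s; rewrite in_itv /= => /andP[/ltW h1 /ltW h2]; apply: dphi; rewrite h1.
  - apply: derivable_within_continuous => s; rewrite in_itv /= => hs.
    by have [] := dphi s hs.
  by rewrite mul0r => /eqP; rewrite subr_eq0 => /eqP.
have h1 := key (@complex.Re R) (fun z w => etrans (ReD _ _) (congr1 _ (ReN _))) (@nc_Re R).
have h2 := key (@complex.Im R) (fun z w => etrans (ImD _ _) (congr1 _ (ImN _))) (@nc_Im R).
by apply/eqP; rewrite eq_complex h1 h2 !eqxx.
Qed.

End ZeroDerivative.

Section LinearMaps.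
Variables (R : realType) (n n' : nat).
Notation C := R[i].
Notation V := 'rV[R[i]]_n.
Notation W := 'rV[R[i]]_n'.
Notation nc := (@Normc.normc R).
Implicit Types (T : V -> W).

Definition linear_map T := (forall x y, T (x + y) = T x + T y) /\ (forall c x, T (c *: x) = c *: T x).

Lemma linear_mapB T x y : linear_map T -> T (x - y) = T x - T y.
Proof. by move=> [TD TZ]; rewrite TD -scaleN1r TZ scaleN1r. Qed.

Lemma linear_map_matrix T : linear_map T -> forall x,
  T x = x *m (\matrix_(j, i) T (delta_mx 0 j) 0 i).
Proof.
move=> [TD TZ] x.
have T0 : T 0 = 0 by rewrite -(scale0r 0) TZ scale0r.
have -> : T x = \sum_j x 0 j *: T (delta_mx 0 j).
  rewrite {1}(row_sum_delta x) (big_morph T TD T0).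
  by apply: eq_bigr => j _; rewrite TZ.
by apply/rowP => i; rewrite summxE !mxE; apply: eq_bigr => j _; rewrite !mxE.
Qed.

Lemma linear_map_vcont T i z : linear_map T -> vcont (fun x => T x 0 i) z.
Proof.
move=> hT e e0; have h : vcont (fun x : V => \sum_j x 0 j * T (delta_mx 0 j) 0 i) z.
  by apply: vcont_sum => j; apply: vcontM; [exact: vcont_coord|exact: vcont_cst].
have E x : T x 0 i = \sum_j x 0 j * T (delta_mx 0 j) 0 i.
  by rewrite (linear_map_matrix hT) mxE; apply: eq_bigr => j _; rewrite !mxE.
by have [d d0 hd] := h e e0; exists d => // w /hd; rewrite !E.
Qed.

Lemma vcont_nonzero (F : V -> C) z : vcont F z -> F z != 0 ->
  exists2 d, 0 < d & forall w, vn (w - z) < d -> nc (F z) / 2 < nc (F w).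
Proof.
move=> cF Fz; have [|d d0 hd] := cF (nc (F z) / 2); first by rewrite divr_gt0 ?nc_gt0.
exists d => // w /hd; have := nc_lerB (F z) (F w); rewrite nc_sub; lra.
Qed.

Lemma sum_delta_coord (k0 : 'I_n') (a : C) (y : W) :
  \sum_k (k == k0)%:R * a * y 0 k = a * y 0 k0.
Proof.
rewrite (bigD1 k0) //= eqxx mul1r big1 ?addr0 // => k /negbTE ->.
by rewrite !mul0r.
Qed.

Lemma det2_parallel (a b : W) : a != 0 -> (forall i j, det2 a b i j = 0) -> exists c, b = c *: a.
Proof.
case/rV0Pn => i ai hd; exists (b 0 i / a 0 i); apply/rowP => j; rewrite mxE.
apply: (mulfI ai); have /eqP := hd i j; rewrite subr_eq0 => /eqP ->.
by field.
Qed.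

Lemma det2_scale (a : W) (b c : C) i j : det2 (b *: a) (c *: a) i j = 0.
Proof. by rewrite /det2 !mxE; ring. Qed.

Definition is_differential (f : V -> W) z T := linear_map T /\
  forall v i e, 0 < e -> exists2 d, 0 < d &
    forall t : C, nc t < d -> nc (f (z + t *: v) 0 i - f z 0 i - t * T v 0 i) <= e * nc t.

Lemma vhol_differential (f : V -> W) z : (forall i, vhol (fun z => f z 0 i) z) ->
  exists T, is_differential f z T.
Proof.
move=> /(@fin_all_exists _ _ _)[l hl].
exists (fun v => \row_i \sum_j l i j * v 0 j); split.
  split=> [x y|c x]; apply/rowP => i; rewrite !mxE.
    by rewrite -big_split /=; apply: eq_bigr => j _; rewrite mxE mulrDr.
  by rewrite mulr_sumr; apply: eq_bigr => j _; rewrite mxE; ring.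
move=> v i e e0; have v1 : 0 < vn v + 1 by rewrite ltr_pwDr // vn_ge0.
have [|d d0 hd] := hl i (e / (vn v + 1)); first by rewrite divr_gt0.
exists (d / (vn v + 1)); first by rewrite divr_gt0.
move=> t ht; have E : z + t *: v - z = t *: v by rewrite addrC addKr.
have tv : vn (t *: v) <= nc t * (vn v + 1) by rewrite vnZ ler_wpM2l ?nc_ge0 // lerDl.
have := hd (z + t *: v); rewrite E; case/(_ _)/Wrap.
  by apply: le_lt_trans tv _; rewrite -ltr_pdivlMr.
rewrite !mxE mulr_sumr => h.
have -> : \sum_j t * (l i j * v 0 j) = \sum_j l i j * (t *: v) 0 j.
  by apply: eq_bigr => j _; rewrite mxE; ring.
apply: le_trans h _; apply: le_trans (ler_wpM2l _ tv) _; first by rewrite divr_ge0 // ltW.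
by rewrite mulrCA divfK ?gt_eqF // mulrC.
Qed.

Lemma differential_form (f : V -> W) z T v (lam : 'I_n' -> C) : is_differential f z T ->
  forall e, 0 < e -> exists2 d, 0 < d & forall t : C, nc t < d ->
    nc (\sum_i lam i * f (z + t *: v) 0 i - \sum_i lam i * f z 0 i - t * \sum_i lam i * T v 0 i) <= e * nc t.
Proof.
move=> [_ hT] e e0.
pose K := \sum_i nc (lam i); have K0 : 0 <= K by apply: sumr_ge0 => i _; exact: nc_ge0.
have K1 : 0 < K + 1 by rewrite ltr_pwDr.
have e1 : 0 < e / (K + 1) by rewrite divr_gt0.
have /(@fin_all_exists2 _ _ _ _)[d d0 hd] := fun i => hT v i _ e1.
exists (\big[Num.min/1]_i d i); first by apply: lt_bigmin.
move=> t ht.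
have -> : \sum_i lam i * f (z + t *: v) 0 i - \sum_i lam i * f z 0 i - t * \sum_i lam i * T v 0 i =
    \sum_i lam i * (f (z + t *: v) 0 i - f z 0 i - t * T v 0 i).
  by rewrite mulr_sumr -!sumrB; apply: eq_bigr => i _; ring.
apply: (@le_trans _ _ (K * (e / (K + 1) * nc t))).
  rewrite /K mulr_suml; elim/big_ind2: _ => [|a1 b1 a2 b2 h h'|i _].
  - by rewrite nc0.
  - by apply: le_trans (ncD _ _) _; exact: lerD.
  - rewrite ncM ler_wpM2l ?nc_ge0 // hd //; apply: lt_le_trans ht _; exact: bigmin_le.
rewrite mulrA ler_wpM2r ?nc_ge0 //.
have -> : K * (e / (K + 1)) = e * (K / (K + 1)) by ring.
by apply: ler_piMr; [exact: ltW|rewrite ler_pdivrMr // mul1r lerDl].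
Qed.

(** A linear form that kills f along a ray from z kills the derivative in that direction. Minors
    with two slots fixed and pairings with a fixed vector are such forms, so linear relations on f
    can be differentiated. *)
Lemma differential_annihil (f : V -> W) z T v (lam : 'I_n' -> C) d0 : is_differential f z T ->
  0 < d0 -> \sum_i lam i * f z 0 i = 0 ->
  (forall t : R, 0 < t < d0 -> \sum_i lam i * f (z + rc t *: v) 0 i = 0) ->
  \sum_i lam i * T v 0 i = 0.
Proof.
move=> hT d00 h0 h; apply/eqP; rewrite -nc_eq0 eq_le nc_ge0 andbT.
apply/ler_addgt0Pl => e e0; rewrite addr0.
have [d d1 hd] := differential_form v lam hT e0.
pose t := Num.min d0 d / 2.
have m0 : 0 < Num.min d0 d by rewrite lt_min d00.
have t0 : 0 < t by rewrite divr_gt0.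
have tm : t < Num.min d0 d by rewrite ltr_divn.
move: tm; rewrite lt_min => /andP[t1 t2].
have := hd (rc t); rewrite nc_rc gtr0_norm // => /(_ t2).
rewrite h ?t0 // h0 subr0 sub0r ncN ncM nc_rc gtr0_norm // mulrC.
by rewrite ler_pM2r.
Qed.

End LinearMaps.

(** * A point where some derivative is not parallel to the value *)

Section NondegenerateDifferential.
Variables (R : realType) (n n' : nat) (eps : 'I_n -> R) (eps' : 'I_n' -> R).
Notation C := R[i].
Notation V := 'rV[R[i]]_n.
Notation W := 'rV[R[i]]_n'.
Notation nc := (@Normc.normc R).
Notation H := (hf eps).
Notation N := (hq eps).
Notation N' := (hq eps').
Variables (f : V -> W) (p : V) (rho : R).
Notation B z := (vn (z - p) < rho).
Hypothesis rho0 : 0 < rho.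
Hypothesis holf : forall z i, B z -> vhol (fun z => f z 0 i) z.
Hypothesis posf : forall z, B z -> 0 < N z -> 0 < N' (f z).
Hypothesis negf : forall z, B z -> N z < 0 -> N' (f z) < 0.
Hypothesis pp : H p p = 0.
Hypothesis neg2 : (2 <= #|Neg eps|)%N.

Lemma quarter_lt z : vn (z - p) < rho / 4 -> B z.
Proof. by move=> h; have := rho0; lra. Qed.

Lemma nonzero_of_hq (w : W) : N' w != 0 -> w != 0.
Proof. by apply: contraNneq => ->; rewrite /hq hf0l. Qed.

Lemma parallel_hq_sign (w w' : W) : 0 < N' w -> N' w' < 0 -> ~ (forall i j, det2 w w' i j = 0).
Proof.
move=> w0 w'0 /det2_parallel[|c wE]; first by apply: nonzero_of_hq; rewrite gt_eqF.
by move: w'0; rewrite wE hqZ ltNge mulr_ge0 ?sqr_ge0 // ltW.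
Qed.

Lemma chol_det2_const (w : W) (x v : V) t i j : B (x + t *: v) ->
  chol (fun s => det2 w (f (x + s *: v)) i j) t.
Proof.
by move=> hB; apply: cholB; apply: cholM; try exact: chol_cst; exact: (chol_on_line holf).
Qed.

(** Otherwise all derivatives near z1 are parallel to f, quotients of coordinates are locally
    constant, and by the identity theorem f is parallel to one vector on the ball of radius rho / 4.
    But positive and negative values are never parallel. *)
Lemma nondegenerate_differential (z0 : V) (sg : R) q : 0 < sg -> H p q != 0 ->
  (forall z, vn (z - z0) < sg -> vn (z - p) < rho / 4 /\ 0 < N z) ->
  exists z T v i j, [/\ vn (z - z0) < sg, H p z != 0, is_differential f z T & det2 (f z) (T v) i j != 0].
Proof.
move=> sg0 pq hz0.
have [z1 hz1 pz1] : exists2 z1, vn (z1 - z0) < sg & H p z1 != 0.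
  have [h|h] := eqVneq (H p z0) 0; last by exists z0; rewrite // subrr vn0.
  have [t t0 ht] := small_scale q sg0; exists (z0 + rc t *: q); first by rewrite addrC addKr.
  by rewrite hfDr h add0r hfZr conjc_rc mulf_neq0 // rc_eq0 gt_eqF.
have [z1p Nz1] := hz0 _ hz1.
have fz1 : 0 < N' (f z1) by apply: posf => //; exact: quarter_lt.
have /rV0Pn[i0 fi0] : f z1 != 0 by apply: nonzero_of_hq; rewrite gt_eqF.
have B1 : B z1 by exact: quarter_lt.
have [d1 d10 hd1] := vcont_nonzero (vhol_vcont (holf i0 B1)) fi0.
have [d2 d20 hd2] := vcont_nonzero (vcont_hfr eps p z1) pz1.
pose si := Num.min (sg - vn (z1 - z0)) (Num.min d1 d2).
have si0 : 0 < si by rewrite !lt_min d10 d20 subr_gt0 hz1.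
have hsi w : vn (w - z1) < si -> [/\ vn (w - z0) < sg, nc (f z1 0 i0) / 2 < nc (f w 0 i0) & H p w != 0].
  rewrite !lt_min => /and3P[h1 /hd1 h2 /hd2 h3]; split=> //.
    by apply: le_lt_trans (vn_dist _ _ z1) _; rewrite -ltrBrDr.
  by rewrite -nc_gt0; apply: le_lt_trans h3; rewrite divr_ge0 ?nc_ge0.
apply: contrapT => hn.
have hall w T v i j : vn (w - z1) < si -> is_differential f w T -> det2 (f w) (T v) i j = 0.
  move=> /hsi[h1 h2 h3] hT; apply/eqP; apply: contrapT => /negP hne.
  by apply: hn; exists w, T, v, i, j.
pose m := nc (f z1 0 i0) / 2; have m0 : 0 < m by rewrite divr_gt0 // nc_gt0.
(* Along the segment from z1 to x this quotient has slope zero, since the form [lam] kills both f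
   and its derivative at each point. *)
have par x j : vn (x - z1) < si -> f x 0 j / f x 0 i0 = f z1 0 j / f z1 0 i0.
  move=> hx; pose v := x - z1; pose w (s : C) := z1 + s *: v.
  have w1 : w (rc 1) = x by rewrite /w scale1r subrKC.
  have w0 : w (rc 0) = z1 by rewrite /w scale0r addr0.
  have := @zero_slope_const R (fun s => f (w s) 0 j / f (w s) 0 i0).
  rewrite w1 w0; apply=> s /andP[s0 s1] e e0.
  have ws : vn (w (rc s) - z1) < si.
    rewrite /w addrC addKr vnZ nc_rc ger0_norm //; apply: le_lt_trans hx.
    by rewrite -[leRHS]mul1r ler_wpM2r // vn_ge0.
  have [hw1 hw2 hw3] := hsi _ ws; have [hw4 _] := hz0 _ hw1; have Bw := quarter_lt hw4.
  have [T hT] := vhol_differential (fun i => holf i Bw).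
  pose lam (k : 'I_n') : C := (k == j)%:R * f (w (rc s)) 0 i0 - (k == i0)%:R * f (w (rc s)) 0 j.
  have lamE (y : W) : \sum_k lam k * y 0 k = f (w (rc s)) 0 i0 * y 0 j - f (w (rc s)) 0 j * y 0 i0.
    by under eq_bigr do rewrite mulrBl; rewrite sumrB !sum_delta_coord.
  have em : 0 < e * (m * m) by apply: mulr_gt0 => //; exact: mulr_gt0.
  have [d d0 hd] := differential_form v lam hT em.
  have v1 : 0 < vn v + 1 by rewrite ltr_pwDr // vn_ge0.
  exists (Num.min d ((si - vn (w (rc s) - z1)) / (vn v + 1))).
    by rewrite lt_min d0 divr_gt0 // subr_gt0.
  move=> t; rewrite lt_min => /andP[/hd ht1 ht2].
  have wt : w (rc s + t) = w (rc s) + t *: v by rewrite /w scalerDl addrA.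
  have : vn (w (rc s + t) - z1) < si.
    rewrite wt addrAC; apply: le_lt_trans (vnD _ _) _; rewrite vnZ -ltrBrDl.
    apply: (@le_lt_trans _ _ (nc t * (vn v + 1))); first by rewrite ler_wpM2l ?nc_ge0 // lerDl.
    by rewrite -ltr_pdivlMr.
  move=> /hsi[_ hw5 _].
  have n1 : f (w (rc s)) 0 i0 != 0 by rewrite -nc_gt0; apply: lt_trans hw2.
  have n2 : f (w (rc s + t)) 0 i0 != 0 by rewrite -nc_gt0; apply: lt_trans hw5.
  move: ht1; rewrite !lamE; have := hall _ T v i0 j ws hT; rewrite /det2 => ->.
  have -> : f (w (rc s)) 0 i0 * f (w (rc s)) 0 j - f (w (rc s)) 0 j * f (w (rc s)) 0 i0 = 0 by ring.
  rewrite mulr0 !subr0 -wt => ht1.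
  have -> : f (w (rc s + t)) 0 j / f (w (rc s + t)) 0 i0 - f (w (rc s)) 0 j / f (w (rc s)) 0 i0 =
    (f (w (rc s)) 0 i0 * f (w (rc s + t)) 0 j - f (w (rc s)) 0 j * f (w (rc s + t)) 0 i0) /
    (f (w (rc s + t)) 0 i0 * f (w (rc s)) 0 i0) by field; rewrite n1 n2.
  rewrite ncM ncV ler_pdivrMr; last by rewrite nc_gt0 mulf_neq0.
  apply: le_trans ht1 _; rewrite mulrAC ler_wpM2l ?mulr_ge0 ?nc_ge0 ?(ltW e0) //.
  by rewrite ncM; apply: ler_pM; apply: ltW.
have vanish i j : forall x, vn (x - p) < rho / 4 -> det2 (f z1) (f x) i j = 0.
  apply: (@identity_ball R n p z1 rho si) => //.
    by move=> y v t hB; exact: chol_det2_const.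
  move=> x hx; have [_ hx2 _] := hsi _ hx.
  have n2 : f x 0 i0 != 0 by rewrite -nc_gt0; apply: lt_trans hx2.
  have E k : f x 0 k = f z1 0 k * (f x 0 i0 / f z1 0 i0).
    by rewrite mulrCA -(par x k hx) mulrC divfK.
  by rewrite /det2 (E i) (E j); ring.
have r4 : 0 < rho / 4 by rewrite divr_gt0.
have [y yp yN] := exists_negative neg2 pp r4.
apply: (@parallel_hq_sign (f z1) (f y)) => //.
  by apply: negf => //; exact: quarter_lt.
by move=> i j; apply: vanish.
Qed.

End NondegenerateDifferential.

(** * The projected differential and the similarity it determines *)

Section LinearPart.
Variables (R : realType) (n n' : nat) (eps : 'I_n -> R) (eps' : 'I_n' -> R).
Notation C := R[i].
Notation V := 'rV[R[i]]_n.
Notation W := 'rV[R[i]]_n'.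
Notation nc := (@Normc.normc R).
Notation H := (hf eps).
Notation H' := (hf eps').
Notation N := (hq eps).
Notation N' := (hq eps').
Variables (f : V -> W) (p : V) (rho : R).
Notation B z := (vn (z - p) < rho).
Hypothesis rho0 : 0 < rho.
Hypothesis holf : forall z i, B z -> vhol (fun z => f z 0 i) z.
Hypothesis orthf : forall z w, B z -> B w -> H z w = 0 -> H' (f z) (f w) = 0.
Hypothesis posf : forall z, B z -> 0 < N z -> 0 < N' (f z).
Hypothesis negf : forall z, B z -> N z < 0 -> N' (f z) < 0.
Hypothesis homf : forall z c, B z -> B (c *: z) -> forall i j, det2 (f z) (f (c *: z)) i j = 0.
Hypothesis pp : H p p = 0.
Hypothesis fp : f p != 0.
Hypothesis pos2 : (2 <= #|Pos eps|)%N.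
Hypothesis neg2 : (2 <= #|Neg eps|)%N.

Variables (z v0 : V) (rho3 : R) (T : V -> W) (i0 j0 : 'I_n').
Notation D x := (vn (x - p) < rho3).
Hypothesis rho30 : 0 < rho3.
Hypothesis rho3le : rho3 <= rho.
Hypothesis zp : vn (z - p) < rho / 4.
Hypothesis Nz : 0 < N z.
Hypothesis pz_small : vn ((H p z / H z z) *: z) < rho3 / 2.
Hypothesis zcol : forall x th, D x -> nc th <= 1 ->
  forall i j k, det3 (f z) (f x) (f ((1 - th) *: z + th *: x)) i j k = 0.
Hypothesis pz : H p z != 0.
Hypothesis dT : is_differential f z T.
Hypothesis Tv0 : det2 (f z) (T v0) i0 j0 != 0.

Let Bz : B z. Proof. by have := rho0; have := zp; lra. Qed.
Let DB x : D x -> B x. Proof. by move=> h; apply: lt_le_trans h rho3le. Qed.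
Let f1 := f z.
Let N1 : 0 < N' f1. Proof. exact: posf. Qed.
Let H1 : H' f1 f1 = rc (N' f1). Proof. exact: hf_diag. Qed.
Let H10 : H' f1 f1 != 0.
Proof. by rewrite H1 rc_eq0 gt_eqF. Qed.
Let Hz : H z z = rc (N z). Proof. exact: hf_diag. Qed.
Let Hz0 : H z z != 0.
Proof. by rewrite Hz rc_eq0 gt_eqF. Qed.
Let f10 : f1 != 0.
Proof. by apply: (@nonzero_of_hq _ _ eps'); rewrite gt_eqF. Qed.
Let TD := dT.1.1.
Let TZ := dT.1.2.

Let P (w : W) := w - (H' w f1 / H' f1 f1) *: f1.
Let T0 x := P (T x).

Let T0D x y : T0 (x + y) = T0 x + T0 y.
Proof. by rewrite /T0 /P TD hfDl; apply/rowP => i; rewrite !mxE; ring. Qed.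
Let T0Z c x : T0 (c *: x) = c *: T0 x.
Proof. by rewrite /T0 /P TZ hfZl; apply/rowP => i; rewrite !mxE; ring. Qed.
Let T0lin : linear_map T0. Proof. by []. Qed.
Let T0B x y : T0 (x - y) = T0 x - T0 y. Proof. exact: linear_mapB. Qed.
Let PT0 x : T x = T0 x + (H' (T x) f1 / H' f1 f1) *: f1.
Proof. by rewrite /T0 /P subrK. Qed.
Let T0f1 x : H' (T0 x) f1 = 0.
Proof. by rewrite /T0 /P hfDl hfNl hfZl divfK // subrr. Qed.
Let f1T0 x : H' f1 (T0 x) = 0.
Proof. by rewrite hfC T0f1 rmorph0. Qed.

Let small v : exists2 d, 0 < d & forall t : R, 0 < t < d -> B (z + rc t *: v) /\ nc (rc t) <= 1.
Proof.
have v1 : 0 < vn v + 1 by rewrite ltr_pwDr // vn_ge0.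
have r0 : 0 < rho - vn (z - p) by rewrite subr_gt0.
exists (Num.min 1 ((rho - vn (z - p)) / (vn v + 1))); first by rewrite lt_min ltr01 divr_gt0.
move=> t; rewrite lt_min => /and3P[t0 t1 t2]; rewrite nc_rc gtr0_norm // (ltW t1); split=> //.
rewrite addrAC; apply: le_lt_trans (vnD _ _) _; rewrite vnZ nc_rc gtr0_norm // -ltrBrDl.
apply: (@le_lt_trans _ _ (t * (vn v + 1))); first by rewrite ler_wpM2l ?(ltW t0) // lerDl.
by rewrite -ltr_pdivlMr.
Qed.

(** By homogeneity f((1 + t) z) is parallel to f(z), so the derivative in the direction z is too. *)
Let T0z : T0 z = 0.
Proof.
have hd i j : det2 f1 (T z) i j = 0.
  have [d d0 hd] := small z.
  pose lam (k : 'I_n') : C := (k == j)%:R * f1 0 i - (k == i)%:R * f1 0 j.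
  have lamE (y : W) : \sum_k lam k * y 0 k = det2 f1 y i j.
    by rewrite /lam; under eq_bigr do rewrite mulrBl; rewrite sumrB !sum_delta_coord.
  rewrite -lamE; apply: (differential_annihil dT d0); rewrite ?lamE.
    by rewrite /det2 mulrC subrr.
  move=> t /hd[h _]; rewrite lamE; have E : z + rc t *: z = (1 + rc t) *: z by rewrite scalerDl scale1r.
  by rewrite E in h *; exact: homf.
have [c cE] := det2_parallel f10 hd.
by rewrite /T0 /P cE hfZl mulfK // subrr.
Qed.

Let T0v0 : T0 v0 != 0.
Proof.
apply: contraNneq Tv0 => h; rewrite (PT0 v0) h add0r.
by rewrite -[f z]scale1r det2_scale.
Qed.

(** The points z, x and z + t (x - z) have dependent images; differentiating at t = 0 replaces the
    third image by T (x - z). *)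
Let col x i j k : D x -> det3 f1 (f x) (T (x - z)) i j k = 0.
Proof.
move=> hx; have [d d0 hd] := small (x - z).
pose lam (l : 'I_n') : C := (l == k)%:R * det2 f1 (f x) i j - (l == j)%:R * det2 f1 (f x) i k
  + (l == i)%:R * det2 f1 (f x) j k.
have lamE (y : W) : \sum_l lam l * y 0 l = det3 f1 (f x) y i j k.
  rewrite /lam; under eq_bigr do rewrite mulrDl mulrBl.
  by rewrite big_split sumrB /= !sum_delta_coord /det3 /det2; ring.
rewrite -lamE; apply: (differential_annihil dT d0); rewrite ?lamE.
  by rewrite /det3 /det2 /f1; ring.
move=> t /hd[_ h]; rewrite lamE.
have -> : z + rc t *: (x - z) = (1 - rc t) *: z + rc t *: x.
  by apply/rowP => l; rewrite !mxE; ring.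
exact: zcol.
Qed.

Let decomp x : D x -> T0 x != 0 -> exists al be, f x = al *: f1 + be *: T0 x.
Proof.
move=> hx Tx.
have Txz : T0 (x - z) = T0 x by rewrite T0B T0z subr0.
have [i [j hij]] : exists i j, det2 f1 (T (x - z)) i j != 0.
  apply: contrapT => hn; move: Tx; rewrite -Txz.
  have [|c cE] := @det2_parallel _ _ f1 (T (x - z)) f10.
    move=> i j; apply/eqP; apply: contrapT => /negP h; apply: hn; by exists i, j.
  by rewrite /T0 /P cE hfZl mulfK // subrr eqxx.
have [al [be ->]] := det3_span hij (fun k => col i j k hx).
rewrite (PT0 (x - z)) Txz.
exists (al + be * (H' (T (x - z)) f1 / H' f1 f1)), be.
by rewrite scalerDr scalerDl scalerA -addrA (addrC (be *: _)).
Qed.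

(** If z and e are orthogonal to x, then f(z + t e) is orthogonal to f(x); the claim is the
    derivative in t. *)
Let orthT x e : B x -> H x z = 0 -> H e x = 0 -> H' (T0 e) (f x) = 0.
Proof.
move=> Bx xz ex.
have zx : H z x = 0 by rewrite hfC xz rmorph0.
have f1x : H' f1 (f x) = 0 by exact: orthf.
rewrite /T0 /P hfDl hfNl hfZl f1x mulr0 subr0.
have [d d0 hd] := small e.
have hE (y : W) : \sum_i (rc (eps' i) * conjc (f x 0 i)) * y 0 i = H' y (f x).
  by apply: eq_bigr => i _; ring.
rewrite -hE; apply: (differential_annihil dT d0); rewrite ?hE //.
move=> t /hd[h _]; rewrite hE; apply: orthf => //.
by rewrite hfDl hfZl zx ex mulr0 addr0.
Qed.

Let orth_decomp x : D x -> H x z = 0 -> N x != 0 -> T0 x != 0 ->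
  exists2 be, be != 0 & f x = be *: T0 x.
Proof.
move=> Dx xz Nx Tx; have [al [be fE]] := decomp Dx Tx.
have al0 : al = 0.
  have : H' (f x) f1 = 0 by apply: orthf => //; exact: DB.
  rewrite fE hfDl !hfZl T0f1 mulr0 addr0 => /eqP; rewrite mulf_eq0 (negbTE H10) orbF.
  by move/eqP.
exists be; last by rewrite fE al0 scale0r add0r.
apply: contraTneq isT => be0.
have f0 : f x = 0 by rewrite fE al0 be0 !scale0r addr0.
have N0 : N' (f x) = 0 by rewrite f0 /hq hf0l.
have Bx := DB Dx; move: Nx; rewrite neq_lt => /orP[/(negf Bx)|/(posf Bx)];
  by rewrite N0 ltxx.
Qed.

(** Removing from e its projection on x leaves a vector whose T0 image is orthogonal to f(x), hence
    to T0 x; the projection contributes the factor. *)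
Let sesqui x e : D x -> H x z = 0 -> N x != 0 -> T0 x != 0 ->
  H' (T0 e) (T0 x) = rc (N' (T0 x) / N x) * H e x.
Proof.
move=> Dx xz Nx Tx; have [be be0 fE] := orth_decomp Dx xz Nx Tx.
have Hx0 : H x x != 0 by rewrite hf_diag rc_eq0.
pose e' := e - (H e x / H x x) *: x.
have e'x : H e' x = 0 by rewrite /e' hfDl hfNl hfZl divfK // subrr.
have h := orthT (DB Dx) xz e'x.
have {}h : H' (T0 e') (T0 x) = 0.
  by move/eqP: h; rewrite fE hfZr mulf_eq0 conjc_eq0 (negbTE be0) => /eqP.
rewrite /e' T0B T0Z hfDl hfNl hfZl in h; move/eqP: h; rewrite subr_eq0 => /eqP ->.
rewrite (hf_diag eps' (T0 x)) rcM (hf_diag eps x).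
have -> : rc (N x)^-1 = (rc (N x))^-1.
  by apply: (mulIf (x := rc (N x))); rewrite -?rcM ?mulVf // rc_eq0.
by ring.
Qed.

Let ratio_pos x : D x -> H x z = 0 -> N x != 0 -> T0 x != 0 -> 0 < N' (T0 x) / N x.
Proof.
move=> Dx xz Nx Tx; have [be be0 fE] := orth_decomp Dx xz Nx Tx.
have Bx := DB Dx; have b2 : 0 < nc be ^+ 2 by rewrite exprn_gt0 // nc_gt0.
move: Nx; rewrite neq_lt => /orP[h|h].
  have := negf Bx h; rewrite fE hqZ pmulr_rlt0 // => h2.
  by rewrite -mulrNN -invrN divr_gt0 // oppr_gt0.
by have := posf Bx h; rewrite fE hqZ pmulr_rgt0 // => h2; rewrite divr_gt0.
Qed.

(** p is null and not orthogonal to z. It is projected off z, then perturbed if necessary along y,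
    where T0 does not vanish, and along a negative vector, to leave the null cone. *)
Let base : exists x1, [/\ D x1, H x1 z = 0, N x1 != 0 & T0 x1 != 0].
Proof.
pose x' := p - (H p z / H z z) *: z.
have x'p : vn (x' - p) < rho3 / 2 by rewrite /x' addrAC subrr add0r vnN.
have x'z : H x' z = 0 by rewrite /x' hfDl hfNl hfZl divfK // subrr.
pose y := v0 - (H v0 z / H z z) *: z.
have yz : H y z = 0 by rewrite /y hfDl hfNl hfZl divfK // subrr.
have Ty : T0 y = T0 v0 by rewrite /y T0B T0Z T0z scaler0 subr0.
have r4 : 0 < rho3 / 4 by rewrite divr_gt0.
have [t t0 ht] := small_scale y r4.
have [x'' [x''p x''z Tx'']] : exists x'', [/\ vn (x'' - p) < 3 * (rho3 / 4), H x'' z = 0 & T0 x'' != 0].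
  have [h|h] := eqVneq (T0 x') 0; last by exists x'; split=> //; have := rho30; lra.
  exists (x' + rc t *: y); split.
  - by rewrite addrAC; apply: le_lt_trans (vnD _ _) _; lra.
  - by rewrite hfDl hfZl x'z yz mulr0 addr0.
  - by rewrite T0D h add0r T0Z Ty scaler_eq0 negb_or T0v0 andbT rc_eq0 gt_eqF.
have [Nx|Nx] := eqVneq (N x'') 0; last by exists x''; split=> //; have := rho30; lra.
have /rV0Pn[k Tk] := Tx''.
have [d d0 hd] := vcont_nonzero (linear_map_vcont k x'' T0lin) Tk.
have [en [en0 sen /(_ ord0) hen]] := @exists_orth R n eps (Neg eps) 1 (fun=> z) neg2.
have Nen : N en < 0 := supported_neg sen en0.
have m0 : 0 < Num.min d (rho3 / 4) by rewrite lt_min d0.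
have [s s0 hs] := small_scale en m0.
(* The sign makes the cross term nonpositive, so the new point is negative. *)
pose s' := if 0 <= complex.Re (H x'' en) then - s else s.
have ns' : `|s'| = s by rewrite /s'; case: ifP => _; rewrite ?normrN gtr0_norm.
have vs : vn (rc s' *: en) < Num.min d (rho3 / 4).
  by rewrite vnZ nc_rc ns'; move: hs; rewrite vnZ nc_rc gtr0_norm.
move: vs; rewrite lt_min => /andP[vs1 vs2].
exists (x'' + rc s' *: en); split.
- by rewrite addrAC; apply: le_lt_trans (vnD _ _) _; lra.
- by rewrite hfDl hfZl x''z hen mulr0 addr0.
- have Re_rc (a : R) (c : C) : complex.Re (rc a * c) = a * complex.Re c.
    by rewrite Re_mul /= mul0r subr0.
  rewrite lt_eqF // /hq !hfDl !hfDr !hfZl !hfZr conjc_rc !ReD !Re_rc -/(hq eps x'') Nx add0r.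
  have -> : complex.Re (H en x'') = complex.Re (H x'' en) by rewrite hfC; case: (H x'' en).
  have h1 : s' * complex.Re (H x'' en) <= 0.
    rewrite /s'; case: ifP => [h|/negbT]; first by rewrite mulNr oppr_le0 mulr_ge0 // ltW.
    by rewrite -ltNge => h; rewrite mulr_ge0_le0 // ltW.
  have h2 : s' * (s' * complex.Re (H en en)) < 0.
    by rewrite mulrA -expr2 -(real_normK (num_real s')) ns' pmulr_rlt0 // exprn_gt0.
  lra.
- apply/rV0Pn; exists k; rewrite -nc_gt0; apply: le_lt_trans (hd _ _).
    by rewrite divr_ge0 ?nc_ge0.
  by rewrite addrC addKr.
Qed.

(** The factors at x1 and at x1 + t y agree because both compute the product of T0 x1 with T0 (x1 +
    t y). Subtracting the two identities and dividing by t leaves the one for y, however large y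
    is. *)
Let conformal0 : exists2 kap : R, 0 < kap & forall y, H y z = 0 -> forall e, H' (T0 e) (T0 y) = rc kap * H e y.
Proof.
clearbody T0.
have [x1 [Dx1 x1z Nx1 Tx1]] := base.
pose kap := N' (T0 x1) / N x1; exists kap; first exact: ratio_pos.
have s1 e : H' (T0 e) (T0 x1) = rc kap * H e x1 by exact: sesqui.
have /rV0Pn[k Tk] := Tx1.
have Hx1 : H x1 x1 != 0 by rewrite hf_diag rc_eq0.
move=> y yz e.
have [d1 d10 hd1] := vcont_nonzero (linear_map_vcont k x1 T0lin) Tk.
have [d2 d20 hd2] := vcont_nonzero (vcont_hq eps x1) Hx1.
have [d3 d30 hd3] := vcont_nonzero (vcont_hfr eps x1 x1) Hx1.
have m0 : 0 < Num.min (rho3 - vn (x1 - p)) (Num.min d1 (Num.min d2 d3)).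
  by rewrite !lt_min d10 d20 d30 subr_gt0 Dx1.
have [t t0] := small_scale y m0; rewrite !lt_min => /and4P[h0 h1 h2 h3].
pose x := x1 + rc t *: y.
have E : x - x1 = rc t *: y by rewrite /x addrC addKr.
have Dx : D x by rewrite /x addrAC; apply: le_lt_trans (vnD _ _) _; rewrite -ltrBrDl.
have xz : H x z = 0 by rewrite /x hfDl hfZl x1z yz mulr0 addr0.
have nc_half (a b : C) : nc a / 2 < nc b -> b != 0.
  by move=> h; rewrite -nc_gt0; apply: le_lt_trans h; rewrite divr_ge0 ?nc_ge0.
have Tx : T0 x != 0.
  by apply/rV0Pn; exists k; apply: nc_half (hd1 x _); rewrite E.
have Nx : N x != 0.
  have : H x x != 0 by apply: nc_half (hd2 x _); rewrite E.
  by rewrite hf_diag rc_eq0.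
have x1x : H x1 x != 0 by apply: nc_half (hd3 x _); rewrite E.
have s2 e' := @sesqui x e' Dx xz Nx Tx.
have kk : rc (N' (T0 x) / N x) = rc kap.
  apply: (mulIf x1x); rewrite -s2 hfC s1 conjcM conjc_rc -hfC //.
have := s2 e; rewrite kk /x T0D T0Z !hfDr !hfZr conjc_rc s1 mulrDr => /addrI.
rewrite mulrCA; apply: mulfI.
by rewrite rc_eq0 gt_eqF.
Qed.

Let conformal : exists2 kap : R, 0 < kap & forall x y,
  H' (T0 x) (T0 y) = rc kap * (H x y - H x z * H z y / H z z).
Proof.
clearbody T0.
have [kap k0 hk] := conformal0; exists kap => // x y.
pose y0 := y - (H y z / H z z) *: z.
have y0z : H y0 z = 0 by rewrite /y0 hfDl hfNl hfZl divfK // subrr.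
have Ty : T0 y = T0 y0 by rewrite /y0 T0B T0Z T0z scaler0 subr0.
rewrite Ty hk // /y0 hfDr hfNr hfZr conjcM conjc_inv hf_real -hfC; congr (_ * (_ - _)).
by rewrite mulrAC (mulrC (H z y)).
Qed.

(* With c of modulus fixed by conformality, L x = c a(x) f(z) + T0 x, where
   a(x) = H x z / H z z, is a similarity parallel to f near p. *)
Theorem local_similarity : exists (L : V -> W) (kap : R), [/\ 0 < kap, linear_map L,
  forall x y, H' (L x) (L y) = rc kap * H x y &
  forall x, vn (x - p) < rho / 4 -> forall i j, det2 (f x) (L x) i j = 0].
Proof.
clearbody T0.
have [kap k0 hconf] := conformal.
have kap0 : rc kap != 0 by rewrite rc_eq0 gt_eqF.
(* The coefficient of z in the orthogonal splitting of x. *)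
pose a x := H x z / H z z.
have confE x y : H' (T0 x) (T0 y) = rc kap * (H x y - a x * conjc (a y) * H z z).
  rewrite hconf /a conjcM conjc_inv hf_real -hfC; congr (_ * (_ - _)).
  by field.
have nullT u : H u u = 0 -> H u z != 0 -> T0 u != 0.
  move=> uu uz; apply/eqP => Tu; have := confE u u; rewrite Tu hf0l uu sub0r => /esym/eqP.
  rewrite mulf_eq0 (negbTE kap0) oppr_eq0 !mulf_eq0 (negbTE Hz0) conjc_eq0 /a mulf_eq0.
  by rewrite (negbTE uz) invr_eq0 (negbTE Hz0).
have aD x y : a (x + y) = a x + a y by rewrite /a hfDl mulrDl.
have aZ (b : C) x : a (b *: x) = b * a x by rewrite /a hfZl mulrA.
have aN x : H x z != 0 -> a x != 0 by move=> h; rewrite /a mulf_neq0 ?invr_eq0.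
clearbody a.
(* For orthogonal x and u, the vanishing product of f(x) and f(u), expanded along f(z) and the image
   of T0, relates the coefficients at the two points. *)
have pair x u al be al' be' : D x -> D u -> H x u = 0 -> f x = al *: f1 + be *: T0 x ->
    f u = al' *: f1 + be' *: T0 u ->
    al * conjc al' * H' f1 f1 = be * conjc be' * (rc kap * (a x * conjc (a u) * H z z)).
  move=> Dx Du xu fx fu; have := orthf (DB Dx) (DB Du) xu.
  rewrite fx fu !hfDl !hfDr !hfZl !hfZr T0f1 f1T0 confE xu => h.
  by apply/eqP; rewrite -subr_eq0 -h; apply/eqP; ring.
have Dp : D p by rewrite subrr vn0.
have [alp [bep fpE]] := decomp Dp (nullT p pp pz).
have ap : a p != 0 by exact: aN.
have hp := pair p p _ _ _ _ Dp Dp pp fpE fpE.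
have bep0 : bep != 0.
  apply: contraNneq fp => b0; move: hp; rewrite b0 !mul0r => /eqP.
  rewrite !mulf_eq0 (negbTE H10) orbF conjc_eq0 orbb => /eqP al0.
  by rewrite fpE al0 b0 !scale0r addr0.
(* c is the normalized ratio of the coefficients at p; as p is null, [pair] with x = u = p
   determines its modulus. *)
pose c := alp / (bep * a p).
have alpE : alp = bep * c * a p by rewrite /c; field; rewrite bep0 ap.
clearbody c.
have cc : c * conjc c * H' f1 f1 = rc kap * H z z.
  have n0 : bep * conjc bep * (a p * conjc (a p)) != 0.
    by rewrite !mulf_neq0 // ?conjc_eq0.
  apply: (mulfI n0); move: hp; rewrite {1 2}alpE !conjcM => hp.
  transitivity (bep * c * a p * (conjc bep * conjc c * conjc (a p)) * H' f1 f1); first by ring.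
  by rewrite hp; ring.
have c0 : c != 0.
  apply/eqP => cz; move/esym/eqP: cc; rewrite cz !mul0r mulf_eq0 (negbTE kap0) (negbTE Hz0) //.
(* The normalized ratio, phase included, passes from u to every x orthogonal to u. *)
have step x u beu : D x -> D u -> H x u = 0 -> T0 x != 0 -> a u != 0 -> beu != 0 ->
    f u = (beu * c * a u) *: f1 + beu *: T0 u ->
    exists be, f x = (be * c * a x) *: f1 + be *: T0 x.
  move=> Dx Du xu Tx au bu fu; have [al [be fx]] := decomp Dx Tx.
  exists be; rewrite {1}fx; congr (_ *: _ + _).
  have h := pair _ _ _ _ _ _ Dx Du xu fx fu.
  have n0 : conjc beu * conjc (a u) * conjc c * H' f1 f1 != 0.
    by rewrite !mulf_neq0 // conjc_eq0.
  apply: (mulIf n0); rewrite !conjcM in h.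
  transitivity (al * (conjc beu * conjc c * conjc (a u)) * H' f1 f1); first by ring.
  rewrite h mulrA; transitivity (be * a x * conjc beu * conjc (a u) * (rc kap * H z z)); first by ring.
  by rewrite -cc; ring.
have [ep [ep0 sep /(_ ord0) hep]] := @exists_orth R n eps (Pos eps) 1 (fun=> p) pos2.
have [en [en0 sen /(_ ord0) hen]] := @exists_orth R n eps (Neg eps) 1 (fun=> p) neg2.
have Nep : 0 < N ep := supported_pos sep ep0.
have Nen : N en < 0 := supported_neg sen en0.
have pn : H ep en = 0.
  apply: big1 => j _; case: (boolP (j \in Pos eps)) => [jp|/sep ->]; last by ring.
  have -> : en 0 j = 0; last by rewrite rmorph0; ring.
  by apply: sen; rewrite inE -leNgt ltW //; move: jp; rewrite inE.
have np : H en ep = 0 by rewrite hfC pn rmorph0.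
pose s1 := Num.sqrt (- N en); pose s2 := Num.sqrt (N ep).
have s12 : s1 ^+ 2 = - N en by rewrite sqr_sqrtr // oppr_ge0 ltW.
have s22 : s2 ^+ 2 = N ep by rewrite sqr_sqrtr // ltW.
have s10 : 0 < s1 by rewrite sqrtr_gt0 oppr_gt0.
(* The weights make e1 null; it is orthogonal to p but not to ep, so p can be tilted along the null
   line through p and e1. *)
pose e1 := rc s1 *: ep + rc s2 *: en.
have e1p : H e1 p = 0 by rewrite /e1 hfDl !hfZl hep hen !mulr0 addr0.
have pe1 : H p e1 = 0 by rewrite hfC e1p rmorph0.
have e1e1 : H e1 e1 = 0.
  rewrite /e1 !hfDl !hfDr !hfZl !hfZr !conjc_rc pn np !mulr0 addr0 add0r !hf_diag.
  rewrite !mulrA -!rcM -rcD -!expr2 s12 s22.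
  by apply/eqP; rewrite rc_eq0; apply/eqP; ring.
have epe1 : H ep e1 != 0.
  rewrite /e1 hfDr !hfZr pn mulr0 addr0 conjc_rc hf_diag -rcM rc_eq0.
  by rewrite gt_eqF // mulr_gt0.
pose L x := (c * a x) *: f1 + T0 x.
have /rV0Pn[k fk] := fp.
have [d1 d10 hd1] := vcont_nonzero (vhol_vcont (holf k (DB Dp))) fk.
have pz' : H p z != 0 := pz.
have [d2 d20 hd2] := vcont_nonzero (vcont_hfl eps z p) pz'.
have /rV0Pn[l Tl] := nullT p pp pz.
have [d3 d30 hd3] := vcont_nonzero (linear_map_vcont l p T0lin) Tl.
pose d := Num.min rho3 (Num.min d1 (Num.min d2 d3)).
have d0 : 0 < d by rewrite !lt_min rho30 d10 d20 d30.
have nc_half (x y : C) : nc x / 2 < nc y -> y != 0.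
  by move=> h; rewrite -nc_gt0; apply: le_lt_trans h; rewrite divr_ge0 ?nc_ge0.
have near u : vn (u - p) < d -> [/\ D u, f u != 0, H u z != 0 & T0 u != 0].
  rewrite !lt_min => /and4P[h0 /hd1 h1 /hd2 h2 /hd3 h3]; split=> //.
  - by apply/rV0Pn; exists k; exact: nc_half h1.
  - exact: nc_half h2.
  - by apply/rV0Pn; exists l; exact: nc_half h3.
have m0 : 0 < Num.min (d / 2) (rho / 4) by rewrite lt_min !divr_gt0.
have [t t0] := small_scale ep m0; rewrite lt_min => /andP[ht1 ht2].
(* x2 is orthogonal to p and not to e1, so each x near x2 is orthogonal to some p + s e1 with s
   small. *)
pose x2 := p + rc t *: ep.
have x2p : H x2 p = 0 by rewrite /x2 hfDl hfZl pp hep mulr0 addr0.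
have x2e1 : H x2 e1 != 0.
  by rewrite /x2 hfDl hfZl pe1 add0r mulf_neq0 // rc_eq0 gt_eqF.
have [d4 d40 hd4] := vcont_nonzero (vcont_hfl eps e1 x2) x2e1.
pose m := nc (H x2 e1) / 2; have m_gt0 : 0 < m by rewrite divr_gt0 // nc_gt0.
have ve1 : 0 < vn e1 + 1 by rewrite ltr_pwDr // vn_ge0.
have [|d5 d50 hd5] := vcont_hfl eps p x2 (e := d * m / (vn e1 + 1)).
  by rewrite divr_gt0 // mulr_gt0.
pose tau := Num.min (d / 2) (Num.min d4 d5).
have tau0 : 0 < tau by rewrite !lt_min d40 d50 divr_gt0.
have nearx2 x : vn (x - x2) < tau -> exists be, f x = be *: L x.
  rewrite !lt_min => /and3P[h1 /hd4 h2 /hd5 h3].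
  have xd : vn (x - p) < d.
    apply: le_lt_trans (vn_dist _ _ x2) _.
    have : vn (x2 - p) < d / 2 by rewrite /x2 addrC addKr.
    by move: h1; rewrite [X in _ -> _ -> _ < X]splitr => *; exact: ltrD.
  have [Dx _ _ Tx] := near x xd.
  have xe1 : H x e1 != 0 by exact: nc_half h2.
  rewrite x2p subr0 in h3.
  pose s := - conjc (H x p / H x e1).
  (* u is orthogonal to both p and x, so the ratio c travels from p to u and from u to x. *)
  pose u := p + s *: e1.
  have xu : H x u = 0 by rewrite /u hfDr hfZr /s conjcN conjcK mulNr divfK // subrr.
  have uu : H u u = 0 by rewrite /u !hfDl !hfDr !hfZl !hfZr pp pe1 e1p e1e1; ring.
  have up : H u p = 0 by rewrite /u hfDl hfZl pp e1p mulr0 addr0.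
  have ud : vn (u - p) < d.
    rewrite /u addrC addKr vnZ /s ncN ncJ ncM ncV mulrAC ltr_pdivrMr ?nc_gt0 //.
    have b1 : nc (H x p) * vn e1 <= nc (H x p) * (vn e1 + 1) by rewrite ler_wpM2l ?nc_ge0 // lerDl.
    apply: le_lt_trans b1 _; rewrite -ltr_pdivlMr //; apply: lt_trans h3 _.
    by rewrite ltr_pM2r ?invr_gt0 // ltr_pM2l.
  have [Du fu uz Tu] := near u ud.
  have au : a u != 0 by exact: aN.
  have [beu fuE] : exists be, f u = (be * c * a u) *: f1 + be *: T0 u.
    by apply: (step u p bep) => //; rewrite -alpE.
  have beu0 : beu != 0.
    by apply: contraNneq fu => b0; rewrite fuE b0 !mul0r !scale0r addr0.
  have [be fxE] := step x u beu Dx Du xu Tx au beu0 fuE.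
  by exists be; rewrite {1}fxE /L scalerDr scalerA mulrA.
have Llin : linear_map L.
  split=> [x y|b x].
    by rewrite /L aD T0D; apply/rowP => i; rewrite !mxE; ring.
  by rewrite /L aZ T0Z; apply/rowP => i; rewrite !mxE; ring.
exists L, kap; split=> //.
  move=> x y; rewrite /L !hfDl !hfDr !hfZl !hfZr T0f1 f1T0 confE conjcM.
  transitivity (a x * conjc (a y) * (c * conjc c * H' f1 f1) + rc kap * (H x y - a x * conjc (a y) * H z z)).
    by ring.
  by rewrite cc; ring.
move=> x hx i j; move: x hx.
apply: (@identity_ball R n p x2 rho tau) => //.
- move=> y v s hB.
  have cL b : chol (fun s => L (y + s *: v) 0 b) s.
    apply: (@chol_ext _ (fun s => L y 0 b + s * L v 0 b)).
      by move=> s'; rewrite Llin.1 Llin.2 !mxE.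
    apply: cholD; first exact: chol_cst.
    by apply: cholM; [exact: chol_id|exact: chol_cst].
  by apply: cholB; apply: cholM; try exact: cL; exact: (chol_on_line holf).
- by rewrite /x2 addrC addKr.
- by move=> x /nearx2[be ->]; rewrite -[X in det2 _ X]scale1r det2_scale.
Qed.

End LinearPart.

(** * Globalization *)

Section NonradicalPart.
Variables (R : realType) (n : nat) (eps : 'I_n -> R).
Notation V := 'rV[R[i]]_n.
Notation nc := (@Normc.normc R).
Notation H := (hf eps).
Notation N := (hq eps).

Definition nonrad (w : V) : V := \row_i if eps i == 0 then 0 else w 0 i.

Lemma nonradE w i : nonrad w 0 i = if eps i == 0 then 0 else w 0 i.
Proof. by rewrite mxE. Qed.

Lemma nonrad_rad w i : eps i = 0 -> nonrad w 0 i = 0.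
Proof. by move=> e0; rewrite nonradE e0 eqxx. Qed.

Lemma nonradD x y : nonrad (x + y) = nonrad x + nonrad y.
Proof. by apply/rowP => i; rewrite !mxE; case: ifP => _; rewrite ?addr0. Qed.

Lemma nonradZ c x : nonrad (c *: x) = c *: nonrad x.
Proof. by apply/rowP => i; rewrite !mxE; case: ifP => _; rewrite ?mulr0. Qed.

Lemma hf_nonrad x y : H (nonrad x) (nonrad y) = H x y.
Proof.
apply: eq_bigr => i _; rewrite !nonradE; case: eqP => [-> |_] //.
by rewrite (_ : rc 0 = 0) ?mul0r.
Qed.

Lemma hq_nonrad x : N (nonrad x) = N x.
Proof. by rewrite /hq hf_nonrad. Qed.

(** Flipping the coordinates of p outside [Pos] preserves the norm, and the product with p becomes
    the sum of |eps i| |p i|^2. *)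
Lemma null_partner (p : V) j : H p p = 0 -> eps j != 0 -> p 0 j != 0 ->
  exists q, H q q = 0 /\ H q p != 0.
Proof.
move=> pp ej pj.
pose sg i : R := if 0 < eps i then 1 else -1.
pose q : V := \row_i (rc (sg i) * p 0 i).
have sg2 i : sg i * sg i = 1 by rewrite /sg; case: ifP => _; ring.
have sge i : 0 <= eps i * sg i.
  by rewrite /sg; case: ltP => h; rewrite ?mulr1 ?mulrN1 ?oppr_ge0 // ltW.
exists q; split.
  rewrite -[RHS]pp; apply: eq_bigr => i _; rewrite !mxE conjcM conjc_rc.
  have -> : rc (sg i) * p 0 i * (rc (sg i) * conjc (p 0 i)) = rc (sg i) * rc (sg i) * (p 0 i * conjc (p 0 i)).
    by ring.
  by rewrite -rcM sg2 (_ : rc 1 = 1) ?mul1r.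
have -> : H q p = rc (\sum_i eps i * sg i * nc (p 0 i) ^+ 2).
  rewrite /hf; transitivity (\sum_i rc (eps i * sg i * nc (p 0 i) ^+ 2)).
    by apply: eq_bigr => i _; rewrite !mxE -mulrA mulcJ mulrA -!rcM.
  by elim/big_rec2: _ => [//|i x y _ ->]; rewrite rcD.
rewrite rc_eq0 gt_eqF // (bigD1 j) //= ltr_pwDl ?sumr_ge0 //.
  rewrite mulr_gt0 ?exprn_gt0 ?nc_gt0 // lt_def sge andbT mulf_neq0 //.
  by rewrite /sg; case: ifP => _; rewrite ?oppr_eq0 oner_eq0.
by move=> i _; rewrite mulr_ge0 // sqr_ge0.
Qed.

End NonradicalPart.

Section GlobalSimilarity.
Variables (R : realType) (n n' : nat) (eps : 'I_n -> R) (eps' : 'I_n' -> R).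
Notation V := 'rV[R[i]]_n.
Notation W := 'rV[R[i]]_n'.
Notation nc := (@Normc.normc R).
Notation H := (hf eps).
Notation H' := (hf eps').
Notation N := (hq eps).
Notation N' := (hq eps').
Variables (U : V -> Prop) (F : V -> W).

(** F is merely a choice of representatives; holomorphy is carried by f, and the scalar relating
    them may vary from point to point without any regularity. *)
Definition local_lift z0 d (f : V -> W) := 0 < d /\
  forall z, vn (z - z0) < d -> [/\ U z, (forall i, vhol (fun w => f w 0 i) z) &
     exists c, c != 0 /\ F z = c *: f z].

Hypothesis U0 : ~ U 0.
Hypothesis lifts : forall z0, U z0 -> exists d f, local_lift z0 d f.
Hypothesis homF : forall z c, U z -> c != 0 -> exists b, b != 0 /\ F (c *: z) = b *: F z.
Hypothesis posF : forall z, U z -> 0 < N z -> 0 < N' (F z).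
Hypothesis negF : forall z, U z -> N z < 0 -> N' (F z) < 0.
Hypothesis pos2 : (2 <= #|Pos eps|)%N.
Hypothesis neg2 : (2 <= #|Neg eps|)%N.
Hypothesis posle : (#|Pos eps'| <= #|Pos eps|)%N.

Lemma vhol_nonrad (f : V -> W) z i : (forall i, vhol (fun w => f w 0 i) z) ->
  vhol (fun w => nonrad eps' (f w) 0 i) z.
Proof.
move=> hf; case: (eqVneq (eps' i) 0) => e0.
  exists (fun=> 0) => e e_gt0; exists 1 => // w _; rewrite !nonradE e0 eqxx.
  by rewrite subrr sub0r big1 ?oppr0 ?nc0 ?mulr_ge0 ?vn_ge0 ?ltW // => j _; rewrite mul0r.
have [l hl] := hf i; exists l => e e_gt0; have [d d0 hd] := hl e e_gt0.
by exists d => // w /hd; rewrite !nonradE (negbTE e0).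
Qed.

Lemma lift_sign z0 d f : local_lift z0 d f -> forall z, vn (z - z0) < d ->
  (0 < N z -> 0 < N' (f z)) /\ (N z < 0 -> N' (f z) < 0).
Proof.
move=> [_ hf] z /hf[Uz _ [c [c0 Fz]]]; have c2 : 0 < nc c ^+ 2 by rewrite exprn_gt0 // nc_gt0.
split=> h.
  by have := posF Uz h; rewrite Fz hqZ pmulr_rgt0.
by have := negF Uz h; rewrite Fz hqZ pmulr_rlt0.
Qed.

(** A null point is a limit of positive and of negative points, so by continuity the norm of its
    image is neither positive nor negative. *)
Lemma lift_null z0 d f : local_lift z0 d f -> forall z, vn (z - z0) < d ->
  H z z = 0 -> H' (f z) (f z) = 0.
Proof.
move=> hl z hz zz; have [_ hf] := hl; have [Uz holz _] := hf z hz.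
pose Q w := \sum_i rc (eps' i) * (f w 0 i * conjc (f w 0 i)).
have cQ : vcont Q z.
  apply: vcont_sum => i; apply: vcontM; first exact: vcont_cst.
  by apply: vcontM; [|apply: vcont_conj]; exact: vhol_vcont.
have dz : 0 < d - vn (z - z0) by rewrite subr_gt0.
have inB y e : vn (y - z) < Num.min e (d - vn (z - z0)) -> vn (y - z) < e /\ vn (y - z0) < d.
  rewrite lt_min => /andP[h1 h2]; split=> //.
  by apply: le_lt_trans (vn_dist _ _ z) _; rewrite -ltrBrDr.
have QE y : complex.Re (Q y) = N' (f y) by [].
apply: hf_hq0; apply/eqP; rewrite eq_le; apply/andP; split; rewrite leNgt; apply/negP => h.
- have [e e0 he] := vcont_Re_gt cQ h.
  have m0 : 0 < Num.min e (d - vn (z - z0)) by rewrite lt_min e0.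
  have [y /inB[/he y1 y2] Ny] := exists_negative neg2 zz m0.
  have [_ /(_ Ny)] := lift_sign hl y2; rewrite -QE => h2.
  by have := lt_trans y1 h2; rewrite ltxx.
- have [e e0 he] := vcont_Re_lt cQ h.
  have m0 : 0 < Num.min e (d - vn (z - z0)) by rewrite lt_min e0.
  have [y /inB[/he y1 y2] Ny] := exists_positive pos2 zz m0.
  have [/(_ Ny) + _] := lift_sign hl y2; rewrite -QE => h2.
  by have := lt_trans y1 h2; rewrite ltxx.
Qed.

Lemma lift_parallel z0 d f : local_lift z0 d f -> forall z c, vn (z - z0) < d ->
  vn (c *: z - z0) < d -> exists b, f (c *: z) = b *: f z.
Proof.
move=> [_ hf] z c /hf[Uz _ [a [a0 Fz]]] /hf[Ucz _ [a' [a'0 Fcz]]].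
have c0 : c != 0 by apply/eqP => c0; move: Ucz; rewrite c0 scale0r.
have [b [b0 FE]] := homF Uz c0.
exists (a'^-1 * (b * a)); apply: (@scalerI _ _ a') => //.
by rewrite -Fcz FE Fz !scalerA mulVKf.
Qed.

(* Null points where the image is radical, or which are themselves radical,
   cannot exhaust the null cone near p. *)
Lemma good_null_point p d f : local_lift p d f -> H p p = 0 ->
  exists p1 j, [/\ vn (p1 - p) < d, H p1 p1 = 0, nonrad eps' (f p1) != 0, eps j != 0 & p1 0 j != 0].
Proof.
move=> hl pp; have [d0 hf] := hl.
apply: contrapT => hn.
(* Without such a point these products vanish at all null vectors near p, hence near p by the sign
   change argument, and a positive y contradicts this. *)
have vanish i j y : eps j != 0 -> vn (y - p) < d / 8 -> nonrad eps' (f y) 0 i * y 0 j = 0.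
  move=> ej hy.
  have d8 : 0 < d / 8 by rewrite divr_gt0.
  have [y1 y1p Ny1] := exists_positive pos2 pp d8.
  have [y2 y2p Ny2] := exists_negative neg2 pp d8.
  apply: (@sign_change_vanish R n (fun=> True) p d (fun z => H z z)
    (fun y => nonrad eps' (f y) 0 i * y 0 j) y1 y2 d0) => //.
  - move=> y' y'' t _ _ hB; apply: cholM; last exact: chol_line.
    have [_ holz _] := hf _ hB.
    apply: (@vhol_chain _ _ (fun w => nonrad eps' (f w) 0 i) (fun s => y' + s *: (y'' - y'))).
      exact: vhol_nonrad.
    by move=> k; exact: chol_line.
  - by move=> z; exact: vcont_hq.
  - move=> z _ hz hq0; apply/eqP; rewrite mulf_eq0; apply/orP.
    have [fz|/eqP fz] := eqVneq (nonrad eps' (f z)) 0; first by left; rewrite fz mxE.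
    right; apply/negPn/negP => zj; apply: hn; exists z, j; split=> //.
      exact: hf_hq0.
    exact/eqP.
have d8 : 0 < d / 8 by rewrite divr_gt0.
have [y yp Ny] := exists_positive pos2 pp d8.
have yd : vn (y - p) < d by apply: lt_trans yp _; rewrite ltr_divn.
have [/(_ Ny) Nfy _] := lift_sign hl yd.
have /rV0Pn[i fi] : nonrad eps' (f y) != 0.
  by apply: (@nonzero_of_hq _ _ eps'); rewrite hq_nonrad gt_eqF.
have [j [ej yj]] : exists j, eps j != 0 /\ y 0 j != 0.
  apply: contrapT => hy; move: Ny; rewrite hqE big1 ?ltxx // => j _.
  have [->|ej] := eqVneq (eps j) 0; first by rewrite mul0r.
  have [->|yj] := eqVneq (y 0 j) 0; first by rewrite nc0 expr0n mulr0.
  by exfalso; apply: hy; exists j.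
by have /eqP := vanish i j y ej yp; rewrite mulf_eq0 (negbTE fi) (negbTE yj).
Qed.

(** The centre moves from p to a nearby null p1 that has a null partner and whose image is not
    radical; the local results are applied there. *)
Theorem similarity_near_null p : U p -> H p p = 0 -> exists p1 (d : R) (L : V -> W) (kap : R),
  [/\ U p1, 0 < d /\ 0 < kap, linear_map L,
    forall x y, H' (L x) (L y) = rc kap * H x y &
    forall x, vn (x - p1) < d -> forall i j, det2 (nonrad eps' (F x)) (L x) i j = 0].
Proof.
move=> Up pp; have [d [f hl]] := lifts Up.
have [p1 [j [p1p p1p1 fp1 ej pj]]] := good_null_point hl pp.
have [d0 hf] := hl; have [Up1 _ _] := hf _ p1p.
have [q [qq qp]] := null_partner p1p1 ej pj.
pose g z := nonrad eps' (f z).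
pose r1 := d - vn (p1 - p); have r10 : 0 < r1 by rewrite subr_gt0.
have inB z : vn (z - p1) < r1 -> vn (z - p) < d.
  by move=> h; apply: le_lt_trans (vn_dist _ _ p1) _; rewrite -ltrBrDr.
have holg z i : vn (z - p1) < r1 -> vhol (fun w => g w 0 i) z.
  by move=> /inB/hf[_ holz _]; exact: vhol_nonrad.
have nullg z : vn (z - p1) < r1 -> H z z = 0 -> H' (g z) (g z) = 0.
  by move=> /inB hz zz; rewrite hf_nonrad; exact: lift_null hl z hz zz.
have [rho [rho0 rho1 orthg]] : exists rho, [/\ 0 < rho, rho <= r1 & forall z w,
    vn (z - p1) < rho -> vn (w - p1) < rho -> H z w = 0 -> H' (g z) (g w) = 0].
  have [rho rho0 h] := polarization r10 qq p1p1 qp holg nullg.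
  exists (Num.min rho r1); split; [by rewrite lt_min rho0|by rewrite ge_min lexx orbT|].
  by move=> z w; rewrite !lt_min => /andP[h1 _] /andP[h2 _]; exact: h.
have inB' z : vn (z - p1) < rho -> vn (z - p1) < r1 by move=> h; apply: lt_le_trans h rho1.
have holg' z i : vn (z - p1) < rho -> vhol (fun w => g w 0 i) z by move=> /inB'; exact: holg.
have posg z : vn (z - p1) < rho -> 0 < N z -> 0 < N' (g z).
  by move=> /inB'/inB hz Nz; rewrite hq_nonrad; have [/(_ Nz)] := lift_sign hl hz.
have negg z : vn (z - p1) < rho -> N z < 0 -> N' (g z) < 0.
  by move=> /inB'/inB hz Nz; rewrite hq_nonrad; have [_ /(_ Nz)] := lift_sign hl hz.
have radg z i : eps' i = 0 -> g z 0 i = 0 by exact: nonrad_rad.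
have homg z c : vn (z - p1) < rho -> vn (c *: z - p1) < rho -> forall i j, det2 (g z) (g (c *: z)) i j = 0.
  move=> /inB'/inB h1 /inB'/inB h2 i k; have [b bE] := lift_parallel hl h1 h2.
  by rewrite /g bE nonradZ -[X in det2 X]scale1r det2_scale.
have [z0 [sg [rho3 [sg0 rho30 rho3le hz0]]]] :=
  good_points rho0 holg' radg orthg posg pos2 neg2 posle p1p1.
have pq : H p1 q != 0 by rewrite hfC conjc_eq0.
have [z [T [v [i [k [hz pz dT Tv]]]]]] :=
  nondegenerate_differential rho0 holg' posg negg p1p1 neg2 sg0 pq
    (fun z hz => conj (let: And4 a _ _ _ := hz0 z hz in a) (let: And4 _ b _ _ := hz0 z hz in b)).
have [zp Nz pzs zcol] := hz0 z hz.
have [L [kap [kap0 Llin Lsim Lpar]]] := @local_similarity R n n' eps eps' g p1 rho rho0 holg' orthg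
  posg negg homg p1p1 fp1 pos2 neg2 z v rho3 T i k rho30 rho3le zp Nz pzs zcol pz dT Tv.
exists p1, (rho / 4), L, kap; split=> //; first by rewrite divr_gt0.
move=> x hx a b; have xr : vn (x - p1) < rho by move: hx; have := rho0; lra.
have [_ _ [c [c0 Fx]]] := hf x (inB _ (inB' _ xr)).
have := Lpar x hx a b; rewrite Fx nonradZ /det2 -/(g x) !mxE => h.
by rewrite -!mulrA -mulrBr h mulr0.
Qed.

Hypothesis connU : forall A : V -> Prop, (exists2 x, U x & A x) ->
  (forall x, U x -> A x -> exists2 d, 0 < d & forall y, vn (y - x) < d -> A y) ->
  (forall x, U x -> (forall d, 0 < d -> exists2 y, vn (y - x) < d & A y) -> A x) ->
  forall x, U x -> A x.

Theorem global_similarity p : U p -> H p p = 0 -> exists (L : V -> W) (kap : R),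
  [/\ 0 < kap, linear_map L, forall x y, H' (L x) (L y) = rc kap * H x y &
    forall x, U x -> forall i j, det2 (nonrad eps' (F x)) (L x) i j = 0].
Proof.
move=> Up pp; have [p1 [d1 [L [kap [Up1 [d10 kap0] Llin Lsim Lpar]]]]] := similarity_near_null Up pp.
exists L, kap; split=> //.
pose K x := forall i j, det2 (nonrad eps' (F x)) (L x) i j = 0.
(* Asking for parallelism on a whole ball makes A open at once; closedness is the identity theorem
   for a lift at the limit point. *)
pose A x := exists2 d, 0 < d & forall y, vn (y - x) < d -> K y.
suff hA x : U x -> A x by move=> x Ux; have [d d0] := hA x Ux; apply; rewrite subrr vn0.
apply: connU x.
- by exists p1 => //; exists d1.
- move=> x _ [d d0 hd]; exists (d / 2); first by rewrite divr_gt0.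
  move=> y hy; exists (d / 2); first by rewrite divr_gt0.
  by move=> z hz; apply: hd; apply: le_lt_trans (vn_dist _ _ y) _; rewrite [d]splitr ltrD.
move=> x Ux hx; have [d [f [d0 hf]]] := lifts Ux.
have d4 : 0 < d / 4 by rewrite divr_gt0.
have dd y : vn (y - x) < d / 4 -> vn (y - x) < d.
  by move=> h; apply: lt_trans h _; rewrite ltr_divn.
have [y yx [e e0 he]] := hx _ d4.
have yd : 0 < d / 4 - vn (y - x) by rewrite subr_gt0.
exists (d / 4) => // w hw i j.
have [_ _ [c [c0 Fw]]] := hf w (dd _ hw).
suff h : det2 (nonrad eps' (f w)) (L w) i j = 0.
  by rewrite Fw nonradZ; move: h; rewrite /det2 !mxE => h; rewrite -!mulrA -mulrBr h mulr0.
apply: (@identity_ball R n x y d (Num.min e (d / 4 - vn (y - x)))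
  (fun w => det2 (nonrad eps' (f w)) (L w) i j)) => //.
- move=> y' v t hB; have [_ holz _] := hf _ hB.
  have cL b : chol (fun s => L (y' + s *: v) 0 b) t.
    apply: (@chol_ext _ (fun s => L y' 0 b + s * L v 0 b)).
      by move=> s'; rewrite Llin.1 Llin.2 !mxE.
    apply: cholD; first exact: chol_cst.
    by apply: cholM; [exact: chol_id|exact: chol_cst].
  have cf b : chol (fun s => nonrad eps' (f (y' + s *: v)) 0 b) t.
    apply: (@vhol_chain _ _ (fun w => nonrad eps' (f w) 0 b) (fun s => y' + s *: v)).
      exact: vhol_nonrad.
    by move=> k; exact: chol_line.
  by apply: cholB; apply: cholM.
- by rewrite lt_min e0.
- move=> w'; rewrite lt_min => /andP[h1 h2].
  have w'd : vn (w' - x) < d.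
    by apply: dd; apply: le_lt_trans (vn_dist _ _ y) _; rewrite -ltrBrDr.
  have [_ _ [c' [c'0 Fw']]] := hf w' w'd.
  have := he w' h1 i j; rewrite Fw' nonradZ /det2 !mxE -!mulrA -mulrBr => /eqP.
  by rewrite mulf_eq0 (negbTE c'0) => /eqP.
Qed.

End GlobalSimilarity.

(** * Maps into projective space *)

Section Bridge.
Variables (R : realType).
Notation C := ((R[i])^o).
Notation nc := (@Normc.normc R).

Lemma rc_lt (a b : R) : (rc a < rc b) = (a < b).
Proof. by rewrite ltcE /= eqxx. Qed.
Lemma rc_le (a b : R) : (rc a <= rc b) = (a <= b).
Proof. by rewrite lecE /= eqxx. Qed.
(** Only real numbers are comparable with 0 in the order on complex numbers, so complex-valued radii
    are real. *)
Lemma pos_rc (e : R[i]) : 0 < e -> exists2 d : R, 0 < d & e = rc d.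
Proof. by case: e => a b; rewrite ltcE /= => /andP[/eqP -> a0]; exists a. Qed.
Lemma nneg_rc (e : R[i]) : 0 <= e -> exists2 d : R, 0 <= d & e = rc d.
Proof. by case: e => a b; rewrite lecE /= => /andP[/eqP -> a0]; exists a. Qed.

Lemma ball_coord n (z w : Cvec R n) (e : R) :
  ball z (rc e) w <-> 0 < e /\ forall i, nc (z 0 i - w 0 i) < e.
Proof.
split=> -[e0 h]; split.
- by move: e0; rewrite -[0 : C]/(rc 0) rc_lt.
- by move=> i; have := h 0 i; rewrite /ball /= -[`|_|]/(rc (nc _)) rc_lt.
- by rewrite -[0 : C]/(rc 0) rc_lt.
by move=> i j; rewrite ord1; have := h j; rewrite -rc_lt; exact.
Qed.

Lemma vn_lt_ball n (z w : Cvec R n) (e : R) : vn (w - z) < e -> ball z (rc e) w.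
Proof.
move=> h; apply/ball_coord; split=> [|i]; first exact: le_lt_trans (vn_ge0 _) h.
apply: le_lt_trans h.
by have := vn_coord (w - z) i; rewrite !mxE nc_sub.
Qed.

(** The ball bounds each of the n coordinates; the divisor n + 1 keeps the estimate strict and
    covers n = 0. *)
Lemma ball_vn_lt n (z w : Cvec R n) (e : R) : ball z (rc (e / n.+1%:R)) w -> vn (w - z) < e.
Proof.
move=> /ball_coord[e0 h].
have {}e0 : 0 < e by move: e0; rewrite pmulr_lgt0 // invr_gt0 ltr0n.
apply: (@le_lt_trans _ _ (n%:R * (e / n.+1%:R))).
  rewrite /vn -[X in X%:R * _]card_ord mulr_natl -sumr_const.
  by apply: ler_sum => i _; rewrite !mxE nc_sub ltW.
by rewrite mulrA ltr_pdivrMr ?ltr0n // mulrC ltr_pM2l // ltr_nat.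
Qed.

Lemma norm_rc n (M : Cvec R n) (a : R) :
  (`|M| < rc a) <-> 0 < a /\ forall i, nc (M 0 i) < a.
Proof.
have : ball (0 : Cvec R n) (rc a) M <-> `|M| < rc a.
  by rewrite mx_norm_ball /ball_ /= sub0r normrN.
move=> <-; rewrite ball_coord.
by split=> -[a0 h]; split=> // i; have := h i; rewrite mxE sub0r ncN.
Qed.

Lemma coord_le_norm n (M : Cvec R n) (a : R) i : `|M| <= rc a -> nc (M 0 i) <= a.
Proof.
move=> h; apply/ler_addgt0Pr => e e0; apply: ltW.
have : `|M| < rc (a + e) by apply: le_lt_trans h _; rewrite rc_lt ltrDl.
by move/norm_rc => [_]; exact.
Qed.

Lemma norm_le_vn n (M : Cvec R n) : `|M| <= rc (vn M).
Proof.
have [a a0 aE] := nneg_rc (normr_ge0 M); rewrite aE rc_le.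
apply/ler_addgt0Pr => e e0; apply: ltW.
rewrite -rc_lt -aE; apply/norm_rc; split=> [|i]; first exact: ltr_wpDl (vn_ge0 _) e0.
apply: (@le_lt_trans _ _ (vn M)); first exact: vn_coord.
by rewrite ltrDl.
Qed.

Lemma nbhs_vn n (z : Cvec R n) (A : set (Cvec R n)) :
  nbhs z A <-> exists2 d : R, 0 < d & forall w, vn (w - z) < d -> A w.
Proof.
split=> [/nbhs_ballP[e /= /pos_rc[d d0 ->] h]|[d d0 h]].
  by exists d => // w /vn_lt_ball; exact: h.
apply/nbhs_ballP; exists (rc (d / n.+1%:R)) => /=.
  by have := rc_lt 0 (d / n.+1%:R); rewrite divr_gt0 // => ->.
by move=> w /ball_vn_lt; exact: h.
Qed.

Lemma differentiable_vhol n n' (f : Cvec R n -> Cvec R n') z i :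
  differentiable f z -> vhol (fun w => f w 0 i) z.
Proof.
move=> df; have := diff_locally df; move=> /eqaddoP hE.
have dlin : linear_map (fun x => 'd f z x : 'rV[R[i]]_n').
  by split=> [x y|c x]; [exact: linearD|exact: linearZ].
exists (fun j => ('d f z (delta_mx 0 j) : 'rV[R[i]]_n') 0 i) => e e0.
have /hE : 0 < rc e by have := rc_lt 0 e; rewrite e0.
move=> /nbhs_vn[d d0 hd]; exists d => // w hw.
have := hd (w - z); rewrite subr0 => /(_ hw).
rewrite !fctE /= subrK => hb.
have {}hb : `|f w - (f z + 'd f z (w - z))| <= rc (e * vn (w - z)).
  apply: le_trans hb _; rewrite rcM ler_wpM2l ?norm_le_vn //.
  by rewrite -[0 : C]/(rc 0) rc_le ltW.
have := coord_le_norm i hb; rewrite !mxE opprD addrA.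
have -> : ('d f z (w - z) : 'rV[R[i]]_n') 0 i = \sum_j ('d f z (delta_mx 0 j) : 'rV[R[i]]_n') 0 i * (w - z) 0 j.
  rewrite (linear_map_matrix dlin) mxE; apply: eq_bigr => j _.
  by rewrite !mxE mulrC.
by [].
Qed.

Lemma connected_vn n (U : set (Cvec R n)) : connected U -> forall A : Cvec R n -> Prop,
  (exists2 x, U x & A x) ->
  (forall x, U x -> A x -> exists2 d : R, 0 < d & forall y, vn (y - x) < d -> A y) ->
  (forall x, U x -> (forall d : R, 0 < d -> exists2 y, vn (y - x) < d & A y) -> A x) ->
  forall x, U x -> A x.
Proof.
move=> cU A [x0 Ux0 Ax0] oA cA.
pose B := [set x | U x /\ A x].
suff BU : B = U by move=> x Ux; have [] : B x by rewrite BU.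
apply: cU.
- by exists x0.
- exists [set x | \forall y \near x, A y]; first exact: open_interior.
  apply/seteqP; split=> x.
    by move=> [Ux Ax]; split=> //; apply/nbhs_vn; exact: oA.
  by move=> [Ux /nbhs_singleton Ax].
- exists (closure [set x | A x]); first exact: closed_closure.
  apply/seteqP; split=> x.
    by move=> [Ux Ax]; split=> //; exact: subset_closure.
  move=> [Ux clx]; split=> //; apply: cA => // d d0.
  have [] := clx [set y | vn (y - x) < d]; first by apply/nbhs_vn; exists d.
  by move=> y [Ay hy]; exists y.
Qed.

End Bridge.

(** * Direct decompositions given by idempotents *)

Section IdempotentDecomposition.
Variables (K : fieldType) (m : nat) (P : 'M[K]_m).
Hypothesis PP : P *m P = P.

Lemma mul_compl_idempotent : (1%:M - P) *m P = 0.
Proof. by rewrite mulmxBl mul1mx PP subrr. Qed.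

Lemma sub_idempotent k (W : 'M[K]_(k, m)) : (W <= P)%MS -> W *m P = W.
Proof. by case/submxP => D ->; rewrite -mulmxA PP. Qed.

Lemma sub_idempotent_compl k (W : 'M[K]_(k, m)) : (W <= 1%:M - P)%MS -> W *m P = 0.
Proof. by case/submxP => D ->; rewrite -mulmxA mul_compl_idempotent mulmx0. Qed.

Lemma capmx_idempotent : (P :&: (1%:M - P) = 0)%MS.
Proof.
apply/eqP; rewrite -submx0; apply/rV_subP => v; rewrite sub_capmx => /andP[vP vQ].
by rewrite -(sub_idempotent vP) (sub_idempotent_compl vQ) sub0mx.
Qed.

Lemma addsmx_idempotent : (P + (1%:M - P) == 1%:M)%MS.
Proof.
rewrite submx1 /=; have {1}-> : 1%:M = P + (1%:M - P) :> 'M[K]_m by rewrite addrC subrK.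
by rewrite addmx_sub // ?addsmxSl ?addsmxSr.
Qed.

Lemma proj_idempotent k (W : 'M[K]_(k, m)) : W *m proj_mx P (1%:M - P) = W *m P.
Proof.
have {1}-> : W = W *m P + W *m (1%:M - P) by rewrite mulmxBr mulmx1 addrC subrK.
rewrite mulmxDl (proj_mx_id capmx_idempotent (submxMl _ _)).
by rewrite (proj_mx_0 capmx_idempotent (submxMl _ _)) addr0.
Qed.

End IdempotentDecomposition.

Section Isometry.
Variables (R : realType) (n n' : nat) (eps : 'I_n -> R) (eps' : 'I_n' -> R).
Variables (U : set (Cvec R n)) (F : Cvec R n -> Cvec R n').
Hypothesis coneU : is_cone U.
Hypothesis connU : connected U.
Hypothesis projF : is_proj_map U F.
Hypothesis holF : proj_holomorphic U F.
Hypothesis posF : forall z, U z -> 0 < hq eps z -> 0 < hq eps' (F z).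
Hypothesis negF : forall z, U z -> hq eps z < 0 -> hq eps' (F z) < 0.
Hypothesis pos2 : (2 <= #|Pos eps|)%N.
Hypothesis neg2 : (2 <= #|Neg eps|)%N.
Hypothesis posle : (#|Pos eps'| <= #|Pos eps|)%N.

Definition parallel (u v : Cvec R n') := forall i j, det2 u v i j = 0.

Lemma proj_local_lift z0 : U z0 -> exists d f, local_lift U F z0 d f.
Proof.
move=> /holF[V [f [oV Vz0 VU hf]]].
have [d d0 hd] : exists2 d : R, 0 < d & forall w, vn (w - z0) < d -> V w.
  by apply/nbhs_vn; exact: open_nbhs_nbhs.
exists d, f; split=> // z /hd Vz; have [df _ eqF] := hf z Vz.
by split; [exact: VU|move=> i; exact: differentiable_vhol|].
Qed.

(** The factor 1 / sqrt kap turns the similarity into an isometry; dropping the radical coordinates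
    of L preserves the form and the parallelism and puts the image into the nonradical summand. *)
Lemma parallel_isometry p : U p -> hf eps p p = 0 -> exists M : 'M[(R[i])^o]_(n, n'),
  [/\ forall u v : Cvec R n, hf eps' (u *m M) (v *m M) = hf eps u v,
      forall z : Cvec R n, nonrad eps' (z *m M) = z *m M &
      forall z, U z -> parallel (nonrad eps' (F z)) (z *m M)].
Proof.
move=> Up pp.
have U0 : ~ U 0 by move=> /(proj1 coneU); rewrite eqxx.
have [L [kap [kap0 [LD LZ] Lsim Lpar]]] := @global_similarity R n n' eps eps' U F U0
  proj_local_lift (proj2 projF) posF negF pos2 neg2 posle (connected_vn connU) p Up pp.
pose c := (Num.sqrt kap)^-1.
pose T x := rc c *: nonrad eps' (L x).
have Tlin : linear_map T.
  split=> [x y|b x]; rewrite /T; first by rewrite LD nonradD scalerDr.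
  by rewrite LZ nonradZ !scalerA mulrC.
exists (\matrix_(j, i) T (delta_mx 0 j) 0 i).
have TE (z : Cvec R n) : z *m (\matrix_(j, i) T (delta_mx 0 j) 0 i) = T z.
  by rewrite -(linear_map_matrix Tlin).
split=> [u v|z|z Uz i j]; rewrite !TE /T.
- rewrite hfZl hfZr hf_nonrad Lsim conjc_rc !mulrA -!rcM.
  rewrite (_ : c * c * kap = 1) ?(mul1r (hf eps u v)) //.
  by rewrite -expr2 exprVn sqr_sqrtr ?mulVf ?gt_eqF // ltW.
- by apply/rowP => i; rewrite nonradE; case: eqP => // e0; rewrite mxE nonrad_rad ?mulr0.
have := Lpar z Uz i j; rewrite /det2 !mxE => h.
case: (eqVneq (eps' i) 0) => ei; first by rewrite !(mul0r, mulr0) subrr.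
case: (eqVneq (eps' j) 0) => ej; first by rewrite !(mul0r, mulr0) subrr.
move: h; rewrite (negbTE ei) (negbTE ej) => h.
by rewrite mulrCA (mulrCA (F z 0 j)) -mulrBr h mulr0.
Qed.

End Isometry.

Lemma nonradN (R : realType) n (eps : 'I_n -> R) x : nonrad (fun i => - eps i) x = nonrad eps x.
Proof. by apply/rowP => i; rewrite !nonradE oppr_eq0. Qed.

(** * The standard signature and its nonradical projector *)

Section StandardForm.
Variables (R : realType) (r s t : nat).

Definition signature (j : 'I_(r + s + t)) : R :=
  if (j < r)%N then 1 else if (j < r + s)%N then -1 else 0.

Lemma hermE (z w : Cvec R (r + s + t)) : herm z w = hf signature z w.
Proof.
apply: eq_bigr => j _; congr (_ * _); rewrite /hsign /signature.
by case: ifP => _ //; case: ifP => _ //; rewrite rcN.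
Qed.

Lemma herm_gt0 (z : Cvec R (r + s + t)) : (0 < herm z z) = (0 < hq signature z).
Proof. by rewrite hermE hf_diag -[0 : R[i]^o]/(rc 0) rc_lt. Qed.

Lemma herm_lt0 (z : Cvec R (r + s + t)) : (herm z z < 0) = (hq signature z < 0).
Proof. by rewrite hermE hf_diag -[0 : R[i]^o]/(rc 0) rc_lt. Qed.

Lemma card_ltn_ord m k : (k <= m)%N -> #|finset (fun i : 'I_m => (i < k)%N)| = k.
Proof.
move=> km; rewrite -sum1_card; under eq_bigl do rewrite inE.
by rewrite -(big_ord_widen m (fun=> 1%N) km) sum1_card card_ord.
Qed.

Lemma card_Pos_signature : #|Pos signature| = r.
Proof.
rewrite -[RHS](@card_ltn_ord (r + s + t) r) -?addnA ?leq_addr //.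
apply: eq_card => i; rewrite !inE /signature.
by case: ifP => _; rewrite ?ltr01 //; case: ifP => _; rewrite ?ltxx // oppr_gt0 ltr10.
Qed.

Lemma card_Neg_signature : #|Neg signature| = s.
Proof.
have -> : Neg signature = finset (fun i : 'I_(r + s + t) => (i < r + s)%N)
    :\: finset (fun i : 'I_(r + s + t) => (i < r)%N).
  apply/setP => i; rewrite !inE /signature.
  case: ifP => _ /=; first by rewrite ltr10.
  by case: ifP => _; rewrite ?ltxx // oppr_lt0 ltr01.
rewrite cardsD (finset.setIidPr _); last first.
  by apply/fintype.subsetP => i; rewrite !inE => h; apply: leq_trans h _; exact: leq_addr.
by rewrite !card_ltn_ord -?addnA ?leq_addr ?addnA ?leq_addr // addKn.
Qed.

Lemma signature_eq0 j : (signature j == 0) = (r + s <= j)%N.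
Proof.
rewrite /signature; case: ltnP => jr.
  by rewrite oner_eq0 leqNgt (leq_trans jr (leq_addr _ _)).
by case: ltnP => _; rewrite ?oppr_eq0 ?oner_eq0 ?eqxx.
Qed.

End StandardForm.

Section NonradicalProjector.
Variables (R : realType) (n : nat) (eps : 'I_n -> R).
Notation C := ((R[i])^o).

Definition nonrad_mx : 'M[C]_n := diag_mx (\row_i (eps i != 0)%:R).

Lemma mul_nonrad_mx (x : Cvec R n) : x *m nonrad_mx = nonrad eps x.
Proof.
apply/rowP => i; rewrite /nonrad_mx mul_mx_diag !mxE.
by case: eqP => _; rewrite ?mulr0 ?mulr1.
Qed.

Lemma nonrad_mx_idempotent : nonrad_mx *m nonrad_mx = nonrad_mx.
Proof.
rewrite /nonrad_mx mulmx_diag; congr diag_mx; apply/rowP => i; rewrite !mxE.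
by case: eqP => _; rewrite ?mulr0 ?mulr1.
Qed.

Lemma nonrad_mx_neq0 : (exists i, eps i != 0) -> nonrad_mx != 0.
Proof.
move=> [i ei]; apply/negP => /eqP/matrixP/(_ i i)/eqP.
by rewrite !mxE eqxx ei oner_eq0.
Qed.

Lemma compl_nonrad_mx_neq0 : (exists i, eps i == 0) -> 1%:M - nonrad_mx != 0.
Proof.
move=> [i ei]; apply/negP => /eqP/matrixP/(_ i i)/eqP.
by rewrite !mxE eqxx ei subr0 oner_eq0.
Qed.

End NonradicalProjector.

Lemma parallel_proj_eq (R : realType) n (u v : Cvec R n) :
  u != 0 -> v != 0 -> parallel u v -> proj_eq u v.
Proof.
move=> u0 v0 /(det2_parallel u0)[c vE]; have c0 : c != 0.
  by apply: contraNneq v0 => c0; rewrite vE c0 scale0r.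
by exists c^-1; rewrite invr_eq0 vE scalerA mulVf // scale1r.
Qed.

Theorem mainTheorem10 (R : realType) (r s t r' s' t' : nat)
    (U : set (Cvec R (r + s + t)))
    (F : Cvec R (r + s + t) -> Cvec R (r' + s' + t')) :
  (2 <= r)%N -> (2 <= s)%N ->
  is_cone U -> open U -> connected U ->
  (exists z0, U z0 /\ herm z0 z0 = 0) ->
  is_proj_map U F -> proj_holomorphic U F ->
  sign_preserving U F ->
  (r = r' \/ s = s') ->
  quasi_standard U F /\ (t' = 0%N -> standard U F).
Proof.
move=> r2 s2 coneU _ connU [p [Up pp]] projF holF sgnF rs.
pose eps := @signature R r s t; pose eps' := @signature R r' s' t'.
have posF z : U z -> 0 < hq eps z -> 0 < hq eps' (F z).
  by move=> /sgnF[]; rewrite !herm_gt0.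
have negF z : U z -> hq eps z < 0 -> hq eps' (F z) < 0.
  by move=> /sgnF[_]; rewrite !herm_lt0.
have {}pp : hf eps p p = 0 by rewrite -hermE.
have [M [Miso Mfix Mpar]] : exists M : 'M[(R[i])^o]_(r + s + t, r' + s' + t'),
  [/\ forall u v : Cvec R (r + s + t), hf eps' (u *m M) (v *m M) = hf eps u v,
      forall z : Cvec R (r + s + t), nonrad eps' (z *m M) = z *m M &
      forall z, U z -> parallel (nonrad eps' (F z)) (z *m M)].
  case: rs => rs.
    apply: (parallel_isometry coneU connU projF holF posF negF _ _ _ Up pp);
      by rewrite ?card_Pos_signature ?card_Neg_signature // rs.
  have [||||||M [Miso Mfix Mpar]] := @parallel_isometry R _ _
      (fun i => - eps i) (fun i => - eps' i) U F coneU connU projF holF _ _ _ _ _ p Up.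
  - by move=> z Uz; rewrite !hqN !oppr_gt0; exact: negF.
  - by move=> z Uz; rewrite !hqN !oppr_lt0; exact: posF.
  - by rewrite PosN card_Neg_signature.
  - by rewrite NegN card_Pos_signature.
  - by rewrite !PosN !card_Neg_signature rs.
  - by rewrite hfN pp oppr0.
  exists M; split=> [u v|z|z Uz].
  - by apply: oppr_inj; rewrite -!hfN.
  - by rewrite -nonradN.
  by rewrite -nonradN; exact: Mpar.
have isoM : lin_isometry M by move=> u v; rewrite !hermE; exact: Miso.
(* With t' = 0 no coordinate is radical, so [nonrad] is the identity and F itself is parallel to
   M. *)
have std : t' = 0%N -> standard U F.
  move=> t0; exists M; split=> // z Uz zM0.
  apply: parallel_proj_eq => //; first by have [] := projF => /(_ z Uz).
  move=> i j; rewrite -(Mpar z Uz i j); congr (det2 _ _ i j).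
  apply/rowP => k; rewrite nonradE signature_eq0 leqNgt.
  by have := ltn_ord k; rewrite {2}t0 addn0 => ->.
split=> //; have [t0|t0] := posnP t'; first by left; exact: std.
(* A is spanned by the nonradical and B by the radical coordinates; B is the radical of the form,
   hence orthogonal to everything, and serves as its own null subspace N. *)
right; pose A := nonrad_mx eps'; pose B := 1%:M - A.
have AA : A *m A = A by exact: nonrad_mx_idempotent.
have rs0 : (0 < r' + s')%N by case: rs => <-; rewrite ?addn_gt0 ?(ltnW r2) ?(ltnW s2) ?orbT.
exists A, B; split.
- split; first by apply/mxdirect_addsP; exact: capmx_idempotent.
  + exact: addsmx_idempotent.
  + apply: nonrad_mx_neq0.
    have h : (0 < r' + s' + t')%N by rewrite addn_gt0 rs0.
    by exists (Ordinal h); rewrite signature_eq0 -ltnNge.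
  apply: compl_nonrad_mx_neq0.
  have h : (r' + s' < r' + s' + t')%N by rewrite -{1}[(r' + s')%N]addn0 ltn_add2l.
  by exists (Ordinal h); rewrite signature_eq0.
- move=> a b _ /(sub_idempotent_compl AA) bA.
  by rewrite hermE -hf_nonrad -!mul_nonrad_mx bA hf0r.
- exists M; split=> //.
    have -> : M = M *m A; last exact: submxMl.
    by apply/row_matrixP => i; rewrite row_mul [row i M]rowE mul_nonrad_mx Mfix.
  move=> z Uz; rewrite (proj_idempotent AA) mul_nonrad_mx => Fz0 zM0.
  by apply: parallel_proj_eq => //; exact: Mpar.
exists B; split=> // [u v _ /(sub_idempotent_compl AA) vA|z Uz]; last exact: proj_mx_sub.
by rewrite hermE -hf_nonrad -!mul_nonrad_mx vA hf0r.
Qed.
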